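(* Let $l\geq 2$ be an integer. Every graph $G$ with $L(G)=\{3,3+2l\}$ satisfies $\chi(G)=\max\{3,\omega(G)\}$.
   Context: All graphs are finite and simple. For a graph $G$, $\chi(G)$ denotes the chromatic number, $\omega(G)$ the number of vertices of a largest clique, and $L(G)$ the set of all lengths of odd cycles contained in $G$. *)

(* Defs.v *)
From mathcomp Require Import all_boot.

Set Implicit Arguments.
Unset Strict Implicit.
Unset Printing Implicit Defensive.

Record sgraph := SGraph {
  vertex :> finType;
  adj : rel vertex;
  adj_sym : symmetric adj;
  adj_irrefl : irreflexive adj
}.

Definition proper_coloring (G : sgraph) (k : nat) (f : {ffun G -> 'I_k}) : bool :=
  [forall x, forall y, adj x y ==> (f x != f y)].

Definition colorable (G : sgraph) (k : nat) : bool :=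
  [exists f : {ffun G -> 'I_k}, proper_coloring f].

Lemma colorable_ex (G : sgraph) : exists k, colorable G k.
Proof.
exists #|G|; apply/existsP; exists [ffun x => enum_rank x].
apply/forallP => x; apply/forallP => y; apply/implyP => xy.
rewrite !ffunE (inj_eq enum_rank_inj).
by apply: contraTneq xy => ->; rewrite adj_irrefl.
Qed.

Definition chromatic_number (G : sgraph) : nat := ex_minn (colorable_ex G).

Definition clique (G : sgraph) (K : {set G}) : bool :=
  [forall x in K, forall y in K, (x != y) ==> adj x y].

Definition clique_number (G : sgraph) : nat :=
  \max_(K : {set G} | clique K) #|K|.

(* A cycle is a subgraph, not necessarily induced, given by the cyclic sequence
   of its distinct vertices.  The bound 2 < n is needed because ucycleb accepts
   the empty sequence and the two ends of an edge. *)
Definition has_cycle (G : sgraph) (n : nat) : bool :=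
  (2 < n) && [exists s : n.-tuple G, ucycleb (@adj G) s].

Definition odd_cycle_lengths (G : sgraph) : pred nat :=
  [pred n | odd n && has_cycle G n].

(* Main.v *)
(* Write m = 2l + 3 and let G be vertex-critical for 3 colours, without K4, with all odd
   cycle lengths in {3, m}.  A clique is not a cutset of G, and a 2-cut {x, y} has x-y paths
   of both parities on each side: by Menger, if one side had only one parity it would be
   bipartite, and then every colouring of x and y would extend to it.

   If G has no triangle, two odd cycles meet at least twice, so deleting an m-cycle C leaves
   a bipartite graph, and the lengths of the ears of C are determined by their parity.  Give
   one vertex of C its own colour, colour the rest of C and each component of G - C with the
   other two, and recolour the vertices that clash with C; for one of the two colourings of
   each component this works.

   If a triangle T shares no edge with another triangle, the paths through G - T between
   vertices of T have length m - 2 or m - 1.  Take a vertex q of G - T with three paths to T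
   that are disjoint apart from q: at least two of them have length l + 1, the third has
   length l or l + 1.  Length counting shows that some branch at q, or at a vertex reached
   by iterating the argument, is attached to q and one vertex of T only, and all paths
   between these two through the branch have the same length, against the 2-cut property.

   Otherwise every triangle lies in a diamond.  The same argument shows that the two middle
   vertices a, b of a diamond have degree 3, and the paths between the other two vertices
   c, d avoiding a, b have length 2l or 2l + 1.  Then G - {a, b} is coloured by distance to
   {c, d}, with c and d in the same colour.

   So every K4-free graph G with such odd cycle lengths is 3-colourable.  A graph that is
   vertex-critical for 4 colours cannot contain two different K4s (two disjoint paths between
   them give odd cycles whose lengths differ by 2), so deleting a vertex of a K4 leaves a
   3-colourable graph and G is 4-colourable. *)
Require Import Defs.
From mathcomp Require Import fingroup perm.
From mathcomp Require Import all_boot zify.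
From Stdlib Require Import Classical.

Set Implicit Arguments.
Unset Strict Implicit.
Unset Printing Implicit Defensive.

(** * Paths and cycles *)

(** The bound [2 <= l] makes the allowed odd lengths 3 and 2l + 3 differ by more than 2, so two odd
    cycles whose lengths differ by exactly 2 are impossible. Hence in each situation the lengths of
    the paths between two fixed roots through the rest of the graph lie in a window of at most two
    consecutive values. This is what the length counting rests on. Sums of two legs of a tripod lie
    in such windows, which forces every leg to be l or l + 1. A path that leaves a leg at distance i
    from the centre can be entered from the root of that leg or through the centre; the two lengths
    differ by at least 2i - 1, and usually by too much for the window. The tie i = 1 is settled by
    descent or by a triangle at the centre. If nothing leaves the leg, it can be replaced by one of
    the other parity, which the other legs forbid or which reduces to a shorter leg. In the last
    colouring the obstacle is an edge inside a level: one of its ends takes the third colour, and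
    the degree condition on middle vertices keeps such ends apart. *)

Section Paths.
Variable G : sgraph.
Implicit Types (x y z t u v : G) (W X Y Z : {set G}) (p s : seq G).

(** The vertex set [W] is carried instead of the vertex list, so that concatenation and disjointness
    are statements about sets; [k] counts edges, and [k = 0] is the one-vertex path. *)
Definition epath W x y k :=
  exists p, [/\ path (@adj G) x p, last x p = y, uniq (x :: p),
                W = [set z in x :: p] & size p = k].

Lemma adj_neq x y : adj x y -> x != y.
Proof. by apply: contraTneq => ->; rewrite adj_irrefl. Qed.

Lemma epath0 x : epath [set x] x x 0.
Proof. by exists [::]; split => //; apply/setP=> z; rewrite !inE. Qed.

Lemma epath1 x y : adj x y -> epath [set x; y] x y 1.
Proof.
move=> xy; exists [:: y]; split => //=; rewrite ?xy //.
- by rewrite inE (adj_neq xy).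
- by apply/setP=> z; rewrite !inE.
Qed.

Lemma epath_start W x y k : epath W x y k -> x \in W.
Proof. by case=> p [_ _ _ -> _]; rewrite !inE eqxx. Qed.

Lemma epath_end W x y k : epath W x y k -> y \in W.
Proof. by case=> p [_ <- _ -> _]; rewrite inE mem_last. Qed.

Lemma epath_sym W x y k : epath W x y k -> epath W y x k.
Proof.
case=> p [xp yp up -> <-]; exists (rev (belast x p)); split.
- by rewrite -yp rev_path; under eq_path do rewrite adj_sym.
- by case: p yp {xp up} => [|z p] //= yp; rewrite rev_cons last_rcons.
- by rewrite -yp -rev_rcons rev_uniq -lastI.
- by rewrite -yp -rev_rcons -lastI; apply/setP=> z; rewrite !inE mem_rev inE.
- by rewrite size_rev size_belast.
Qed.

Lemma epath_cat W1 W2 x y z k1 k2 :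
  epath W1 x y k1 -> epath W2 y z k2 ->
  (forall t, t \in W1 -> t \in W2 -> t = y) ->
  epath (W1 :|: W2) x z (k1 + k2).
Proof.
case=> p [xp yp up -> <-] [q [yq zq uq -> <-]] dis; exists (p ++ q); split.
- by rewrite cat_path xp yp.
- by rewrite last_cat yp.
- move: uq; rewrite cons_uniq => /andP[yNq uq]; rewrite -cat_cons cat_uniq up uq andbT /=.
  apply/hasPn=> t tq; apply/negP=> tp; case/negP: yNq.
  by rewrite -(dis t) // !inE // tq orbT.
- apply/setP=> t; rewrite !inE mem_cat orbA; case: (t \in q); rewrite ?orbT ?orbF //.
  have [->|] := eqVneq t y; last by rewrite orbF.
  by have := mem_last x p; rewrite yp inE => ->.
- by rewrite size_cat.
Qed.

Lemma epath_nil W x y : epath W x y 0 -> x = y /\ W = [set x].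
Proof.
by case=> -[|z p] [_ lp _ -> //= _]; split=> //; apply/setP=> z; rewrite !inE.
Qed.

Lemma epath_loop W x k : epath W x x k -> k = 0.
Proof.
case=> -[|z p] [_ lp] //; rewrite cons_uniq => /andP[xN _] _ _.
by rewrite -{1}lp /= mem_last in xN.
Qed.

Lemma epath_step W x y k : epath W x y k.+1 ->
  exists z W', [/\ adj x z, epath W' z y k, x \notin W' & W = x |: W'].
Proof.
case=> -[|z p] [//= /andP[xz zp] lp /andP[xN up] -> [<-]].
exists z, [set t in z :: p]; split=> //; rewrite ?inE //.
- by exists p.
- by apply/setP=> t; rewrite !inE.
Qed.

Lemma epath_consl W x z y k :
  adj x z -> epath W z y k -> x \notin W -> epath (x |: W) x y k.+1.
Proof.
move=> xz [p [zp lp up -> <-]]; rewrite inE => xN; exists (z :: p).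
by split=> //=; [rewrite xz | rewrite xN | apply/setP=> t; rewrite !inE].
Qed.

Lemma epath_split W x y z k : epath W x y k -> z \in W ->
  exists W1 W2 i j, [/\ epath W1 x z i, epath W2 z y j,
    (forall t, t \in W1 -> t \in W2 -> t = z), W = W1 :|: W2 & i + j = k].
Proof.
elim: k W x => [|k IH] W x.
  move=> /epath_nil[<- ->]; rewrite inE => /eqP->.
  by exists [set x], [set x], 0, 0; split=> //; try exact: epath0;
    [move=> t /set1P | rewrite setUid].
move=> /[dup] Wp /epath_step [w [W' [xw W'p xN ->]]]; rewrite inE => /orP[|zW'].
  rewrite inE => /eqP->; exists [set x], (x |: W'), 0, k.+1; split=> //.
  - exact: epath0.
  - exact: epath_consl W'p _.
  - by move=> t /set1P.
  - by rewrite setUA setUid.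
have [W1 [W2 [i [j [W1p W2p dis W'E ijk]]]]] := IH _ _ W'p zW'.
exists (x |: W1), W2, i.+1, j; split=> //.
- by apply: epath_consl W1p _ => //; apply: contra xN; rewrite W'E inE => ->.
- move=> t; rewrite !inE => /orP[/eqP->|]; last exact: dis.
  by move=> xW2; case/negP: xN; rewrite W'E inE xW2 orbT.
- by rewrite W'E setUA.
- by rewrite addSn ijk.
Qed.

Lemma epath_hit W x y k Z : epath W x y k -> y \in Z ->
  exists W' z i, [/\ epath W' x z i, W' \subset W, z \in Z,
    (forall t, t \in W' -> t \in Z -> t = z) & i <= k].
Proof.
elim: k W x => [|k IH] W x.
  move=> /epath_nil[<- ->] xZ; exists [set x], x, 0; split=> //; [exact: epath0|].
  by move=> t /set1P.
move=> Wp yZ; have [xZ|xZ] := boolP (x \in Z).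
  exists [set x], x, 0; split=> //; [exact: epath0| |by move=> t /set1P].
  by rewrite sub1set (epath_start Wp).
have [w [W' [xw W'p xN ->]]] := epath_step Wp.
have [W1 [z [i [W1p sub zZ hit ik]]]] := IH _ _ W'p yZ.
exists (x |: W1), z, i.+1; split=> //.
- by apply: epath_consl W1p _ => //; apply: contra xN; apply: (subsetP sub).
- exact: setUS.
- by move=> t; rewrite !inE => /orP[/eqP->|]; [rewrite (negPf xZ) | apply: hit].
Qed.

(** [connect (radj W) x x] holds for every [x], also outside [W]; this is why membership in [W] is
    assumed separately later on. *)
Definition radj W := [rel x y : G | [&& adj x y, x \in W & y \in W]].

Lemma radj_sym W : symmetric (radj W).
Proof. by move=> x y /=; rewrite adj_sym; case: (x \in W); case: (y \in W). Qed.

Lemma connect_radj_sym W : connect_sym (radj W).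
Proof. exact/sym_connect_sym/radj_sym. Qed.

Lemma connect_epath W x y : connect (radj W) x y -> x \in W ->
  exists W' k, epath W' x y k /\ W' \subset W.
Proof.
move=> /connectP[p xp ->] xW; case: (shortenP xp) => p' xp' up' sub'.
exists [set z in x :: p'], (size p'); split.
  exists p'; split=> //; apply: sub_path xp' => u v /=.
  by case/and3P.
apply/subsetP=> z; rewrite !inE => /orP[/eqP->//|zp'].
have : all (mem W) p' by elim: p' (x) xp' {up' sub' zp'} => //= u p' IH w
  /andP[/and3P[_ _ ->] /IH].
by move/allP; apply.
Qed.

Lemma epath_connect W W' x y k : epath W' x y k -> W' \subset W ->
  connect (radj W) x y.
Proof.
elim: k x W' => [|k IH] x W'; first by case/epath_nil=> ->.
move=> /epath_step[z [U [xz Up xN ->]]] sub; apply: (connect_trans (y := z)).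
  apply: connect1 => /=; rewrite xz (subsetP sub) ?(subsetP sub) // !inE ?eqxx //.
  by rewrite (epath_start Up) orbT.
by apply: IH Up _; apply: subset_trans sub; apply: subsetUr.
Qed.

(** The path is stopped at its first vertex in [Y]; the result, read backwards, is stopped at its
    first vertex in [X]. *)
Lemma connect_ear W X Y x y :
  connect (radj W) x y -> x \in W -> x \in X -> y \in Y ->
  exists W' x' y' k, [/\ epath W' x' y' k, W' \subset W, x' \in X & y' \in Y] /\
    (forall t, t \in W' -> t \in X -> t = x') /\
    (forall t, t \in W' -> t \in Y -> t = y').
Proof.
move=> cxy xW xX yY; have [W1 [k [W1p sub]]] := connect_epath cxy xW.
have [W2 [y' [i [W2p sub2 y'Y hit2 _]]]] := epath_hit W1p yY.
have [W3 [x' [j [W3p sub3 x'X hit3 _]]]] := epath_hit (epath_sym W2p) xX.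
exists W3, x', y', j; split; last by split=> // t /(subsetP sub3); apply: hit2.
split=> //; first exact: epath_sym.
by apply: subset_trans sub3 _; apply: subset_trans sub2 _.
Qed.

Definition cycle_of_length n := exists s, [/\ ucycle (@adj G) s, size s = n & 2 < n].

(** The bound [2 < k1 + k2] excludes that both paths are the same edge. The last clause records
    where the cycle lies, which [epath_cycle] forgets. *)
Lemma epath_cycle_in W1 W2 x y k1 k2 :
  epath W1 x y k1 -> epath W2 x y k2 -> x != y ->
  (forall t, t \in W1 -> t \in W2 -> t = x \/ t = y) -> 2 < k1 + k2 ->
  exists s, [/\ ucycle (@adj G) s, size s = k1 + k2 & {subset s <= W1 :|: W2}].
Proof.
move=> W1p /epath_sym; case: k2 => [/epath_nil[-> _]|k2]; first by rewrite eqxx.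
move=> /epath_step[z [W2' [yz W2p yN ->]]] xy dis k3.
case: W1p dis k3 => p [xp lp up -> <-] dis.
case: W2p yN dis => q [zq lq uq -> <-] yN dis k3.
exists (p ++ z :: q); split.
- rewrite /ucycle; apply/andP; split; last first.
    rewrite cat_uniq; move: up => /= /andP[xN ->]; move: uq => /= ->; rewrite andbT /=.
    rewrite negb_or; apply/andP; split; last first.
      apply/hasPn=> t tq; apply/negP=> tp.
      have := dis t; rewrite !inE tp tq !orbT => /(_ isT isT)[] E; subst t.
        by rewrite tp in xN.
      by rewrite !inE tq orbT in yN.
    apply/negP=> zp; have := dis z; rewrite !inE zp eqxx !orbT => /(_ isT isT)[] E; subst z.
      by rewrite zp in xN.
    by rewrite !inE eqxx in yN.
  rewrite /cycle; case E: (p ++ z :: q) => [|w r]; first by case: (p) E.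
  have : path (@adj G) x (p ++ z :: q) by rewrite cat_path xp lp /= yz.
  rewrite E rcons_path /= => /andP[xw ->] /=.
  by have -> : last w r = x by have := last_cat x p (z :: q); rewrite E /= lq.
- by rewrite size_cat.
- by move=> t; rewrite mem_cat !inE => /orP[->|/orP[]->]; rewrite ?orbT.
Qed.

Lemma epath_cycle W1 W2 x y k1 k2 :
  epath W1 x y k1 -> epath W2 x y k2 -> x != y ->
  (forall t, t \in W1 -> t \in W2 -> t = x \/ t = y) -> 2 < k1 + k2 ->
  cycle_of_length (k1 + k2).
Proof.
move=> W1p W2p xy dis k3; have [s [cs sz _]] := epath_cycle_in W1p W2p xy dis k3.
by exists s.
Qed.

Lemma cycle_arcs s x y : ucycle (@adj G) s -> x \in s -> y \in s -> x != y ->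
  exists W1 W2 i j, [/\ epath W1 x y i, epath W2 x y j,
    (forall t, t \in W1 -> t \in W2 -> t = x \/ t = y),
    [set t in s] = W1 :|: W2 & i + j = size s].
Proof.
move=> cs xs ys xy; have [i p sE] := rot_to xs.
have : ucycle (@adj G) (x :: p) by rewrite -sE rot_ucycle.
rewrite /ucycle /cycle rcons_path => /andP[/andP[xp lx] up].
have yp : y \in p by have := ys; rewrite -(mem_rot i) sE inE eq_sym (negPf xy).
have Pp : epath [set t in x :: p] x (last x p) (size p) by exists p.
have yW : y \in [set t in x :: p] by rewrite !inE yp orbT.
have [W1 [W2 [a [b [W1p W2p dis WE ab]]]]] := epath_split Pp yW.
have W2l : epath (x |: W2) y x b.+1.
  have xW1 := epath_start W1p.
  have /epath_sym xW2 := W2p; apply: epath_sym.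
  apply: epath_consl xW2 _; first by rewrite adj_sym.
  by apply: contraNN xy => xW2'; rewrite (dis x).
exists W1, (x |: W2), a, b.+1; split=> //; first exact: epath_sym.
- by move=> t tW1; rewrite !inE => /orP[/eqP|]; [left | right; apply: dis].
- rewrite setUA (setUC W1) -setUA -WE; apply/setP=> t.
  by rewrite !inE -(mem_rot i s) sE inE orbA orbb.
- by rewrite addnS ab -(size_rot i s) sE.
Qed.

Definition component W x := [set y | connect (radj W) x y].

Lemma component_sub W x : x \in W -> component W x \subset W.
Proof.
move=> xW; apply/subsetP=> y; rewrite inE => /connect_epath[//|W' [k [W'p sub]]].
exact/(subsetP sub)/(epath_end W'p).
Qed.

Lemma component_refl W x : x \in component W x.
Proof. by rewrite inE connect0. Qed.

Lemma component_closed W x u v : x \in W -> u \in component W x -> adj u v -> v \in W ->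
  v \in component W x.
Proof.
move=> xW uC uv vW; have uW := subsetP (component_sub xW) _ uC.
move: uC; rewrite !inE => /connect_trans; apply; apply: connect1.
by rewrite /= uv uW vW.
Qed.

End Paths.

(** * Critical graphs and clique cutsets *)

Section Colouring.
Variable G : sgraph.
Implicit Types (x y z t u v w : G) (W X Y Z K M S : {set G}) (p s : seq G).

Definition proper_on k S (f : G -> 'I_k) :=
  forall x y, x \in S -> y \in S -> adj x y -> f x != f y.
Definition colorable_on k S := exists f : G -> 'I_k, proper_on S f.
(** In the usual terminology this is (k + 1)-vertex-critical: [k] is the number of colours that just
    fails. *)
Definition vertex_critical k :=
  ~ colorable_on k setT /\ forall v, colorable_on k (~: [set v]).

Lemma colorable_on_sub k S S' : S \subset S' -> colorable_on k S' -> colorable_on k S.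
Proof.
by move=> /subsetP sub [f fP]; exists f => x y xS yS; apply: fP; apply: sub.
Qed.

Lemma critical_colorable k S v : vertex_critical k -> v \notin S -> colorable_on k S.
Proof.
move=> [_ cr] vS; apply: colorable_on_sub (cr v); apply/subsetP=> x xS.
by rewrite !inE; apply: contraNneq vS => <-.
Qed.

(** Induction on [s]: a permutation that is right on the tail is corrected at the head by a
    transposition, which moves no colour that [f] uses on the tail. *)
Lemma align_colors k s (f g : G -> 'I_k) :
  {in s &, injective f} -> {in s &, injective g} -> uniq s ->
  exists h : {perm 'I_k}, {in s, forall x, h (g x) = f x}.
Proof.
elim: s => [|a s IH] fI gI /=; first by exists 1%g.
move=> /andP[aN us].
have [||//|h hP] := IH.
- by move=> x y xs ys; apply: fI; rewrite inE ?xs ?ys orbT.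
- by move=> x y xs ys; apply: gI; rewrite inE ?xs ?ys orbT.
exists (h * tperm (h (g a)) (f a))%g => x; rewrite permM inE => /orP[/eqP->|xs].
  by rewrite tpermL.
rewrite (hP x) // tpermD //.
  rewrite -(hP x) // (inj_eq perm_inj); apply: contraNneq aN => E.
  by rewrite (gI a x) // inE ?eqxx ?xs ?orbT.
by apply: contraNneq aN => E; rewrite (fI a x) // inE ?eqxx ?xs ?orbT.
Qed.

(** Otherwise let [U] be the component of [x] outside [K]. Both [K :|: U] and the complement of [U]
    miss a vertex, hence are colourable; on the clique [K] both colourings are injective, so
    renaming colours makes them agree there. *)
Lemma clique_not_cutset k K x y : vertex_critical k ->
  (forall u v, u \in K -> v \in K -> u != v -> adj u v) ->
  x \notin K -> y \notin K -> connect (radj (~: K)) x y.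
Proof.
move=> cr KP xK yK; apply: contraT => ncxy; case: (cr) => + _; case.
pose U := component (~: K) x; have xC : x \in ~: K by rewrite inE.
have yU : y \notin K :|: U by rewrite !inE negb_or yK.
have xU : x \notin ~: U by rewrite !inE negbK connect0.
have [f fP] := critical_colorable cr yU; have [g gP] := critical_colorable cr xU.
have KU v : v \in K -> v \notin U.
  by move=> vK; apply/negP=> /(subsetP (component_sub xC)); rewrite inE vK.
have [|||h hP] := @align_colors k (enum K) f g; last 1 first.
- exists (fun v => if v \in K :|: U then f v else h (g v)) => u v _ _ uv.
  case: (boolP (u \in K :|: U)) => uKU; case: (boolP (v \in K :|: U)) => vKU.
  + exact: fP.
  + have [uK|uK] := boolP (u \in K).
      rewrite -(hP u) ?mem_enum // (inj_eq perm_inj); apply: gP => //; rewrite inE ?(KU u) //.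
      by move: vKU; rewrite inE negb_or => /andP[].
    move: vKU; rewrite inE negb_or => /andP[vK /negP[]].
    apply: (component_closed xC _ uv); last by rewrite inE.
    by move: uKU; rewrite inE (negPf uK).
  + have [vK|vK] := boolP (v \in K).
      rewrite -(hP v) ?mem_enum // (inj_eq perm_inj); apply: gP => //; rewrite inE ?(KU v) //.
      by move: uKU; rewrite inE negb_or => /andP[].
    move: uKU; rewrite inE negb_or => /andP[uK /negP[]]; rewrite adj_sym in uv.
    apply: (component_closed xC _ uv); last by rewrite inE.
    by move: vKU; rewrite inE (negPf vK).
  + rewrite (inj_eq perm_inj); apply: gP => //; rewrite inE.
      by move: uKU; rewrite inE negb_or => /andP[].
    by move: vKU; rewrite inE negb_or => /andP[].
- move=> u v; rewrite !mem_enum => uK vK E; apply: contra_eq E => uv.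
  by apply: fP; rewrite ?inE ?uK ?vK //; apply: KP.
- move=> u v; rewrite !mem_enum => uK vK E; apply: contra_eq E => uv.
  by apply: gP; rewrite ?in_setC ?KU //; apply: KP.
- exact: enum_uniq.
Qed.

(** * Two-connected graphs and fans *)

Definition two_connected := forall v x y, x != v -> y != v -> connect (radj (~: [set v])) x y.

Lemma critical_two_connected k : vertex_critical k -> two_connected.
Proof.
move=> cr v x y xv yv; apply: clique_not_cutset cr _ _ _; rewrite ?inE //.
by move=> u w; rewrite !inE => /eqP-> /eqP->; rewrite eqxx.
Qed.

Definition fan2 X y := exists W1 W2 z1 z2 k1 k2,
  [/\ epath W1 y z1 k1, epath W2 y z2 k2, z1 \in X & z2 \in X] /\
  [/\ (forall t, t \in W1 -> t \in W2 -> t = y),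
    (forall t, t \in W1 -> t \in X -> t = z1) & (forall t, t \in W2 -> t \in X -> t = z2)].

(** The fan at the neighbour [y'] is moved to [y]: one leg follows [Wg] to its contact [g] and then
    the rest of [U1], the other is [y] followed by [U2]. *)
Lemma fan2_step X y y' g U1 U2 Wg z1 z2 i1 i2 kg :
  adj y y' -> y \notin X -> y' \notin X ->
  epath U1 y' z1 i1 -> epath U2 y' z2 i2 -> z1 \in X -> z2 \in X ->
  (forall t, t \in U1 -> t \in U2 -> t = y') ->
  (forall t, t \in U1 -> t \in X -> t = z1) -> (forall t, t \in U2 -> t \in X -> t = z2) ->
  epath Wg y g kg -> y' \notin Wg ->
  (forall t, t \in Wg -> [|| t \in U1, t \in U2 | t \in X] -> t = g) -> g \in U1 ->
  fan2 X y.
Proof.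
move=> yy' yX y'X U1p U2p z1X z2X dis hit1 hit2 Wgp y'Wg hitg gU1.
have yN := adj_neq yy'; have yWg := epath_start Wgp.
have gy' : g != y' by apply: contraNneq y'Wg => <-; apply: epath_end Wgp.
have [A [B [a [b [Ap Bp disAB UE ab]]]]] := epath_split U1p gU1.
have BU t : t \in B -> t \in U1 by rewrite UE inE => ->; rewrite orbT.
have y'B : y' \notin B.
  by apply: contraNN gy' => y'B; rewrite (disAB y') ?(epath_start Ap).
have yU2 : y \notin U2.
  apply/negP=> yU2; have yg : y = g by apply: hitg; rewrite ?yU2 ?orbT.
  by move: yN; rewrite [y](dis y) ?eqxx // yg.
exists (Wg :|: B), (y |: U2), z1, z2, (kg + b), i2.+1; split; split=> //.
- by apply: epath_cat Wgp Bp _ => t tW /BU tU; apply: hitg; rewrite ?tU.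
- exact: epath_consl U2p _.
- move=> t; rewrite !inE => tWB /orP[/eqP//|tU2]; case/orP: tWB => [tW|tB].
    have tg : t = g by apply: hitg; rewrite ?tU2 ?orbT.
    by case/eqP: gy'; rewrite -tg; apply: dis; rewrite // tg.
  by rewrite -(dis t) ?(BU t) // in y'B; rewrite tB in y'B.
- move=> t; rewrite inE => /orP[tW tX|/BU]; last exact: hit1.
  have tg : t = g by apply: hitg; rewrite ?tX ?orbT.
  by apply: hit1 tX; rewrite tg.
- by move=> t; rewrite !inE => /orP[/eqP->|]; [rewrite (negPf yX) | apply: hit2].
Qed.

(** Menger's theorem for a fan of two paths, by induction on the length of a path from [y] to [X]:
    the next vertex [y'] has a fan or lies in [X], and a path from [y] avoiding [y'] supplies the
    second leg. *)
Lemma fan2P X y x1 x2 :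
  two_connected -> x1 \in X -> x2 \in X -> x1 != x2 -> y \notin X -> fan2 X y.
Proof.
move=> con x1X x2X x12 yX.
have other v : exists2 x, x \in X & x != v.
  by have [<-|] := eqVneq x1 v; [exists x2; rewrite // eq_sym | exists x1].
have away v x : x \in X -> x != v -> y != v ->
    exists W k, epath W y x k /\ W \subset ~: [set v].
  by move=> xX xv yv; apply: connect_epath; [apply: con | rewrite !inE].
have [v0 v0X v0y] := other y.
have [x0 [W [k [x0X Wp]]]] : exists x0 W k, x0 \in X /\ epath W y x0 k.
  have [x0 x0X x0v] := other v0; rewrite eq_sym in v0y.
  have [W [k [Wp _]]] := away _ _ x0X x0v v0y.
  by exists x0, W, k.
elim: k y W yX Wp {v0 v0X v0y} away => [|k IH] y W yX Wp away.
  by case/epath_nil: Wp => E; rewrite E x0X in yX.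
have [y' [W' [yy' Wp' _ _]]] := epath_step Wp; have yN := adj_neq yy'.
have [x' x'X x'y'] := other y'.
have [W1 [k1 [W1p sub]]] := away _ _ x'X x'y' yN.
have [y'X|y'X] := boolP (y' \in X).
  have [W2 [z2 [k2 [W2p sub2 z2X hit _]]]] := epath_hit W1p x'X.
  exists [set y; y'], W2, y', z2, 1, k2; split; split=> //; first exact: epath1.
  - move=> t; rewrite !inE => /orP[/eqP->//|/eqP->] /(subsetP sub2)/(subsetP sub).
    by rewrite !inE eqxx.
  - by move=> t; rewrite !inE => /orP[/eqP->|/eqP->//]; rewrite (negPf yX).
have [|U1 [U2 [z1 [z2 [i1 [i2 [[U1p U2p z1X z2X] [dis hit1 hit2]]]]]]]] := IH y' W' y'X Wp'.
  by move=> v x xX xv yv; apply: connect_epath; [apply: con | rewrite !inE].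
pose Z := U1 :|: U2 :|: X.
have x'Z : x' \in Z by rewrite !inE x'X !orbT.
have [Wg [g [kg [Wgp subg gZ hitg _]]]] := epath_hit W1p x'Z.
have y'Wg : y' \notin Wg.
  by apply/negP=> /(subsetP subg)/(subsetP sub); rewrite !inE eqxx.
have {}hitg t : t \in Wg -> [|| t \in U1, t \in U2 | t \in X] -> t = g.
  by move=> tW tZ; apply: hitg; rewrite // !inE -orbA.
have [gU1|gU1] := boolP (g \in U1).
  exact: (fan2_step yy' yX y'X U1p U2p z1X z2X dis hit1 hit2 Wgp y'Wg hitg gU1).
have [gU2|gU2] := boolP (g \in U2).
  apply: (fan2_step yy' yX y'X U2p U1p z2X z1X _ hit2 hit1 Wgp y'Wg _ gU2).
  - by move=> t tU2 tU1; apply: dis.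
  - by move=> t tW tZ; apply: hitg; rewrite // orbCA.
have gX : g \in X by move: gZ; rewrite !inE (negPf gU1) (negPf gU2).
have yU2 : y \notin U2.
  by apply: contraNN gU2 => yU2; rewrite -(hitg y) ?yU2 ?orbT // (epath_start Wgp).
exists Wg, (y |: U2), g, z2, kg, i2.+1; split; split=> //.
- exact: epath_consl U2p _.
- move=> t tW; rewrite !inE => /orP[/eqP//|tU2]; case/negP: gU2.
  by rewrite -(hitg t) ?tU2 ?orbT.
- by move=> t tW tX; apply: hitg; rewrite ?tX ?orbT.
- by move=> t; rewrite !inE => /orP[/eqP->|]; [rewrite (negPf yX) | apply: hit2].
Qed.

End Colouring.

(** * Disjoint paths between two sets *)

Section Menger.
Variable G : sgraph.
Implicit Types (x y z t u v w : G) (W X Y Z K M S U P : {set G}) (p s : seq G).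

Definition link2 X Y := exists W1 W2 x1 y1 x2 y2 k1 k2,
  [/\ epath W1 x1 y1 k1, epath W2 x2 y2 k2, x1 \in X & y1 \in Y] /\
  [/\ x2 \in X, y2 \in Y & forall t, t \in W1 -> t \notin W2] /\
  [/\ forall t, t \in W1 -> t \in X -> t = x1, forall t, t \in W1 -> t \in Y -> t = y1,
      forall t, t \in W2 -> t \in X -> t = x2 & forall t, t \in W2 -> t \in Y -> t = y2].

Lemma link2_of_paths X Y U P z2 y z y2 k k2 :
  epath U z2 y k2 -> z2 \in X -> y \in Y ->
  (forall t, t \in U -> t \in X -> t = z2) -> (forall t, t \in U -> t \in Y -> t = y) ->
  epath P z y2 k -> z \in X -> y2 \in Y -> (forall t, t \in P -> t \in X -> t = z) ->
  (forall t, t \in P -> t \notin U) -> link2 X Y.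
Proof.
move=> Up z2X yY UX UY Pp zX y2Y PX PU.
have [P' [y' [i [P'p sub y'Y hit _]]]] := epath_hit Pp y2Y.
exists P', U, z, y', z2, y, i, k2; split; split=> //; split=> //.
- by move=> t /(subsetP sub)/PU.
- by move=> t /(subsetP sub)/PX.
Qed.

(** The legs of the fan meet at [y]. A path from [y2] that first touches the fan at [g] on [U1]
    replaces the part of [U1] between [g] and [y], so that only [U2] still ends at [y]. *)
Lemma link2_of_fan X Y U1 U2 W g z1 z2 y y2 i1 i2 k :
  epath U1 z1 y i1 -> epath U2 z2 y i2 -> z1 \in X -> z2 \in X -> y \in Y ->
  (forall t, t \in U1 -> t \in U2 -> t = y) ->
  (forall t, t \in U1 -> t \in X -> t = z1) -> (forall t, t \in U2 -> t \in X -> t = z2) ->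
  (forall t, t \in U2 -> t \in Y -> t = y) ->
  epath W y2 g k -> y2 \in Y -> y \notin W ->
  (forall t, t \in W -> [|| t \in U1, t \in U2 | t \in X] -> t = g) -> g \in U1 ->
  link2 X Y.
Proof.
move=> U1p U2p z1X z2X yY dis U1X U2X U2Y Wp y2Y yW hit gU1.
have gy : g != y by apply: contraNneq yW => <-; apply: epath_end Wp.
have [A [B [a [b [Ap Bp disAB UE ab]]]]] := epath_split U1p gU1.
have AU t : t \in A -> t \in U1 by rewrite UE inE => ->.
apply: (link2_of_paths U2p z2X yY U2X U2Y
  (epath_cat Ap (epath_sym Wp) _) z1X y2Y).
- by move=> t /AU tU tW; apply: hit; rewrite ?tU.
- move=> t; rewrite inE => /orP[/AU|tW tX]; first exact: U1X.
  have tg : t = g by apply: hit; rewrite ?tX ?orbT.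
  by apply: U1X; rewrite // tg.
- move=> t; rewrite inE => /orP[tA|tW]; apply/negP=> tU2.
    have ty := dis t (AU t tA) tU2; case/eqP: gy; rewrite -ty; apply/esym/disAB => //.
    by rewrite ty; apply: epath_end Bp.
  have tg : t = g by apply: hit; rewrite ?tU2 ?orbT.
  by case/eqP: gy; rewrite -tg; apply: dis; rewrite // tg.
Qed.

(** A vertex [y] of [Y] outside [X] has a fan to [X]. Its legs, cut at their first vertices in [Y]
    seen from [X], are disjoint unless both still end at [y]; then a path from another vertex of [Y]
    that avoids [y] is used to separate them. *)
Lemma menger2 X Y x1 x2 y1 y2 : two_connected G ->
  x1 \in X -> x2 \in X -> x1 != x2 -> y1 \in Y -> y2 \in Y -> y1 != y2 -> link2 X Y.
Proof.
move=> con x1X x2X x12 y1Y y2Y y12.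
have [|] := boolP ((y1 \in X) && (y2 \in X)).
  case/andP=> y1X y2X; exists [set y1], [set y2], y1, y1, y2, y2, 0, 0.
  split; first by split=> //; exact: epath0.
  split; last by split=> t /set1P->.
  by split=> // t /set1P->; rewrite inE.
have other v : exists2 x, x \in Y & x != v.
  by have [<-|] := eqVneq y1 v; [exists y2; rewrite // eq_sym | exists y1].
rewrite negb_and => yX; have {yX}[y [yY yX]] : exists y, y \in Y /\ y \notin X.
  by case/orP: yX => ?; [exists y1 | exists y2].
have [W1 [W2 [z1 [z2 [k1 [k2 [[W1p W2p z1X z2X] [dis W1X W2X]]]]]]]] :=
  fan2P con x1X x2X x12 yX.
have [U1 [g1 [i1 [U1p sub1 g1Y hit1 _]]]] := epath_hit (epath_sym W1p) yY.
have [U2 [g2 [i2 [U2p sub2 g2Y hit2 _]]]] := epath_hit (epath_sym W2p) yY.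
have U1X t : t \in U1 -> t \in X -> t = z1 by move/(subsetP sub1)/W1X.
have U2X t : t \in U2 -> t \in X -> t = z2 by move/(subsetP sub2)/W2X.
have disU t : t \in U1 -> t \in U2 -> t = y.
  by move=> /(subsetP sub1) t1 /(subsetP sub2) t2; apply: dis.
have [|] := boolP ((g1 == y) && (g2 == y)); last first.
  move=> ng; apply: (link2_of_paths U2p z2X g2Y U2X hit2 U1p z1X g1Y U1X).
  move=> t tU1; apply: contraNN ng => tU2; have ty := disU t tU1 tU2.
  have tY : t \in Y by rewrite ty.
  by rewrite -(hit1 t tU1 tY) -(hit2 t tU2 tY) ty eqxx.
case/andP=> /eqP E1 /eqP E2; subst g1 g2.
have [y' y'Y y'y] := other y.
have z1y : z1 != y by apply: contraNneq yX => <-.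
have [W [k [Wp sub]]] : exists W k, epath W y' z1 k /\ W \subset ~: [set y].
  by apply: connect_epath; [apply: con | rewrite !inE].
have z1Z : z1 \in U1 :|: U2 :|: X by rewrite !inE z1X !orbT.
have [W' [g [k' [W'p sub' gZ hit _]]]] := epath_hit Wp z1Z.
have yW' : y \notin W'.
  by apply/negP=> /(subsetP sub')/(subsetP sub); rewrite !inE eqxx.
have {}hit t : t \in W' -> [|| t \in U1, t \in U2 | t \in X] -> t = g.
  by move=> tW tZ; apply: hit; rewrite // !inE -orbA.
have [gU1|gU1] := boolP (g \in U1).
  exact: (link2_of_fan U1p U2p z1X z2X yY disU U1X U2X hit2 W'p y'Y yW' hit gU1).
have [gU2|gU2] := boolP (g \in U2).
  apply: (link2_of_fan U2p U1p z2X z1X yY _ U2X U1X hit1 W'p y'Y yW' _ gU2).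
    by move=> t tU2 tU1; apply: disU.
  by move=> t tW tZ; apply: hit; rewrite // orbCA.
have gX : g \in X by move: gZ; rewrite !inE (negPf gU1) (negPf gU2).
apply: (link2_of_paths U2p z2X yY U2X hit2 (epath_sym W'p) gX y'Y).
  by move=> t tW tX; apply: hit; rewrite ?tX ?orbT.
by move=> t tW; apply: contraNN gU2 => tU2; rewrite -(hit t) ?tU2 ?orbT.
Qed.

End Menger.

(** * Bipartite subgraphs and 2-cuts *)

Section Bipartite.
Variable G : sgraph.
Implicit Types (x y z t u v w : G) (W X Y Z K M S U P Q : {set G}) (p s : seq G).

Definition odd_cycle_in W :=
  exists s, [/\ ucycle (@adj G) s, odd (size s), 2 < size s & {subset s <= W}].

Definition two_coloring W (g : G -> bool) :=
  forall x y, x \in W -> y \in W -> adj x y -> g x != g y.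

Lemma not_uniq_split p : ~~ uniq p -> exists v p1 p2 p3, p = p1 ++ v :: p2 ++ v :: p3.
Proof.
elim: p => //= a p IH; rewrite negb_and negbK; have [ap _|aN /= /IH] := boolP (a \in p).
  by case/splitPr: ap => p2 p3; exists a, [::], p2, p3.
by move=> [v [p1 [p2 [p3 ->]]]]; exists v, (a :: p1), p2, p3.
Qed.

(** A repeated vertex splits the closed walk into two shorter closed walks, one of them odd. *)
Lemma odd_closed_walk W x p :
  path (radj W) x p -> last x p = x -> odd (size p) -> odd_cycle_in W.
Proof.
have [n] := ubnP (size p); elim: n x p => // n IH x p szp xp lp op.
have [up|/not_uniq_split[v [p1 [p2 [p3 E]]]]] := boolP (uniq p).
  exists p; split=> //.
  - rewrite /ucycle up andbT (cycle_path x) lp; apply: sub_path xp => u v /=.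
    by case/and3P.
  - case: p xp lp op {szp up} => [|a [|b [|c p]]] //= /andP[/and3P[xa _ _] _] ax _.
    by rewrite ax adj_irrefl in xa.
  - move=> z zp; have : all (mem W) p; last by move/allP; apply.
    elim: p (x) xp {lp op szp up zp} => //= u p IHp w.
    by case/andP=> /and3P[_ _ ->] /IHp.
move: xp lp szp op; rewrite E cat_path /= cat_path /= last_cat /= last_cat /=.
case/and5P=> xp1 p1v vp2 p2v vp3 lp.
rewrite !size_cat /= size_cat /= => szp op.
have [o2|e2] := boolP (odd (size p2).+1).
- apply: (IH v (rcons p2 v)); rewrite ?size_rcons ?last_rcons ?rcons_path ?vp2 //.
  by lia.
- apply: (IH x (p1 ++ v :: p3)).
  + by rewrite size_cat /=; lia.
  + by rewrite cat_path /= xp1 p1v vp3.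
  + by rewrite last_cat.
  + by rewrite size_cat /=; lia.
Qed.

Lemma walk_parity W x y p q : ~ odd_cycle_in W ->
  path (radj W) x p -> last x p = y -> path (radj W) x q -> last x q = y ->
  odd (size p) = odd (size q).
Proof.
move=> no xp lp xq lq; have [/eqP//|ne] := boolP (odd (size p) == odd (size q)).
case: no.
apply: (@odd_closed_walk W x (p ++ rev (belast x q))).
- rewrite cat_path xp lp -lq rev_path /=.
  by rewrite (eq_path (e' := radj W)) // => u v; rewrite radj_sym.
- rewrite last_cat lp -lq; case: q {xq lq ne} => //= a q.
  by rewrite rev_cons last_rcons.
- by rewrite size_cat size_rev size_belast oddD; move: ne; do 2!case: odd.
Qed.

Lemma bipartite W : ~ odd_cycle_in W -> exists g, two_coloring W g.
Proof.
move=> no; pose r x := root (radj W) x.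
(* Only walks shorter than [#|G|] are tested, which makes the condition decidable; shortening a walk
   keeps its parity because [W] has no odd cycle. *)
pose g x := [exists n : 'I_#|G|, odd n &&
  [exists p : n.-tuple G, path (radj W) (r x) p && (last (r x) p == x)]].
have gE x p : path (radj W) (r x) p -> last (r x) p = x -> g x = odd (size p).
  move=> xp lp; apply/existsP/idP => [[n /andP[on /existsP[q /andP[xq /eqP lq]]]]|op].
    by rewrite (walk_parity no xp lp xq lq) size_tuple.
  case: (shortenP xp) (lp) => p' xp' up' _ lp'.
  have sz : size p' < #|G|.
    by have := max_card (mem (r x :: p')); rewrite (card_uniqP up').
  exists (Ordinal sz); rewrite /= (walk_parity no xp' lp' xp lp) op /=.
  by apply/existsP; exists (in_tuple p'); rewrite xp' lp' eqxx.
exists g => x y xW yW xy.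
have cxy : connect (radj W) x y by apply: connect1; rewrite /= xy xW yW.
have rxy : r x = r y by apply/eqP; rewrite root_connect //; apply: connect_radj_sym.
have : connect (radj W) (r x) x.
  by rewrite connect_radj_sym connect_root.
case/connectP=> p xp lp; rewrite (gE x p) // (gE y (rcons p y)).
- by rewrite size_rcons /=; case: odd.
- by rewrite -rxy rcons_path xp -lp /= xy xW yW.
- by rewrite last_rcons.
Qed.

(** Every vertex before the last lies outside [Y], hence in [M], and neighbours of [M] stay in
    [Y :|: M]. *)
Lemma epath_trapped M Y W w v k :
  (forall u t, u \in M -> adj u t -> t \notin M -> t \in Y) ->
  epath W w v k -> w \in Y :|: M -> (forall t, t \in W -> t \in Y -> t = v) ->
  W \subset Y :|: M.
Proof.
move=> NM; elim: k W w => [|k IH] W w.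
  by case/epath_nil=> _ -> wJ _; rewrite sub1set.
move=> /[dup] Wp /epath_step[z [W' [wz W'p wW' WE]]] wJ hit.
have wM : w \in M.
  case/setUP: wJ => // wY; have wv : w = v by apply: hit wY; apply: epath_start Wp.
  by rewrite wv in Wp; have := epath_loop Wp.
have zJ : z \in Y :|: M.
  by rewrite inE orbC; case: (boolP (z \in M)) => //= zM; apply: NM wz zM.
rewrite WE subUset sub1set wJ /=; apply: IH W'p zJ _ => t tW' tY.
by apply: hit; rewrite // WE inE tW' orbT.
Qed.

Lemma epath_join W1 W2 A x1 x2 y1 y2 k1 k2 i :
  epath W1 x1 y1 k1 -> epath W2 x2 y2 k2 -> epath A x1 x2 i ->
  (forall t, t \in W1 -> t \in A -> t = x1) -> (forall t, t \in W2 -> t \in A -> t = x2) ->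
  (forall t, t \in W1 -> t \notin W2) -> epath (W1 :|: A :|: W2) y1 y2 (k1 + i + k2).
Proof.
move=> W1p W2p Ap h1 h2 dis; apply: epath_cat W2p _; first exact: epath_cat (epath_sym W1p) Ap h1.
move=> t; rewrite inE => /orP[tW1 tW2|tA tW2]; last exact: h2.
by have := dis t tW1; rewrite tW2.
Qed.

Lemma cycle_two_points s : ucycle (@adj G) s -> 2 < size s ->
  exists a b, [/\ a != b, a \in s & b \in s].
Proof.
case: s => [|a [|b s]] // /andP[_ /= /andP[aN _]] _; exists a, b.
by rewrite !inE !eqxx orbT; split=> //; apply: contraNneq aN => ->; rewrite inE eqxx.
Qed.

Lemma third_color (a b : 'I_3) : exists c, c != a /\ c != b.
Proof.
have : ~: [set a; b] != set0.
  by rewrite -card_gt0 cardsCs setCK cards2 card_ord; case: (_ != _).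
by case/set0Pn=> c; rewrite !inE negb_or => /andP[ca cb]; exists c.
Qed.

(* If every [x]-[y] path through [M] had the same parity, then by Menger there would be
   no odd cycle in [M] with [x] and [y] added, and every colouring of [x] and [y] would
   extend to [M]. *)
Lemma two_cut_parities M x y z : vertex_critical G 3 -> M != set0 ->
  x \notin M -> y \notin M -> x != y -> z \notin M -> z != x -> z != y ->
  (forall u v, u \in M -> adj u v -> v \notin M -> v = x \/ v = y) ->
  exists W1 W2 k1 k2, [/\ epath W1 x y k1, epath W2 x y k2,
    W1 \subset [set x; y] :|: M, W2 \subset [set x; y] :|: M & odd k1 != odd k2].
Proof.
move=> cr /set0Pn[m mM] xM yM xy zM zx zy NM.
have con := critical_two_connected cr.
have NM' u v : u \in M -> adj u v -> v \notin M -> v \in [set x; y].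
  by move=> uM uv vM; rewrite !inE; case: (NM u v uM uv vM) => ->; rewrite eqxx ?orbT.
(* Otherwise [x] and [y] would form a clique separating [m] from [z]. *)
have nxy : ~~ adj x y.
  apply/negP=> adjxy; have mK : m \notin [set x; y].
    by rewrite !inE; apply/norP; split; apply: contraTneq mM => ->.
  have zK : z \notin [set x; y] by rewrite !inE negb_or zx zy.
  have : connect (radj (~: [set x; y])) m z.
    apply: clique_not_cutset cr _ mK zK => u v; rewrite !inE.
    by case/orP=> /eqP-> /orP[]/eqP->; rewrite ?eqxx // adj_sym.
  case/connect_epath=> [|W [k [Wp sub]]]; first by rewrite inE.
  have /subsetP/(_ z) : W \subset [set x; y] :|: M.
    apply: epath_trapped NM' Wp _ _; first by rewrite inE mM orbT.
    by move=> t /(subsetP sub); rewrite inE => /negPf->.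
  by rewrite (epath_end Wp) inE (negPf zM) (negPf zK) => /(_ isT).
pose J := [set x; y] :|: M.
have [[s [cs os s2 sJ]]|no] := classic (odd_cycle_in J).
  have [a [b [ab as_ bs]]] := cycle_two_points cs s2.
  have [] := @menger2 _ [set t in s] [set x; y] a b x y con; rewrite ?inE ?eqxx ?orbT //.
  move=> W1 [W2 [x1 [y1 [x2 [y2 [k1 [k2 [[W1p W2p x1s y1Y] [[x2s y2Y dis] [h1 h2 h3 h4]]]]]]]]]].
  have stay W w v k : epath W w v k -> w \in [set t in s] ->
      (forall t, t \in W -> t \in [set x; y] -> t = v) -> W \subset J.
    by move=> Wp ws hit; apply: epath_trapped NM' Wp _ hit; apply: sJ; rewrite inE in ws.
  have x12 : x1 != x2.
    apply: contraTneq (epath_start W2p) => <-; exact: dis (epath_start W1p).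
  have y12 : y1 != y2.
    apply: contraTneq (epath_end W2p) => <-; exact: dis (epath_end W1p).
  rewrite !inE in x1s x2s.
  (* The two arcs of the odd cycle between the feet of the Menger paths have different parity, and
     so do the resulting [x]-[y] paths. *)
  have [A [B [i [j [Ap Bp _ sE ij]]]]] := cycle_arcs cs x1s x2s x12.
  have inA t : t \in A -> t \in s by move=> tA; rewrite -[t \in s]in_set sE inE tA.
  have inB t : t \in B -> t \in s by move=> tB; rewrite -[t \in s]in_set sE inE tB orbT.
  have Cyc A' i' : epath A' x1 x2 i' -> (forall t, t \in A' -> t \in s) ->
      epath (W1 :|: A' :|: W2) y1 y2 (k1 + i' + k2) /\ W1 :|: A' :|: W2 \subset J.
    move=> A'p inA'; split.
      apply: epath_join W1p W2p A'p _ _ dis => t tW /inA' ts; [apply: h1 | apply: h3];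
        by rewrite // inE.
    rewrite !subUset (stay _ _ _ _ W1p) ?inE //= (stay _ _ _ _ W2p) ?inE // andbT.
    by apply/subsetP=> t /inA'/sJ.
  have [P1 S1] := Cyc _ _ Ap inA; have [P2 S2] := Cyc _ _ Bp inB.
  have par : odd (k1 + i + k2) != odd (k1 + j + k2).
    by move: os; rewrite -ij !oddD; do 4!case: odd.
  have [/eqP E1|] := boolP (y1 == x); have [/eqP E2|] := boolP (y2 == y).
  - by subst y1 y2; exists (W1 :|: A :|: W2), (W1 :|: B :|: W2), (k1 + i + k2), (k1 + j + k2).
  - by move: y2Y y12; rewrite E1 !inE => /orP[]/eqP->; rewrite ?eqxx.
  - by move: y1Y y12; rewrite E2 !inE => /orP[]/eqP->; rewrite ?eqxx.
  - move: y1Y y2Y; rewrite !inE => /orP[]/eqP E1; rewrite ?E1 ?eqxx // => /orP[]/eqP E2;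
      rewrite ?E2 ?eqxx // => _ _; subst y1 y2.
    exists (W1 :|: A :|: W2), (W1 :|: B :|: W2), (k1 + i + k2), (k1 + j + k2).
    by split=> //; apply: epath_sym.
have [g gP] := bipartite no.
have [|f fP] := @critical_colorable _ 3 (~: M) m cr; first by rewrite inE mM.
(* In [M], the class of [x] under [g] will get [c1] and the other class [c2]. Neighbours of [x] thus
   get [c2]; those of [y] get [c2] if [x] and [y] are in one class, and [c1] if not. *)
have [c1 [c2 [c12 cx cy]]] : exists c1 c2, [/\ c1 != c2, c2 != f x &
    (if g x == g y then c2 else c1) != f y].
  case: (g x == g y).
    have [c2 [c2x c2y]] := third_color (f x) (f y).
    by have [c1 [c12 _]] := third_color c2 c2; exists c1, c2.
  have [E|ne] := eqVneq (f x) (f y); last by exists (f x), (f y); split; rewrite // eq_sym.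
  have [c2 [c2x _]] := third_color (f x) (f x).
  by have [c1 [c1x c12]] := third_color (f x) c2; exists c1, c2; rewrite -E.
case: cr => + _; case; pose h u := if u \in M then if g u == g x then c1 else c2 else f u.
have gJ u v : u \in M -> adj u v -> g u != g v.
  move=> uM uv; apply: gP => //; rewrite inE ?uM ?orbT // orbC.
  by case: (boolP (v \in M)) => //= vM; apply: NM' uv vM.
have mixed u v : u \in M -> v \notin M -> adj u v -> h u != h v.
  move=> uM vM uv; rewrite /h uM (negPf vM); have := gJ u v uM uv.
  case: (NM u v uM uv vM) => ->; first by move/negPf->.
  by move: cy; case: (g u); case: (g x); case: (g y).
exists h => u v _ _ uv; have [uM|uM] := boolP (u \in M); have [vM|vM] := boolP (v \in M).
- rewrite /h uM vM; have := gJ u v uM uv.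
  have c21 : c2 != c1 by rewrite eq_sym.
  by case: (g u); case: (g x); case: (g v).
- exact: mixed.
- by rewrite eq_sym mixed // adj_sym.
- by rewrite /h (negPf uM) (negPf vM); apply: fP; rewrite // inE.
Qed.

End Bipartite.

(** * Two cliques on four vertices *)

Section FourColours.
Variable G : sgraph.
Implicit Types (x y z s t u v w : G) (W X Y Z K M S U P Q : {set G}).

Definition odd_lengths l := forall n, cycle_of_length G n -> odd n -> n = 3 \/ n = 2 * l + 3.

Definition K4 K := clique K && (#|K| == 4).

Lemma cliqueP K : reflect (forall x y, x \in K -> y \in K -> x != y -> adj x y) (clique K).
Proof.
apply: (iffP forall_inP) => [cK x y xK yK xy|cK x xK].
  by have /forall_inP/(_ y yK)/implyP := cK x xK; apply.
by apply/forall_inP=> y yK; apply/implyP; apply: cK.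
Qed.

Lemma epath2 x s y : adj x s -> adj s y -> x != y -> epath (x |: [set s; y]) x y 2.
Proof.
move=> xs sy xy; apply: (epath_consl xs (epath1 sy)).
by rewrite !inE negb_or xy (adj_neq xs).
Qed.

Lemma epath3 x s t y : adj x s -> adj s t -> adj t y -> x != y -> x != t -> s != y ->
  epath (x |: (s |: [set t; y])) x y 3.
Proof.
move=> xs st ty xy xt sy; apply: (epath_consl xs (epath2 st ty sy)).
by rewrite !inE !negb_or xy xt (adj_neq xs).
Qed.

(** The vertex [z] stands for the one that two such cliques may share; the path of length 2 is
    chosen so that its middle vertex is not [z]. *)
Lemma K4_paths K x y z : K4 K -> x \in K -> y \in K -> x != y -> 
  [/\ adj x y,
    (exists2 A, epath A x y 2 & A \subset K /\ (z \in A -> z = x \/ z = y)) &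
    (exists2 A, epath A x y 3 & A \subset K)].
Proof.
case/andP=> /cliqueP cK /eqP cardK xK yK xy.
have /eqP/cards2P[a [b [ab E]]] : #|K :\ x :\ y| = 2.
  have := cardsD1 x K; rewrite xK cardK; have := cardsD1 y (K :\ x).
  by rewrite in_setD1 eq_sym xy yK; lia.
have : a \in K :\ x :\ y by rewrite E !inE eqxx.
have : b \in K :\ x :\ y by rewrite E !inE eqxx orbT.
rewrite !inE => /and3P[bx by_ bK] /and3P[ax ay aK].
have p2 u : u \in K -> u != x -> u != y -> epath (x |: [set u; y]) x y 2.
  by move=> uK ux uy; apply: epath2; rewrite ?cK // eq_sym.
have s2 u : u \in K -> x |: [set u; y] \subset K.
  by move=> uK; rewrite !subUset !sub1set xK uK yK.
split; first exact: cK.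
- have [az|az] := eqVneq a z.
    exists (x |: [set b; y]); [exact: p2 | split; first exact: s2].
    rewrite !inE -az (negPf ab); case/or3P=> // /eqP ->; by [left | right].
  exists (x |: [set a; y]); [exact: p2 | split; first exact: s2].
  by rewrite !inE eq_sym [z == a]eq_sym (negPf az) /= => /orP[]/eqP; [left|right].
- exists (x |: (a |: [set b; y])); last by rewrite !subUset !sub1set xK aK bK yK.
  by apply: epath3; rewrite ?cK // eq_sym.
Qed.

Lemma four_critical_false l : 2 <= l -> odd_lengths l -> vertex_critical G 4 ->
  (forall S, (forall K, K \subset S -> ~~ K4 K) -> colorable_on 3 S) -> False.
Proof.
move=> l2 odl cr col3.
(* If every K4 contained [v], the rest would be 3-colourable by [col3], and [v] could take the
   fourth colour [ord_max]. *)
have getK4 v : exists K, K4 K /\ v \notin K.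
  have [ex|nex] := classic (exists K, K4 K /\ v \notin K); first by [].
  case: cr => + _; case; have [|f fP] := col3 (~: [set v]).
    move=> K sub; apply/negP=> kK; apply: nex; exists K; split=> //.
    by apply/negP=> /(subsetP sub); rewrite !inE eqxx.
  exists (fun x => if x == v then ord_max else inord (f x)) => x y _ _ xy.
  have bnd z : val (inord (f z) : 'I_4) = f z.
    by rewrite /= inordK //; have := ltn_ord (f z); lia.
  have ne z : inord (f z) != ord_max :> 'I_4.
    by apply/eqP=> /(congr1 val); rewrite bnd /=; have := ltn_ord (f z); lia.
  have [E|xv] := eqVneq x v; have [E'|yv] := eqVneq y v => //.
  - by rewrite E E' adj_irrefl in xy.
  - by rewrite eq_sym.
  - apply/eqP=> /(congr1 val); rewrite !bnd => /ord_inj/eqP.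
    by apply/negP; apply: fP; rewrite ?inE.
have con := critical_two_connected cr.
have [v0 _] : exists v : G, True.
  have [//|no] := classic (exists v : G, True); case: cr => + _; case.
  by exists (fun=> ord0) => x; case: no; exists x.
have [Q [kQ _]] := getK4 v0.
have pick2 K x : K4 K -> exists2 y, y \in K & y != x.
  case/andP=> _ /eqP c4; have : #|K :\ x| != 0.
    by have := cardsD1 x K; rewrite c4; case: (x \in K); lia.
  by rewrite cards_eq0 => /set0Pn[y]; rewrite !inE => /andP[yx yK]; exists y.
have [q qQ _] := pick2 Q v0 kQ; have [Q' [kQ' qQ']] := getK4 q.
have [[x [y [xy xQ yQ xQ' yQ']]]|few] :=
  classic (exists x y, [/\ x != y, x \in Q, y \in Q, x \in Q' & y \in Q']).
  (* Two shared vertices give a cycle of length 5, excluded by [2 <= l]: three edges in [Q] and two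
     through a vertex [s] of [Q'] outside [Q]. *)
  have [s sQ' sQ] : exists2 s, s \in Q' & s \notin Q.
    apply/subsetPn; apply: contra qQ' => sub.
    suff -> : Q' = Q by []; apply/eqP; rewrite eqEcard sub.
    by case/andP: kQ => _ /eqP->; case/andP: kQ' => _ /eqP->.
  have [_ _ [A Ap sA]] := K4_paths x kQ xQ yQ xy.
  have c' := cliqueP _ (proj1 (andP kQ')).
  have P : epath (x |: [set s; y]) x y 2.
    apply: epath2 => //; apply: c' => //; first by apply: contraNneq sQ => <-.
    by apply: contraNneq sQ => ->.
  have : cycle_of_length G (3 + 2).
    apply: epath_cycle Ap P xy _ _ => // t /(subsetP sA) tQ.
    rewrite !inE => /or3P[]/eqP E; [by left| |by right].
    by rewrite -E tQ in sQ.
  by move=> c5; have := odl _ c5 isT; clear -l2; lia.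
have [z zP] : exists z, forall t, t \in Q -> t \in Q' -> t = z.
  have [[z [zQ zQ']]|no] := classic (exists z, z \in Q /\ z \in Q').
    exists z => t tQ tQ'; apply/eqP/negP=> tz; case: few; exists t, z; split=> //.
    exact/negP.
  by exists v0 => t tQ tQ'; case: no; exists t.
have [q' q'Q' _] := pick2 Q' v0 kQ'; have [r rQ rq] := pick2 Q q kQ.
have [r' r'Q' rq'] := pick2 Q' q' kQ'.
have [W1 [W2 [x1 [y1 [x2 [y2 [k1 [k2 [[W1p W2p x1Q y1Q'] [[x2Q y2Q' dis] [h1 h2 h3 h4]]]]]]]]]]] :=
  menger2 con rQ qQ rq r'Q' q'Q' rq'.
have x12 : x1 != x2.
  apply: contraTneq (epath_start W2p) => <-; exact: dis (epath_start W1p).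
have y12 : y1 != y2.
  apply: contraTneq (epath_end W2p) => <-; exact: dis (epath_end W1p).
have [x1x2 [A2 A2p [sA2 zA2]] _] := K4_paths z kQ x1Q x2Q x12.
have [y1y2 [B2 B2p [sB2 _]] [B3 B3p sB3]] := K4_paths z kQ' y1Q' y2Q' y12.
have A1p := epath1 x1x2; have B1p := epath1 y1y2.
have sA1 : [set x1; x2] \subset Q by rewrite subUset !sub1set x1Q x2Q.
have sB1 : [set y1; y2] \subset Q' by rewrite subUset !sub1set y1Q' y2Q'.
have zA1 : z \in [set x1; x2] -> z = x1 \/ z = x2.
  by rewrite !inE => /orP[]/eqP; [left | right].
have cyc A B i j : epath A x1 x2 i -> A \subset Q -> (z \in A -> z = x1 \/ z = x2) ->
    epath B y1 y2 j -> B \subset Q' -> 0 < i -> 0 < j -> odd (k1 + i + k2 + j) ->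
    k1 + i + k2 + j = 3 \/ k1 + i + k2 + j = 2 * l + 3.
  move=> Ap /subsetP sA zA Bp /subsetP sB i0 j0 od; apply: odl => //.
  have J := epath_join W1p W2p Ap (fun t tW tA => h1 t tW (sA t tA))
    (fun t tW tA => h3 t tW (sA t tA)) dis.
  have three : 2 < k1 + i + k2 + j by clear -i0 j0 od; lia.
  apply: (epath_cycle J Bp y12 _ three).
  move=> t; rewrite !inE => + /sB tB; case/orP=> [/orP[tW|tA]|tW].
  - by left; apply: h2.
  - have tz := zP t (sA t tA) tB; case: zA => [|zx|zx]; first by rewrite -tz.
      left; apply: h2 => //; rewrite tz zx; exact: epath_start W1p.
    right; apply: h4 => //; rewrite tz zx; exact: epath_start W2p.
  - by right; apply: h4.
(* The four choices add 2, 3, 4 and 5 edges to [k1 + k2]. If this sum is odd, adding 2 and 4 gives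
   two odd lengths that differ by 2; if it is even, adding 3 and 5 does. *)
have c11 := cyc _ _ _ _ A1p sA1 zA1 B1p sB1 isT isT.
have c12 := cyc _ _ _ _ A1p sA1 zA1 B2p sB2 isT isT.
have c13 := cyc _ _ _ _ A1p sA1 zA1 B3p sB3 isT isT.
have c23 := cyc _ _ _ _ A2p sA2 zA2 B3p sB3 isT isT.
clear -c11 c12 c13 c23 l2; lia.
Qed.

End FourColours.

(** * Triangle-free critical graphs *)

Section ParityPath.
Variable G : sgraph.
Implicit Types (x y z t u v w : G) (W P : {set G}) (p s : seq G).

Lemma two_coloring_epath W (g : G -> bool) P x y k : two_coloring W g ->
  epath P x y k -> P \subset W -> odd k = (g x != g y).
Proof.
move=> gW; elim: k x P => [|k IH] x P; first by case/epath_nil=> ->; rewrite eqxx.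
case/epath_step=> z [P' [xz P'p _ ->]]; rewrite subUset sub1set => /andP[xW sub].
have := gW _ _ xW (subsetP sub _ (epath_start P'p)) xz.
by rewrite /= (IH _ _ P'p sub); case: (g x); case: (g y); case: (g z).
Qed.

Variables (x0 : G) (s : seq G).
Hypotheses (cs : ucycle (@adj G) s) (s2 : 2 < size s).
Let c k := nth x0 s (k %% size s).

Lemma cyc_mem k : c k \in s.
Proof. by rewrite mem_nth // ltn_mod; apply: leq_trans s2. Qed.

Lemma cyc_eq i j : (c i == c j) = (i == j %[mod size s]).
Proof.
case/andP: cs => _ us; rewrite nth_uniq // ltn_mod; exact: leq_trans s2.
Qed.

Lemma cyc_ex v : v \in s -> exists2 i, i < size s & v = c i.
Proof.
move=> vs; exists (index v s); rewrite ?index_mem // /c modn_small ?index_mem //.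
by rewrite nth_index.
Qed.

Lemma cyc_adj k : adj (c k) (c k.+1).
Proof.
have m0 : 0 < size s by apply: leq_trans s2.
case/andP: cs => cys _; rewrite /c -addn1 -modnDml addn1.
move: (k %% size s) (ltn_pmod k m0) => {k} k km.
case: (s) cys km => // a p /(pathP x0) /= /(_ k); rewrite size_rcons => + km.
move/(_ km); rewrite -rcons_cons !nth_rcons /= km.
case: (ltngtP k (size p)) => [kp| |->].
- by rewrite modn_small.
- by rewrite ltnNge -ltnS km.
- by rewrite modnn.
Qed.

Lemma cyc_arc i d : d < size s ->
  exists A, epath A (c i) (c (i + d)) d /\ forall t, t \in A -> exists2 k, k <= d & t = c (i + k).
Proof.
elim: d => [|d IH] dm.
  exists [set c i]; rewrite addn0; split; first exact: epath0.
  by move=> t /set1P->; exists 0; rewrite ?addn0.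
have [A [Ap AE]] := IH (ltnW dm).
have E := epath1 (cyc_adj (i + d)); rewrite -addnS in E.
exists (A :|: [set c (i + d); c (i + d.+1)]); split.
  have := epath_cat Ap E; rewrite addn1; apply=> t tA; rewrite !inE => /orP[/eqP//|/eqP E'].
  have [k kd] := AE t tA; rewrite E' => /eqP; rewrite cyc_eq eqn_modDl.
  have km : k < size s by clear -kd dm; lia.
  by rewrite !modn_small // => /eqP; clear -kd; lia.
move=> t; rewrite !inE => /or3P[tA|/eqP->|/eqP->].
- by have [k kd ->] := AE t tA; exists k; rewrite // ltnW.
- by exists d.
- by exists d.+1.
Qed.

End ParityPath.

(** * Colouring around a cycle of length 2l + 3 *)

Section TriangleFree.
Variables (G : sgraph) (l : nat).
Implicit Types (x y z t u v w : G) (W X Y Z K M S U P Q D : {set G}) (s : seq G).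
Hypotheses (l2 : 2 <= l) (odl : odd_lengths G l) (cr : vertex_critical G 3).
Hypothesis no_triangle : forall x y z, adj x y -> adj y z -> adj x z = false.

Let m := 2 * l + 3.

Lemma odd_length_m n : cycle_of_length G n -> odd n -> n = m.
Proof.
move=> cn on; case: (odl cn on) => // n3; subst n.
case: cn => -[|a [|b [|d [|u p]]]] [//= cs _ _].
case/andP: cs => /= /and4P[ab bd da _] _.
by have := no_triangle ab bd; rewrite adj_sym da.
Qed.

Lemma long_cycle : exists s, [/\ ucycle (@adj G) s, size s = m & 2 < size s].
Proof.
have [[s [cs os s2 _]]|no] := classic (odd_cycle_in [set: G]).
  by exists s; split=> //; apply: odd_length_m => //; exists s.
case: cr => + _; case; have [g gP] := bipartite no.
exists (fun v => if g v then ord0 else ord_max) => x y xT yT /(gP x y xT yT).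
by case: (g x); case: (g y).
Qed.

Variables (x0 : G) (s : seq G).
Hypotheses (cs : ucycle (@adj G) s) (sm : size s = m) (s2 : 2 < size s).
Let S := [set t in s].
Let c k := nth x0 s (k %% size s).

(** Here [d] is the distance of the indices, written with truncated subtraction. The ear closes with
    an arc of length [d] and with one of length [m - d]; as [m] is odd, exactly one of these cycles
    is odd, and it has length [m]. *)
Lemma ear_length i j W p : i < m -> j < m -> i != j -> epath W (c i) (c j) p -> 1 < p ->
  (forall t, t \in W -> t \in s -> t = c i \/ t = c j) ->
  let d := (i - j) + (j - i) in if odd (p + d) then p + d = m else p = d.
Proof.
wlog ij : i j W / i < j.
  move=> wl im jm ne Wp p1 hit /=; have [ij|ji|E] := ltngtP i j.
  - exact: (wl i j W).
  - have := wl j i W ji jm im _ (epath_sym Wp) p1; rewrite /= [j - i + _]addnC eq_sym.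
    by apply=> // t tW ts; case: (hit t tW ts); [right | left].
  - by rewrite E eqxx in ne.
move=> im jm _ Wp p1 hit /=.
have -> : i - j + (j - i) = j - i by clear -ij; lia.
have cij : c i != c j by rewrite cyc_eq // sm !modn_small //; clear -ij; lia.
have cyc A B q q' : epath A (c i) (c j) q -> epath B (c i) (c j) q' -> 1 < q -> 0 < q' ->
    (forall t, t \in A -> t \in B -> t = c i \/ t = c j) -> odd (q + q') -> q + q' = m.
  move=> Ap Bp q1 q0 dis; apply: odd_length_m; apply: epath_cycle Ap Bp cij dis _.
  by clear -q1 q0; lia.
have onS A : (forall t, t \in A -> t \in s) -> forall t, t \in W -> t \in A -> t = c i \/ t = c j.
  by move=> As t tW /As; apply: hit.
have [|A [Ap AE]] := @cyc_arc G x0 s cs s2 i (j - i).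
  by rewrite sm; clear -jm; lia.
have [|B [Bp BE]] := @cyc_arc G x0 s cs s2 j (m - (j - i)).
  by rewrite sm; clear -ij; rewrite /m; lia.
have ij1 : i + (j - i) = j by clear -ij; lia.
have ij2 : j + (m - (j - i)) = i + size s by rewrite sm; clear -ij jm; lia.
rewrite -/(c _) -/(c _) ij1 in Ap.
have E2 : nth x0 s ((j + (m - (j - i))) %% size s) = c i by rewrite ij2 modnDr.
rewrite E2 in Bp.
case: ifP => od.
  apply: (cyc W A) => //; first by clear -ij; lia.
  by apply: onS => t /AE[k _ ->]; apply: cyc_mem.
have : p + (m - (j - i)) = m.
  apply: (cyc W B) => //.
  - exact: epath_sym.
  - by clear -ij jm; lia.
  - by apply: onS => t /BE[k _ ->]; apply: cyc_mem.
  - by move: od; clear -ij jm; rewrite /m; lia.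
by clear -ij jm; lia.
Qed.

(** An even gap would close an odd cycle of length [j - i + 1 < m]. The condition [0 < i] leaves out
    the edge from the last vertex of [s] to the first. *)
Lemma chord_odd i j : 0 < i -> i < j -> j < m -> adj (c i) (c j) -> odd (j - i).
Proof.
move=> i0 ij jm cij; apply: contraT => ev.
have [|A [Ap AE]] := @cyc_arc G x0 s cs s2 i (j - i).
  by rewrite sm; clear -jm; lia.
have ij1 : i + (j - i) = j by clear -ij; lia.
rewrite -/(c _) -/(c _) ij1 in Ap.
have : 1 + (j - i) = m.
  apply: odd_length_m; last by move: ev; clear -ij; lia.
  apply: (epath_cycle (epath1 cij) Ap); first exact: adj_neq.
    by move=> t; rewrite !inE => /orP[]/eqP->; [left | right].
  by move: ev; clear -ij; lia.
by clear -i0 ij jm; lia.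
Qed.

(* The two ears cut out by an odd cycle [s'] and two paths from it to [s] have
   total length [m] plus twice the length of the paths, but as ears of [s] of different
   parity their total length is [m]. *)
Lemma odd_cycle_meets_twice s' : ucycle (@adj G) s' -> odd (size s') -> 2 < size s' ->
  exists a b, [/\ a != b, a \in s, b \in s, a \in s' & b \in s'].
Proof.
move=> cs' os' s'2; have [//|few] := classic (exists a b, [/\ a != b, a \in s, b \in s, a \in s' & b \in s']).
have con := critical_two_connected cr.
have sm' : size s' = m by apply: odd_length_m => //; exists s'.
(* By [ear_length], of two ears of different parity with the same ends one has length [d] and the
   other [m - d]. *)
have two W W' a b q q' : a \in s -> b \in s -> a != b -> epath W a b q -> epath W' a b q' ->
    (forall t, t \in W -> t \in s -> t = a \/ t = b) ->
    (forall t, t \in W' -> t \in s -> t = a \/ t = b) ->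
    1 < q -> 1 < q' -> odd (q + q') -> q + q' = m.
  move=> /(cyc_ex x0)[i im ->] /(cyc_ex x0)[j jm ->] ne Wp W'p hit hit' q1 q'1 od.
  have nij : i != j by apply: contraNneq ne => ->.
  rewrite sm in im jm.
  have /= := ear_length im jm nij Wp q1 hit; have /= := ear_length im jm nij W'p q'1 hit'.
  by move: od; clear -im jm nij; rewrite /m in im jm *; do 2![case: ifP]; lia.
have [a [b [ab as' bs']]] := cycle_two_points cs' s'2.
have [a' [b' [ab' as_ bs_]]] := cycle_two_points cs s2.
have [[z [zs zs']]|dj] := classic (exists z, z \in s /\ z \in s').
  have only t : t \in s -> t \in s' -> t = z.
    move=> ts ts'; apply/eqP/negP=> tz; case: few; exists t, z; split=> //.
    exact/negP.
  have [x xs' xz] : exists2 x, x \in s' & x != z.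
    by have [<-|] := eqVneq a z; [exists b; rewrite // eq_sym | exists a].
  have [y ys yz] : exists2 y, y \in s & y != z.
    by have [<-|] := eqVneq a' z; [exists b'; rewrite // eq_sym | exists a'].
  have xs'S : x \in [set t in s'] by rewrite inE.
  have ysS : y \in S by rewrite inE.
  have [|W [u [v [k [[Wp sub us' vs] [hu hv]]]]]] := connect_ear (con z x y xz yz) _ xs'S ysS.
    by rewrite !inE.
  rewrite !inE in us' vs.
  have zW : z \notin W by apply/negP=> /(subsetP sub); rewrite !inE eqxx.
  have uz : z != u by apply: contraNneq zW => ->; apply: epath_start Wp.
  have vz : z != v by apply: contraNneq zW => ->; apply: epath_end Wp.
  have k0 : 0 < k.
    by case: k Wp => // /epath_nil[E _]; case/eqP: uz; rewrite (only u) // E.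
  have [A [B [i [j [Ap Bp dAB sE ij]]]]] := cycle_arcs cs' zs' us' uz.
  have inA t : t \in A -> t \in s' by move=> tA; rewrite -[t \in s']in_set sE inE tA.
  have inB t : t \in B -> t \in s' by move=> tB; rewrite -[t \in s']in_set sE inE tB orbT.
  have ear A' i' : epath A' z u i' -> (forall t, t \in A' -> t \in s') ->
      epath (A' :|: W) z v (i' + k) /\
      (forall t, t \in A' :|: W -> t \in s -> t = z \/ t = v).
    move=> A'p inA'; split.
      by apply: epath_cat A'p Wp _ => t /inA' ts' tW; apply: hu; rewrite // inE.
    move=> t; rewrite inE => /orP[/inA' ts' ts|tW ts]; first by left; apply: only.
    by right; apply: hv; rewrite // inE.
  have [P1 h1] := ear _ _ Ap inA; have [P2 h2] := ear _ _ Bp inB.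
  have i0 : 0 < i by case: i Ap {ij P1} => // /epath_nil[E _]; rewrite E eqxx in uz.
  have j0 : 0 < j by case: j Bp {ij P2} => // /epath_nil[E _]; rewrite E eqxx in uz.
  have := two _ _ _ _ _ _ zs vs vz P1 P2 h1 h2.
  by move: os'; rewrite -sm' -ij; clear -i0 j0 k0; lia.
have [] := @menger2 _ [set t in s'] S a b a' b' con; rewrite ?inE //.
move=> W1 [W2 [x1 [y1 [x2 [y2 [k1 [k2 [[W1p W2p x1s y1s] [[x2s y2s dis] [h1 h2 h3 h4]]]]]]]]]].
have x12 : x1 != x2.
  apply: contraTneq (epath_start W2p) => <-; exact: dis (epath_start W1p).
have y12 : y1 != y2.
  apply: contraTneq (epath_end W2p) => <-; exact: dis (epath_end W1p).
rewrite !inE in x1s x2s y1s y2s.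
have pos W x y k : epath W x y k -> x \in s' -> y \in s -> 0 < k.
  by case: k => // /epath_nil[-> _] ys' ys; case: dj; exists y.
have k10 := pos _ _ _ _ W1p x1s y1s; have k20 := pos _ _ _ _ W2p x2s y2s.
have [A [B [i [j [Ap Bp _ sE ij]]]]] := cycle_arcs cs' x1s x2s x12.
have inA t : t \in A -> t \in s' by move=> tA; rewrite -[t \in s']in_set sE inE tA.
have inB t : t \in B -> t \in s' by move=> tB; rewrite -[t \in s']in_set sE inE tB orbT.
have ear A' i' : epath A' x1 x2 i' -> (forall t, t \in A' -> t \in s') ->
    epath (W1 :|: A' :|: W2) y1 y2 (k1 + i' + k2) /\
    (forall t, t \in W1 :|: A' :|: W2 -> t \in s -> t = y1 \/ t = y2).
  move=> A'p inA'; split.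
    by apply: epath_join W1p W2p A'p _ _ dis => t tW /inA' ts; [apply: h1 | apply: h3];
      rewrite // inE.
  move=> t; rewrite !inE => /orP[/orP[tW|/inA' ts']|tW] ts.
  - by left; apply: h2; rewrite // inE.
  - by case: dj; exists t.
  - by right; apply: h4; rewrite // inE.
have [P1 e1] := ear _ _ Ap inA; have [P2 e2] := ear _ _ Bp inB.
have := two _ _ _ _ _ _ y1s y2s y12 P1 P2 e1 e2.
by move: os'; rewrite -sm' -ij; clear -k10 k20; lia.
Qed.

Variable g : G -> bool.
Hypothesis gP : two_coloring (~: S) g.

(** Otherwise [D] is odd and closes through [c h] to an odd cycle that meets [s] in this vertex
    only. *)
Lemma same_side p q D h : D \subset ~: S -> (exists k, epath D p q k) ->
  adj p (c h) -> adj q (c h) -> g p = g q.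
Proof.
move=> sub [k Dp] ph qh; apply/eqP; apply: contraT => gpq.
have pq : p != q by apply: contraNneq gpq => ->.
have Q2 : epath (p |: [set c h; q]) p q 2 by apply: epath2; rewrite // adj_sym.
have kodd := two_coloring_epath gP Dp sub; rewrite gpq in kodd.
have chS : c h \in s by apply: cyc_mem.
have chD : c h \notin D by apply/negP=> /(subsetP sub); rewrite !inE chS.
have [||s' [cs' sz' sub']] := epath_cycle_in Dp Q2 pq.
- move=> t tD; rewrite !inE => /or3P[]/eqP E; [by left| |by right].
  by rewrite -E tD in chD.
- by case: k kodd {Dp} => // k; clear; lia.
have [||a [b [ab as_ bs as' bs']]] := odd_cycle_meets_twice cs'.
- by rewrite sz' oddD kodd.
- by rewrite sz'; case: k kodd {Dp sz'} => // k; clear; lia.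
have E t : t \in s -> t \in s' -> t = c h.
  move=> ts /sub'; rewrite !inE => /orP[/(subsetP sub)|]; first by rewrite !inE ts.
  have nD u : u \in D -> t != u.
    by move=> /(subsetP sub); rewrite !inE; apply: contraNneq => <-.
  by rewrite (negPf (nD _ (epath_start Dp))) (negPf (nD _ (epath_end Dp))) orbF => /eqP.
by case/eqP: ab; rewrite (E a) // (E b).
Qed.

Lemma ear_through D p q k i j : i < m -> j < m -> i != j ->
  epath D p q k -> D \subset ~: S -> adj p (c i) -> adj q (c j) ->
  let d := (i - j) + (j - i) in if odd (k + d) then k + 2 + d = m else k + 2 = d.
Proof.
move=> im jm ij Dp sub pi qj.
have nD h : c h \notin D by apply/negP=> /(subsetP sub); rewrite !inE cyc_mem.
have cij : c j != c i.
  by apply/negP; rewrite cyc_eq // sm !modn_small // eq_sym (negPf ij).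
have D1 : epath (c i |: D) (c i) q k.+1 by apply: epath_consl Dp _; rewrite // adj_sym.
have D2 : epath (c j |: (c i |: D)) (c j) (c i) k.+2.
  apply: epath_consl (epath_sym D1) _; first by rewrite adj_sym.
  by rewrite !inE negb_or cij nD.
have := @ear_length i j _ k.+2 im jm ij (epath_sym D2) isT.
rewrite /= negbK addn2; apply=> t; rewrite !inE.
case/or3P=> [/eqP|/eqP|/(subsetP sub)]; [by right | by left |].
by rewrite !inE => /negPf->.
Qed.

(** A path from [r] first reaches the edge [pq] at one end, so there are ears from [c h] to [c i]
    and to [c j] whose lengths differ by 1. Hence the index distances from [h] to [i] and [j] differ
    by 1 or add up to the even number [m - 1] or [m + 1]; outside the interval they would differ by
    3. *)
Lemma third_attachment W p q r i j h : W \subset ~: S -> connect (radj W) r p ->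
  p \in W -> q \in W -> r \in W -> adj p q -> adj p (c i) -> adj q (c j) -> adj r (c h) ->
  i < m -> j < m -> h < m -> (i - j) + (j - i) = 3 -> h != i -> h != j ->
  (i < h < j) || (j < h < i).
Proof.
move=> sub con pW qW rW pq pi qj rh im jm hm d3 hi hj.
have [P [k [Pp sP]]] := connect_epath con rW.
have pZ : p \in [set p; q] by rewrite !inE eqxx.
have [U [z [n [Up sU zZ hit _]]]] := epath_hit Pp pZ.
have {}sU := subset_trans sU (subset_trans sP sub).
have [pS qS] : p \notin S /\ q \notin S.
  by split; [have := subsetP sub _ pW | have := subsetP sub _ qW]; rewrite inE.
have ext u v : adj u v -> epath U r u n -> (v \in U -> v = u) -> v \notin S ->
    exists2 D, epath D r v n.+1 & D \subset ~: S.
  move=> uv Uu hv vS; exists (v |: U); last first.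
    by rewrite subUset sub1set sU andbT inE.
  apply/epath_sym/(epath_consl _ (epath_sym Uu)); first by rewrite adj_sym.
  by apply/negP=> /hv E; rewrite E adj_irrefl in uv.
move: zZ; rewrite !inE => /orP[]/eqP E; subst z.
- have [|D Dp sD] := ext p q pq Up _ qS; first by move=> qU; apply: hit; rewrite // !inE eqxx orbT.
  have := ear_through hm im hi Up sU rh pi; have := ear_through hm jm hj Dp sD rh qj.
  move: d3 hi hj im jm hm; clear; rewrite /m => d3 hi hj im jm hm /=.
  by do 2![case: ifP]; lia.
- rewrite adj_sym in pq.
  have [|D Dp sD] := ext q p pq Up _ pS; first by move=> qU; apply: hit; rewrite // !inE eqxx.
  have := ear_through hm im hi Dp sD rh pi; have := ear_through hm jm hj Up sU rh qj.
  move: d3 hi hj im jm hm; clear; rewrite /m => d3 hi hj im jm hm /=.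
  by do 2![case: ifP]; lia.
Qed.

(* [c 0] gets a colour of its own and the other vertices of [s] are coloured by the
   parity of their index.  [clash b p]: the colour [g p (+) b] is taken by a neighbour
   of [p] on [s]; such a [p] is recoloured with the colour of [c 0]. *)
Let clash b p := [exists i : 'I_m, [&& 0 < i, adj p (c i) & odd i == g p (+) b]].
Let bad b v := [exists p in component (~: S) v, clash b p &&
  (adj p (c 0) || [exists q in component (~: S) v, adj p q && clash b q])].

(** A failure is a clashing neighbour of [c 0] or an edge with two clashing ends. Such an edge is
    attached at indices 3 apart, and by [third_attachment] the failure for the other value would
    have to be attached strictly between them. *)
Lemma not_both_bad v : v \notin S -> bad false v -> bad true v -> False.
Proof.
move=> vS.
have vC : v \in ~: S by rewrite inE.
have m0 : 0 < m by rewrite /m addnS.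
have subC := component_sub vC.
have con p q : p \in component (~: S) v -> q \in component (~: S) v -> connect (radj (~: S)) p q.
  by rewrite !inE connect_radj_sym; apply: connect_trans.
have side p q h : p \in component (~: S) v -> q \in component (~: S) v ->
    adj p (c h) -> adj q (c h) -> g p = g q.
  move=> pv qv ph qh; have [|D [k [Dp sD]]] := connect_epath (con p q pv qv).
    exact: (subsetP subC).
  by apply: same_side sD _ ph qh; exists k.
(* The ear through [pq] has length 3 and the indices have different parity, so [ear_through] gives
   index distance 3. *)
have edge b p q i j : p \in ~: S -> q \in ~: S -> adj p q -> i < m -> j < m ->
    adj p (c i) -> odd i = g p (+) b -> adj q (c j) -> odd j = g q (+) b ->
    (i - j) + (j - i) = 3.
  move=> pS qS pq im jm pi oi qj oj; have gpq := gP pS qS pq.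
  have oij : odd i != odd j by rewrite oi oj; move: gpq; case: (g p); case: (g q); case: (b).
  have ij : i != j by apply: contraNneq oij => ->.
  have sD : [set p; q] \subset ~: S by rewrite subUset !sub1set pS qS.
  have := ear_through im jm ij (epath1 pq) sD pi qj.
  move: oij im jm; clear; rewrite /m => oij im jm /=; case: ifP; last by lia.
  by lia.
case/exists_inP=> p pv /andP[/existsP[[i im] /= /and3P[i0 pi /eqP oi]] F0].
case/exists_inP=> p' pv' /andP[/existsP[[i' im'] /= /and3P[i0' pi' /eqP oi']] F1].
have [pS pS'] : p \in ~: S /\ p' \in ~: S by split; apply: (subsetP subC).
case/orP: F0 => [p0|/exists_inP[q qv /andP[pq /existsP[[j jm] /= /and3P[j0 qj /eqP oj]]]]];
case/orP: F1 => [p0'|/exists_inP[q' qv' /andP[pq' /existsP[[j' jm'] /= /and3P[j0' qj' /eqP oj']]]]].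
(* Both failures are at [c 0]: the ears of length 2 force [i] and [i'] to be 2 and [m - 2]. The path
   from [p] to [p'] then has length 2 by the ear between [c i] and [c i'], but length 0 by the ear
   from [c 0] to [c i']. *)
- have gpp := side _ _ _ pv pv' p0 p0'.
  have n0i : 0 != i by rewrite neq_ltn i0.
  have n0i' : 0 != i' by rewrite neq_ltn i0'.
  have [|D [k [Dp sD]]] := connect_epath (con p p' pv pv'); first by [].
  have sub1 u : u \in ~: S -> [set u] \subset ~: S by rewrite sub1set.
  have e1 := ear_through m0 im n0i (epath0 p) (sub1 p pS) p0 pi.
  have e2 := ear_through m0 im' n0i' (epath0 p') (sub1 p' pS') p0' pi'.
  have oii : odd i' = ~~ odd i by rewrite oi oi' gpp addbT addbF.
  have ii : i != i' by apply/eqP=> E; move: oii; rewrite E; case: odd.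
  have e3 := ear_through im im' ii Dp sD pi pi'.
  have e4 := ear_through m0 im' n0i' Dp sD p0 pi'.
  have ek : ~~ odd k by rewrite (two_coloring_epath gP Dp sD) gpp eqxx.
  move: e1 e2 e3 e4 ek oii im im' l2; clear; rewrite /m /=.
  by do 4![case: ifP]; lia.
- have qS' := subsetP subC _ qv'.
  have d3 := edge _ _ _ _ _ pS' qS' pq' im' jm' pi' oi' qj' oj'.
  have := third_attachment (subxx _) (con _ _ pv pv') pS' qS' pS pq' pi' qj' p0 im' jm' m0 d3.
  by move: i0' j0'; clear; lia.
- have qS := subsetP subC _ qv.
  have d3 := edge _ _ _ _ _ pS qS pq im jm pi oi qj oj.
  have := third_attachment (subxx _) (con _ _ pv' pv) pS qS pS' pq pi qj p0' im jm m0 d3.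
  by move: i0 j0; clear; lia.
(* Both [i'] and [j'] would lie strictly between [i] and [j], which are 3 apart, and yet be 3 apart
   themselves. *)
- have qS := subsetP subC _ qv; have qS' := subsetP subC _ qv'.
  have d3 := edge _ _ _ _ _ pS qS pq im jm pi oi qj oj.
  have d3' := edge _ _ _ _ _ pS' qS' pq' im' jm' pi' oi' qj' oj'.
  have far r h : r \in component (~: S) v -> adj r (c h) -> h < m -> odd h = g r (+) true ->
      (i < h < j) || (j < h < i).
    move=> rv rh hm oh; have rS := subsetP subC _ rv.
    apply: (third_attachment (subxx _) (con _ _ rv pv) pS qS rS pq pi qj rh im jm hm d3).
    - apply/eqP=> E; subst h; have := side _ _ _ rv pv rh pi.
      by move: oh; rewrite oi; case: (g p); case: (g r).
    - apply/eqP=> E; subst h; have := side _ _ _ rv qv rh qj.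
      by move: oh; rewrite oj; case: (g q); case: (g r).
  have := far _ _ pv' pi' im' oi'; have := far _ _ qv' qj' jm' oj'.
  by move: d3 d3'; clear; lia.
Qed.

Let cl (r b : bool) : 'I_3 := if r then inord 2 else inord b.

Lemma cl_neq r b r' b' : ~~ (r && r') -> (~~ r -> ~~ r' -> b != b') -> cl r b != cl r' b'.
Proof.
rewrite /cl -(inj_eq val_inj).
by case: r; case: r' => //= _ h; case: b h; case: b' => h; rewrite ?inordK //; have := h isT isT.
Qed.

Lemma triangle_free_colorable : colorable_on 3 [set: G].
Proof.
(* [bad] depends on the component only, so [flip] is constant on components; it swaps the two
   colours exactly where [g] itself is bad. *)
pose flip v := bad false v.
pose red v := if v \in s then index v s == 0 else clash (flip v) v.
pose base v := if v \in s then odd (index v s) else g v (+) flip v.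
have flipP v : v \notin S -> bad (flip v) v = false.
  move=> vS; rewrite /flip; case b0 : (bad false v) => //.
  exact/negbTE/negP/(not_both_bad vS b0).
have idx v : v \in s -> index v s < m by move=> vs; rewrite -sm index_mem.
have cI v : v \in s -> c (index v s) = v.
  by move=> vs; rewrite /c modn_small ?index_mem // nth_index.
have mixed u v : u \notin s -> v \in s -> adj u v -> cl (red u) (base u) != cl (red v) (base v).
  move=> us vs uv; rewrite /red /base (negPf us) vs.
  have uS : u \notin S by rewrite inE.
  have := flipP u uS; rewrite /bad => /negbT; rewrite negb_exists => /forallP/(_ u).
  rewrite component_refl /= negb_and => nb; apply: cl_neq.
    apply/negP=> /andP[clu /eqP i0]; move: nb; rewrite clu negb_or /= => /andP[nc _].
    by case/negP: nc; rewrite -i0 cI.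
  move=> /existsPn h i0; have := h (Ordinal (idx v vs)); rewrite /= lt0n i0 cI // uv /=.
  by rewrite eq_sym.
exists (fun v => cl (red v) (base v)) => u v _ _ uv.
have [us|us] := boolP (u \in s); have [vs|vs] := boolP (v \in s).
- rewrite /red /base us vs; apply: cl_neq.
    apply/negP=> /andP[/eqP iu /eqP iv]; have := adj_neq uv.
    by rewrite -(cI u us) -(cI v vs) iu iv eqxx.
  move=> iu iv.
  have [lt|lt|E] := ltngtP (index u s) (index v s).
  + have := chord_odd (i := index u s) (j := index v s); rewrite !cI // lt0n => /(_ iu lt (idx v vs) uv).
    by rewrite oddB 1?ltnW //; case: odd; case: odd.
  + rewrite adj_sym in uv.
    have := chord_odd (i := index v s) (j := index u s); rewrite !cI // lt0n => /(_ iv lt (idx u us) uv).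
    by rewrite oddB 1?ltnW //; case: odd; case: odd.
  + by have := adj_neq uv; rewrite -(cI u us) -(cI v vs) E eqxx.
- by rewrite eq_sym; apply: mixed; rewrite // adj_sym.
- exact: mixed.
- rewrite /red /base (negPf us) (negPf vs).
  have [uS vS] : u \in ~: S /\ v \in ~: S by split; rewrite !inE.
  have vu : v \in component (~: S) u.
    by apply: (component_closed uS _ uv vS); apply: component_refl.
  have same : component (~: S) u = component (~: S) v.
    apply/setP=> t; rewrite !inE; rewrite inE in vu.
    by rewrite (same_connect (@connect_radj_sym _ _) vu).
  have fuv : flip u = flip v by rewrite /flip /bad same.
  apply: cl_neq; last by move=> _ _; rewrite fuv; have := gP uS vS uv; case: (g u); case: (g v); case: (flip v).
  apply/negP=> /andP[cu cv].
  have := flipP u; rewrite in_setC in uS => /(_ uS)/negbT; rewrite /bad negb_exists => /forallP/(_ u).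
  rewrite component_refl cu /= negb_or => /andP[_ /negP[]].
  by apply/exists_inP; exists v; rewrite // uv fuv.
Qed.

End TriangleFree.

Lemma triangle_free_critical_false (G : sgraph) l : 2 <= l -> odd_lengths G l ->
  vertex_critical G 3 -> (forall x y z : G, adj x y -> adj y z -> adj x z = false) -> False.
Proof.
move=> l2 odl cr nt; have [s [cs sm s2]] := long_cycle odl cr nt.
have [x0 x0s] : exists x0, x0 \in s by case: (s) s2 => // x p _; exists x; rewrite inE eqxx.
have [[p [cp op p2 sub]]|/bipartite[g gP]] := classic (odd_cycle_in (~: [set t in s])).
  have [a [b [_ as_ _ ap _]]] := odd_cycle_meets_twice odl cr nt x0 cs sm s2 cp op p2.
  by have := sub a ap; rewrite !inE as_.
by case: (cr) => + _; case; apply: (triangle_free_colorable l2 odl cr nt x0 cs sm s2 gP).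
Qed.

(** * Tripods *)

Section Component.
Variable G : sgraph.
Implicit Types (x y z t u v w : G) (W X Y Z D M : {set G}).

Lemma component_connected W x u v : x \in W -> u \in component W x -> v \in component W x ->
  connect (radj (component W x)) u v.
Proof.
move=> xW; suff con t : t \in component W x -> connect (radj (component W x)) x t.
  by move=> /con xu /con; apply: connect_trans; rewrite connect_radj_sym.
rewrite inE => /connect_epath[//|P [k [Pp sub]]]; apply: (epath_connect Pp).
apply/subsetP=> z zP; have [A [B [i [j [Ap _ _ PE _]]]]] := epath_split Pp zP.
rewrite inE; apply: epath_connect Ap _; apply: subset_trans sub.
by rewrite PE subsetUl.
Qed.

End Component.

Section Tripods.
Variables (G : sgraph) (R D : {set G}).
Implicit Types (x y z t u v w q : G) (W X Y Z M : {set G}).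
Hypothesis DR : forall t, t \in D -> t \notin R.
Hypothesis NDR : forall u v, u \in D -> adj u v -> v \notin D -> v \in R.
Hypothesis conD : forall u v, u \in D -> v \in D -> connect (radj D) u v.

(** [R] is a set of roots and [D] a connected set attached to the rest of the graph through [R]
    only; all length bounds are stated for these paths. *)
Definition ext x y k := exists2 W, epath W x y k & W \subset [set x; y] :|: D.

Lemma ext_sym x y k : ext x y k -> ext y x k.
Proof. by case=> W /epath_sym Wp sub; exists W => //; rewrite [[set y; x]]setUC. Qed.

Record tripod q x y z X Y Z a b c : Prop := Tripod {
  tp_q : q \in D;
  tp_x : x \in R; tp_y : y \in R; tp_z : z \in R;
  tp_xy : x != y; tp_xz : x != z; tp_yz : y != z;
  tp_X : epath X q x a; tp_Y : epath Y q y b; tp_Z : epath Z q z c;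
  tp_XD : X \subset x |: D; tp_YD : Y \subset y |: D; tp_ZD : Z \subset z |: D;
  tp_XY : forall t, t \in X -> t \in Y -> t = q;
  tp_XZ : forall t, t \in X -> t \in Z -> t = q;
  tp_YZ : forall t, t \in Y -> t \in Z -> t = q }.

Lemma tripod_swap q x y z X Y Z a b c :
  tripod q x y z X Y Z a b c -> tripod q x z y X Z Y a c b.
Proof.
by case=> *; split=> //; [rewrite eq_sym | move=> t tZ tY; auto].
Qed.

Lemma tripod_rot q x y z X Y Z a b c :
  tripod q x y z X Y Z a b c -> tripod q y z x Y Z X b c a.
Proof.
by case=> *; split=> //; first [by rewrite eq_sym | by move=> t t1 t2; auto].
Qed.

Lemma epath_two_legs q x y X Y a b : epath X q x a -> epath Y q y b ->
  X \subset x |: D -> Y \subset y |: D -> (forall t, t \in X -> t \in Y -> t = q) ->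
  ext x y (a + b).
Proof.
move=> Xp Yp XD YD XY; exists (X :|: Y); first exact: epath_cat (epath_sym Xp) Yp XY.
rewrite subUset (subset_trans XD) ?(subset_trans YD) //.
  by rewrite -setUA subsetUr.
by rewrite subUset subsetUr andbT sub1set !inE eqxx.
Qed.

Lemma tripod_ext q x y z X Y Z a b c : tripod q x y z X Y Z a b c -> ext x y (a + b).
Proof. by case=> *; apply: epath_two_legs; eauto. Qed.

(** Join [x'] to [y'] in [D]; the centre [q] is where a path from [z'] first meets this path. *)
Lemma tripod_exists x y z x' y' z' : x \in R -> y \in R -> z \in R ->
  x != y -> x != z -> y != z -> x' \in D -> y' \in D -> z' \in D ->
  adj x x' -> adj y y' -> adj z z' ->
  exists q X Y Z a b c, tripod q x y z X Y Z a b c.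
Proof.
move=> xR yR zR xy xz yz x'D y'D z'D xx' yy' zz'.
have [P [n [Pp sP]]] := connect_epath (conD x'D y'D) x'D.
have zx' := conD z'D x'D.
have [U [m [Up sU]]] := connect_epath zx' z'D.
have [C [q [k [Cp sC qP hit _]]]] := epath_hit Up (epath_start Pp).
have {}sC := subset_trans sC sU.
have [A [B [i [j [Ap Bp dis PE _]]]]] := epath_split Pp qP.
have sA : A \subset D by apply: subset_trans sP; rewrite PE subsetUl.
have sB : B \subset D by apply: subset_trans sP; rewrite PE subsetUr.
have noR W r : W \subset D -> r \in R -> r \notin W.
  by move=> sW rR; apply/negP=> /(subsetP sW)/DR; rewrite rR.
have legp r r' W k' : r \in R -> adj r r' -> epath W r' q k' -> W \subset D ->
    epath (r |: W) q r k'.+1.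
  move=> rR rr' Wp sW; apply: epath_sym; apply: epath_consl Wp _ => //; exact: noR.
have meet W W' r r' : W \subset D -> W' \subset D -> r \in R -> r' \in R -> r != r' ->
    (forall t, t \in W -> t \in W' -> t = q) ->
    forall t, t \in r |: W -> t \in r' |: W' -> t = q.
  move=> sW sW' rR r'R rr' h t; rewrite !inE => /orP[/eqP->|tW] /orP[/eqP E|tW'].
  - by rewrite E eqxx in rr'.
  - by rewrite (negPf (noR _ _ sW' rR)) in tW'.
  - by rewrite E (negPf (noR _ _ sW r'R)) in tW.
  - exact: h.
exists q, (x |: A), (y |: B), (z |: C), i.+1, j.+1, k.+1; split=> //.
- exact/(subsetP sP).
- exact: legp Ap sA.
- exact: legp (epath_sym Bp) sB.
- exact: legp Cp sC.
- exact: setUS.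
- exact: setUS.
- exact: setUS.
- exact: meet.
- by apply: meet => // t tA tC; apply: hit; rewrite // PE inE tA.
- by apply: meet => // t tB tC; apply: hit; rewrite // PE inE tB orbT.
Qed.

(* The first part of the leg [X] is used from [z], the rest from [x]. *)
Lemma ray_ext q x y z X Z W a c u e :
  epath X q x a -> epath Z q z c -> X \subset x |: D -> Z \subset z |: D ->
  (forall t, t \in X -> t \in Z -> t = q) -> q != u -> x != u -> u \in X ->
  epath W u y e -> W \subset y |: D -> (forall t, t \in W -> t \in X -> t = u) ->
  (forall t, t \in W -> t \notin Z) ->
  exists i A B, [/\ 0 < i, i < a, ext x y (a - i + e) & ext z y (c + i + e)] /\
    [/\ epath A q u i, epath B u x (a - i), forall t, t \in A -> t \in B -> t = u &
        X = A :|: B].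
Proof.
move=> Xp Zp sX sZ XZ qu xu uX Wp sW WX WZ.
have [A [B [i [j [Ap Bp dis XE ij]]]]] := epath_split Xp uX.
have sA : A \subset x |: D by apply: subset_trans sX; rewrite XE subsetUl.
have sB : B \subset x |: D by apply: subset_trans sX; rewrite XE subsetUr.
have xA : x \notin A.
  apply/negP=> xA; case/eqP: xu; apply: dis => //; exact: epath_end Bp.
have i0 : 0 < i by case: i Ap {ij} => // /epath_nil[E _]; rewrite E eqxx in qu.
have j0 : 0 < j by case: j Bp {ij} => // /epath_nil[E _]; rewrite E eqxx in xu.
have aij : a - i = j by rewrite -ij addKn.
exists i, A, B; rewrite aij; split; split=> //; first by rewrite -ij -addn1 leq_add2l.
- apply: epath_two_legs Bp Wp _ _ _ => // t tB tW.
  by apply: WX; rewrite // XE inE tB orbT.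
- have ZA : epath (Z :|: A) z u (c + i).
    by apply: epath_cat (epath_sym Zp) Ap _ => t tZ tA; apply: XZ; rewrite // XE inE tA.
  exists (Z :|: A :|: W).
    apply: epath_cat ZA Wp _ => t; rewrite inE => /orP[tZ tW|tA tW].
      by have := WZ t tW; rewrite tZ.
    by apply: WX; rewrite // XE inE tA.
  apply/subsetP=> t; rewrite !inE => /orP[/orP[/(subsetP sZ)|tA]|/(subsetP sW)].
  + by rewrite !inE => /orP[]->; rewrite ?orbT.
  + have := subsetP sA t tA; rewrite !inE => /orP[/eqP E|->]; rewrite ?orbT //.
    by rewrite E (negPf xA) in tA.
  + by rewrite !inE => /orP[]->; rewrite ?orbT.
Qed.

(** * The branch behind a leg of a tripod *)

Section Branch.
Variables (q x y z : G) (X Y Z : {set G}) (a b c : nat) (w : G).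
Hypotheses (tp : tripod q x y z X Y Z a b c) (wX : w \in X) (wq : w != q) (wx : w != x).
Let M := component (D :\ q) w.

Lemma branch_base : w \in D :\ q.
Proof.
by have := subsetP (tp_XD tp) w wX; rewrite !inE wq (negPf wx).
Qed.

Lemma branch_sub : M \subset D :\ q.
Proof. exact/component_sub/branch_base. Qed.

Lemma branch_step u v : u \in M -> adj u v -> v \notin M -> v = q \/ v \in R.
Proof.
move=> uM uv vM; have /setD1P[_ uD] := subsetP branch_sub u uM.
have [vD|vD] := boolP (v \in D); last by right; apply: NDR uv vD.
have [|vq] := eqVneq v q; first by left.
case/negP: vM; apply: component_closed branch_base uM uv _.
by rewrite !inE vq.
Qed.

Lemma leg_root r : r \in R -> r \in X -> r = x.
Proof. by move=> rR /(subsetP (tp_XD tp)) /setU1P[//|/DR]; rewrite rR. Qed.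

(** If [M] contains a vertex of another leg or is adjacent to a root other than [x], trimming a
    connection from [w] gives the ear; otherwise only [q] and [x] are left as attachments. *)
Lemma branch_closed_or_ear :
  ((forall u v, u \in M -> adj u v -> v \notin M -> v = q \/ v = x) /\
   (forall t, t \in M -> t \notin Y :|: Z)) \/
  exists u v W e, [/\ u \in X, u \in M, epath W u v e, W \subset v |: M & v != x] /\
    [/\ v != q, v \in R \/ v \in Y :|: Z, forall t, t \in W -> t \in X -> t = u &
        forall t, t \in W -> t \in (Y :|: Z) :\ q :|: R :\ x -> t = v].
Proof.
pose T := (Y :|: Z) :\ q :|: R :\ x.
have qM : q \notin M by apply/negP=> /(subsetP branch_sub); rewrite !inE eqxx.
have RM r : r \in R -> r \notin M.
  by move=> rR; apply/negP=> /(subsetP branch_sub)/setD1P[_ /DR]; rewrite rR.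
have ear N t : t \in T -> connect (radj N) w t -> w \in N -> N \subset t |: M ->
    exists u v W e, [/\ u \in X, u \in M, epath W u v e, W \subset v |: M & v != x] /\
    [/\ v != q, v \in R \/ v \in Y :|: Z, forall t, t \in W -> t \in X -> t = u &
        forall t, t \in W -> t \in T -> t = v].
  move=> tT con wN sN.
  have [W [u [v [e [[Wp sW uX vT] [hX hT]]]]]] := connect_ear con wN wX tT.
  have uW := epath_start Wp.
  have sW' : W \subset v |: M.
    apply/subsetP=> s sW1; have := subsetP sN _ (subsetP sW _ sW1).
    rewrite !inE => /orP[/eqP E|->]; rewrite ?orbT //.
    by rewrite (hT s sW1) ?eqxx // E.
  have xq : x != q by apply/eqP=> E; have := DR (tp_q tp); rewrite -E (tp_x tp).
  have nT s : s \in X -> s \in T -> s = q.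
    move=> sX; rewrite !inE => /orP[/andP[_ /orP[sY|sZ]]|/andP[sx sR]].
    - exact: (tp_XY tp).
    - exact: (tp_XZ tp).
    - by rewrite (leg_root sR sX) eqxx in sx.
  have qT : q \notin T by rewrite !inE eqxx /= (negPf (DR (tp_q tp))) andbF.
  have uM : u \in M.
    have := subsetP sW' u uW; rewrite !inE => /orP[/eqP E|//].
    by move: vT; rewrite -E => /[dup] uT /(nT u uX) E'; rewrite E' (negPf qT) in uT.
  have vq : v != q by apply: contraNneq qT => <-.
  have vx : v != x.
    apply: contraTneq vT => ->; rewrite !inE eqxx orbF negb_and xq /= negb_or.
    apply/andP; split; apply: contraNN xq => h.
      by apply/eqP/(tp_XY tp) => //; apply: epath_end (tp_X tp).
    by apply/eqP/(tp_XZ tp) => //; apply: epath_end (tp_X tp).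
  exists u, v, W, e; split; split=> //.
  by move: vT; rewrite !inE => /orP[/andP[_ ->]|/andP[_ ->]]; [right | left].
have wM : w \in M by apply: component_refl.
have [[t [tM tYZ]]|nYZ] := classic (exists t, t \in M /\ t \in Y :|: Z).
  right; apply: (ear M t) => //; last exact: subsetUr.
  - by rewrite 2!inE tYZ andbT; apply/orP; left; rewrite inE; apply: contraNneq qM => <-.
  - exact: component_connected branch_base wM tM.
have [[r [u [rR rx uM ur]]]|nR] := classic (exists r u, [/\ r \in R, r != x, u \in M & adj u r]).
  right; apply: (ear (r |: M) r _ _ _ (subxx _)).
  - by rewrite in_setU !in_setD1 rx rR orbT.
  - apply: (connect_trans (y := u)).
      have [P [k [Pp sP]]] := connect_epath (component_connected branch_base wM uM) wM.
      by apply: epath_connect Pp _; apply: subset_trans sP (subsetUr _ _).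
    by apply: connect1; rewrite /= ur !in_setU1 uM eqxx orbT.
  - by rewrite in_setU1 wM orbT.
left; split.
  move=> u v uM uv vM; case: (branch_step uM uv vM) => [|vR]; first by left.
  right; apply/eqP/negP=> vx; case: nR; exists v, u; split=> //; exact/negP.
by move=> t tM; apply/negP=> tYZ; case: nYZ; exists t.
Qed.

Lemma branch_ear_disjoint v W t : W \subset v |: M -> v != q -> v != x ->
  (forall t, t \in W -> t \in (Y :|: Z) :\ q :|: R :\ x -> t = v) ->
  t \in W -> t \in Y :|: Z -> t = v.
Proof.
move=> sW vq vx hT tW tYZ; apply: hT => //; rewrite in_setU in_setD1 tYZ andbT.
apply/orP; left; apply/eqP=> E; move: (subsetP sW t tW); rewrite E in_setU1 eq_sym (negPf vq).
by move=> /(subsetP branch_sub); rewrite !inE eqxx.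
Qed.

Lemma branch_neq u : u \in M -> q != u /\ x != u.
Proof.
move=> /(subsetP branch_sub) /setD1P[uq uD]; rewrite eq_sym; split=> //.
by apply: contraTneq uD => <-; apply: contraL (tp_x tp); apply: DR.
Qed.

Lemma branch_ear_pos u v W e : u \in X -> u \in M -> epath W u v e -> v != q ->
  v \in R \/ v \in Y :|: Z -> 0 < e.
Proof.
move=> uX uM Wp vq vT; case: e Wp => // /epath_nil[E _]; subst v.
case: vT => [uR|].
  by have := subsetP branch_sub _ uM; rewrite !inE => /andP[_ /DR]; rewrite uR.
by case/setUP=> h; case/eqP: vq; [apply: (tp_XY tp) | apply: (tp_XZ tp)].
Qed.

(** The ear reaches [Y] at [v] and is prolonged along [Y] to the root [y]; [e'] is the total length
    from [u]. *)
Lemma branch_ray_leg u v W e : u \in X -> u \in M -> epath W u v e -> W \subset v |: M ->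
  v != x -> v != q -> v \in Y -> (forall t, t \in W -> t \in X -> t = u) ->
  (forall t, t \in W -> t \in (Y :|: Z) :\ q :|: R :\ x -> t = v) ->
  exists i e', [/\ 0 < i, i < a, 0 < e', ext x y (a - i + e') & ext z y (c + i + e')].
Proof.
move=> uX uM Wp sW vx vq vY WX hT; have hYZ := branch_ear_disjoint sW vq vx hT.
have [qu xu] := branch_neq uM.
have [A [B [j1 [j2 [Ap Bp dis YE _]]]]] := epath_split (tp_Y tp) vY.
have BY t : t \in B -> t \in Y by rewrite YE inE => ->; rewrite orbT.
have qB : q \notin B.
  by apply: contraNN vq => qB; rewrite (dis q) // (epath_start Ap).
have vZ : v \notin Z by apply: contraNN vq => vZ; apply/eqP/(tp_YZ tp).
have WB : epath (W :|: B) u y (e + j2).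
  by apply: epath_cat Wp Bp _ => t tW /BY tY; apply: hYZ; rewrite // inE tY.
have sWB : W :|: B \subset y |: D.
  apply/subsetP=> t; rewrite in_setU => /orP[/(subsetP sW)|/BY/(subsetP (tp_YD tp))//].
  case/setU1P=> [->|/(subsetP branch_sub)/setD1P[_ tD]]; first exact: (subsetP (tp_YD tp)).
  by rewrite in_setU1 tD orbT.
have [|t|i [_ [_ [[i0 ia e1 e2] _]]]] := ray_ext (tp_X tp) (tp_Z tp) (tp_XD tp) (tp_ZD tp) (tp_XZ tp)
    qu xu uX WB sWB.
- move=> t; rewrite in_setU => /orP[|tB tX]; first exact: WX.
  by case/negP: qB; rewrite -(tp_XY tp tX (BY t tB)).
- rewrite in_setU => /orP[tW|tB]; apply/negP=> tZ.
    have tv : t = v by apply: hYZ; rewrite // inE tZ orbT.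
    by rewrite tv (negPf vZ) in tZ.
  by case/negP: qB; rewrite -(tp_YZ tp (BY t tB) tZ).
exists i, (e + j2); split=> //; rewrite addn_gt0 (branch_ear_pos uX uM Wp vq) //.
by right; rewrite inE vY.
Qed.

(** [L] is the leg of [third], of length [f]. As [L] avoids the end [v] of the ear, it avoids the
    whole ear, so the second path may come from [third] through [q]. *)
Lemma branch_ray_root u v W e third f L :
  (third = z /\ f = c /\ L = Z) \/ (third = y /\ f = b /\ L = Y) ->
  u \in X -> u \in M -> epath W u v e -> W \subset v |: M ->
  v != x -> v != q -> v \in R -> v \notin L -> (forall t, t \in W -> t \in X -> t = u) ->
  (forall t, t \in W -> t \in (Y :|: Z) :\ q :|: R :\ x -> t = v) ->
  exists i, [/\ 0 < i, i < a, 0 < e, ext x v (a - i + e) & ext third v (f + i + e)].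
Proof.
move=> third_case uX uM Wp sW vx vq vR vL WX hT; have hYZ := branch_ear_disjoint sW vq vx hT.
have [qu xu] := branch_neq uM.
have sWD : W \subset v |: D.
  apply: subset_trans sW _; apply: setUS; apply: subset_trans branch_sub _; exact: subsetDl.
have e0 : 0 < e by apply: (branch_ear_pos uX uM Wp vq); left.
have WL t : t \in W -> t \notin L.
  move=> tW; apply: contraNN vL => tL; rewrite -(hYZ t) //.
  by case: third_case => [[_ [_ E]]|[_ [_ E]]]; rewrite inE -E tL ?orbT.
case: third_case => [[-> [-> E]]|[-> [-> E]]]; subst L.
- have [i [_ [_ [[i0 ia e1 e2] _]]]] := ray_ext (tp_X tp) (tp_Z tp) (tp_XD tp) (tp_ZD tp) (tp_XZ tp)
    qu xu uX Wp sWD WX WL.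
  by exists i.
- have [i [_ [_ [[i0 ia e1 e2] _]]]] := ray_ext (tp_X tp) (tp_Y tp) (tp_XD tp) (tp_YD tp) (tp_XY tp)
    qu xu uX Wp sWD WX WL.
  by exists i.
Qed.

End Branch.

(* In the second case, the ray to [y'] leaves [X] at distance [i] from [q]. *)
Lemma branch_closed_or_ray q x y z X Y Z a b c w : tripod q x y z X Y Z a b c ->
  w \in X -> w != q -> w != x -> let M := component (D :\ q) w in
  ((forall u v, u \in M -> adj u v -> v \notin M -> v = q \/ v = x) /\
   (forall t, t \in M -> t \notin Y :|: Z)) \/
  exists y' i e, [/\ y' \in R, y' != x, 0 < i & i < a] /\ 0 < e /\
    ((y' != z /\ ext x y' (a - i + e) /\ ext z y' (c + i + e)) \/
     (y' = z /\ ext x y' (a - i + e) /\ ext y y' (b + i + e))).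
Proof.
move=> tp wX wq wx M.
have [|[u [v [W [e [[uX uM Wp sW vx] [vq vT WX hT]]]]]]] := branch_closed_or_ear tp wX wq wx.
  by left.
right; have tp' := tripod_swap tp.
have [vY|vY] := boolP (v \in Y).
  have [i [e' [i0 ia e0 e1 e2]]] := branch_ray_leg tp wX wq wx uX uM Wp sW vx vq vY WX hT.
  exists y, i, e'; split; first by split=> //; [exact: tp_y tp | rewrite eq_sym (tp_xy tp)].
  by split=> //; left; rewrite (tp_yz tp).
have [vZ|vZ] := boolP (v \in Z).
  have [|i [e' [i0 ia e0 e1 e2]]] := branch_ray_leg tp' wX wq wx uX uM Wp sW vx vq vZ WX.
    by move=> t; rewrite (setUC Z Y); apply: hT.
  exists z, i, e'; split; first by split=> //; [exact: tp_z tp | rewrite eq_sym (tp_xz tp)].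
  by split=> //; right.
have vR : v \in R by case: vT => //; rewrite inE (negPf vY) (negPf vZ).
have [E|vz] := eqVneq v z.
  by case/negP: vZ; rewrite E; apply: epath_end (tp_Z tp).
have [|i [i0 ia e0 e1 e2]] := @branch_ray_root _ _ _ _ _ _ _ _ _ _ _ tp wX wq wx u v W e z c Z _ uX uM Wp sW vx vq vR vZ WX hT.
  by left.
by exists v, i, e; split; split=> //; left.
Qed.

Lemma branch_ear_meet q x y z X Y Z a b c w t : tripod q x y z X Y Z a b c ->
  w \in X -> w != q -> w != x -> let M := component (D :\ q) w in
  t \in M -> t \in Y :|: Z -> exists u v W e,
    [/\ u \in X, u \in M, v \in M, v \in Y :|: Z & epath W u v e] /\
    [/\ W \subset M, forall t, t \in W -> t \in X -> t = u &
        forall t, t \in W -> t \in Y :|: Z -> t = v].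
Proof.
move=> tp wX wq wx M tM tYZ; have wD := branch_base tp wX wq wx.
have wM : w \in M by apply: component_refl.
have [W [u [v [e [[Wp sW uX vYZ] [hX hYZ]]]]]] :=
  connect_ear (component_connected wD wM tM) wM wX tYZ.
exists u, v, W, e; split; split=> //; apply: (subsetP sW);
  [exact: epath_start Wp | exact: epath_end Wp].
Qed.

Lemma branch_ear_root q x y z X Y Z a b c w r u : tripod q x y z X Y Z a b c ->
  w \in X -> w != q -> w != x -> let M := component (D :\ q) w in
  (forall t, t \in M -> t \notin Y :|: Z) -> u \in M -> adj u r -> r \in R -> r != x ->
  exists u' W e, [/\ u' \in X, u' \in M, epath W u' r e, W \subset r |: M &
    forall t, t \in W -> t \in X -> t = u'].
Proof.
move=> tp wX wq wx M nYZ uM ur rR rx; have wD := branch_base tp wX wq wx.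
have wM : w \in M by apply: component_refl.
have con : connect (radj (r |: M)) w r.
  apply: (connect_trans (y := u)).
    have [P [k [Pp sP]]] := connect_epath (component_connected wD wM uM) wM.
    by apply: epath_connect Pp _; apply: subset_trans sP (subsetUr _ _).
  by apply: connect1; rewrite /= ur !in_setU1 uM eqxx orbT.
have wrM : w \in r |: M by rewrite in_setU1 wM orbT.
have [W [u' [r' [e [[Wp sW uX /set1P E] [hX _]]]]]] := connect_ear con wrM wX (set11 r).
subst r'; exists u', W, e; split=> //.
have := subsetP sW _ (epath_start Wp); rewrite in_setU1 => /orP[/eqP E|//].
by case/eqP: rx; apply: (leg_root tp rR); rewrite -E.
Qed.

(** The pair [q], [x] separates [M] from [y], so [two_cut_parities] supplies paths of both parities
    through [M]; each of them can replace the leg [X]. *)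
Lemma branch_two_lengths q x y z X Y Z a b c w : vertex_critical G 3 ->
  tripod q x y z X Y Z a b c -> w \in X -> w != q -> w != x ->
  let M := component (D :\ q) w in
  (forall u v, u \in M -> adj u v -> v \notin M -> v = q \/ v = x) ->
  (forall t, t \in M -> t \notin Y :|: Z) ->
  exists W1 W2 k1 k2, [/\ tripod q x y z W1 Y Z k1 b c, tripod q x y z W2 Y Z k2 b c &
    odd k1 != odd k2].
Proof.
move=> cr tp wX wq wx M NM nYZ; have sM := branch_sub tp wX wq wx.
have noM r : r \in R -> r \notin M.
  by move=> rR; apply/negP=> /(subsetP sM)/setD1P[_ /DR]; rewrite rR.
have Rq r : r \in R -> r != q.
  by move=> rR; apply: contraTneq rR => ->; apply: DR (tp_q tp).
have qM : q \notin M by apply/negP=> /(subsetP sM); rewrite !inE eqxx.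
have [||||||||W1 [W2 [k1 [k2 [W1p W2p s1 s2 par]]]]] := @two_cut_parities G M q x y cr.
- by apply/set0Pn; exists w; apply: component_refl.
- exact: qM.
- exact/noM/(tp_x tp).
- by rewrite eq_sym; apply/Rq/(tp_x tp).
- exact/noM/(tp_y tp).
- exact/Rq/(tp_y tp).
- by rewrite eq_sym (tp_xy tp).
- exact: NM.
have new W k : epath W q x k -> W \subset [set q; x] :|: M -> tripod q x y z W Y Z k b c.
  move=> Wp sW; have legW (V : {set G}) r : V \subset r |: D -> x != r -> r \in R ->
      (forall t, t \in M -> t \notin V) -> forall t, t \in W -> t \in V -> t = q.
    move=> sV xr rR MV t /(subsetP sW); rewrite !in_setU !in_set1 => /orP[/orP[/eqP//|/eqP->]|tM tV].
      by move/(subsetP sV)/setU1P=> [E|/DR]; [rewrite E eqxx in xr | rewrite (tp_x tp)].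
    by have := MV t tM; rewrite tV.
  case: (tp) => *; split=> //.
  - apply: subset_trans sW _; apply/subsetP=> t; rewrite !in_setU !in_set1.
    case/orP=> [/orP[/eqP->|->//]|/(subsetP sM)/setD1P[_ ->]]; last by rewrite orbT.
    by rewrite (tp_q tp) orbT.
  - apply: (legW Y y) => // t /nYZ; by rewrite in_setU negb_or => /andP[].
  - apply: (legW Z z) => // t /nYZ; by rewrite in_setU negb_or => /andP[].
by exists W1, W2, k1, k2; split=> //; apply: new.
Qed.

Lemma epath_interior W x y k : epath W x y k -> 1 < k ->
  exists w, [/\ w \in W, w != x & w != y].
Proof.
case: k => [|[|k]] // /epath_step[w [W' [xw W'p xW' ->]]] _; exists w.
rewrite in_setU1 (epath_start W'p) orbT eq_sym (adj_neq xw); split=> //.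
by apply/eqP=> E; rewrite E in W'p; have := epath_loop W'p.
Qed.

(** * Tripods on three roots with path lengths 2l + 1 and 2l + 2 *)

Section ThreeRoots.
Variable l : nat.
Hypotheses (l2 : 2 <= l) (cr : vertex_critical G 3).
Hypothesis R3 : forall x y z r, x \in R -> y \in R -> z \in R -> r \in R ->
  x != y -> x != z -> y != z -> [|| r == x, r == y | r == z].
Hypothesis extR : forall x y k, x \in R -> y \in R -> x != y -> 1 < k -> ext x y k ->
  2 * l + 1 <= k <= 2 * l + 2.

(** From [q] the root [x] is reached along [X] in [l.+1] steps and through [v] and [u] in [l.+2].
    This pins any closed short leg to length [l], against the two parities; a ray leaving the short
    leg gives two lengths that differ by [2 * i + 1]. *)
Lemma prism_false q x y z X Y Z u v B : tripod q x y z X Y Z l.+1 l.+1 l ->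
  u \in X -> v \in Y -> v \in D -> adj q v -> adj v u ->
  epath B u x l -> B \subset X -> q \notin B -> False.
Proof.
move=> tp uX vY vD qv vu Bp sB qB; have vq : v != q by rewrite eq_sym (adj_neq qv).
have tpz := tripod_rot (tripod_rot tp).
have [w [wZ wq wz]] := epath_interior (tp_Z tp) l2.
have R_sym (r r' : G) : r != r' -> r' != r by rewrite eq_sym.
have [[NM nXY]|[y' [i [e [[y'R y'z i0 il] [e0 ray]]]]]] := branch_closed_or_ray tpz wZ wq wz; last first.
  case: ray => [[y'y [e1 e2]]|[y'y [e1 e2]]].
  - have /= := extR (tp_z tp) y'R (R_sym _ _ y'z) _ e1.
    have /= := extR (tp_y tp) y'R (R_sym _ _ y'y) _ e2.
    by move: i0 il e0; clear; lia.
  - have xy' : x != y' by rewrite y'y (tp_xy tp).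
    have /= := extR (tp_z tp) y'R (R_sym _ _ y'z) _ e1.
    have /= := extR (tp_x tp) y'R xy' _ e2.
    by move: i0 il e0; clear; lia.
have [W1 [W2 [k1 [k2 [t1 t2 par]]]]] := branch_two_lengths cr tpz wZ wq wz NM nXY.
suff one W k : tripod q z x y W X Y k l.+1 l.+1 -> k = l.
  by move: par; rewrite (one _ _ t1) (one _ _ t2) eqxx.
move=> t; have zx : z != x by rewrite eq_sym (tp_xz tp).
have vB : v \notin B by apply/negP=> /(subsetP sB) vX; rewrite (tp_XY tp vX vY) eqxx in vq.
have vBp := epath_consl vu Bp vB.
have qvB : q \notin v |: B by rewrite in_setU1 negb_or eq_sym vq.
have Pp := epath_consl qv vBp qvB.
have sP : q |: (v |: B) \subset x |: D.
  rewrite !subUset !sub1set (subset_trans sB (tp_XD tp)) andbT !in_setU1 (tp_q tp) orbT /=.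
  by rewrite vD orbT.
have e1 : ext z x (k + l.+1) := tripod_ext t.
have e2 : ext z x (k + l.+2).
  apply: (epath_two_legs (tp_X t) Pp (tp_XD t) sP) => r rW; rewrite !in_setU1.
  case/or3P=> [/eqP//|/eqP E|/(subsetP sB) rX].
    by apply: (tp_XZ t) => //; rewrite E.
  exact: (tp_XY t).
have /= := extR (tp_z tp) (tp_x tp) zx _ e1.
have /= := extR (tp_z tp) (tp_x tp) zx _ e2.
by move: l2; clear; lia.
Qed.

(* An ear between two long legs would be an edge closing a triangle at [q]. *)
Lemma long_branch_no_meet q x y z X Y Z w : tripod q x y z X Y Z l.+1 l.+1 l ->
  w \in X -> w != q -> w != x ->
  forall t, t \in component (D :\ q) w -> t \notin Y :|: Z.
Proof.
move=> tp wX wq wx t tM; apply/negP=> tYZ.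
have [u [v [W [e [[uX uM vM vYZ Wp] [sW hX hYZ]]]]]] := branch_ear_meet tp wX wq wx tM tYZ.
have sM := branch_sub tp wX wq wx.
have ne s : s \in component (D :\ q) w -> forall r, r \in R -> [/\ q != s, r != s & s \in D].
  move=> /(subsetP sM)/setD1P[sq sD] r rR; rewrite eq_sym sq sD; split=> //.
  by apply: contraTneq sD => <-; apply: contraL rR; apply: DR.
have [qu xu uD] := ne u uM x (tp_x tp); have [qv yv vD] := ne v vM y (tp_y tp).
have [_ zv _] := ne v vM z (tp_z tp).
have sWD : W \subset D by apply: subset_trans sW (subset_trans sM (subsetDl _ _)).
have eu : u = v -> False.
  move=> E; case/eqP: qu; case/setUP: vYZ => h; rewrite -E in h.
    by rewrite (tp_XY tp uX h).
  by rewrite (tp_XZ tp uX h).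
have e0 : 0 < e by case: e Wp => // /epath_nil[].
have along r (L : {set G}) f : epath L q r f -> L \subset r |: D -> v \in L -> L \subset Y :|: Z ->
    r != v -> (forall t, t \in X -> t \in L -> t = q) ->
    exists B j, [/\ epath (W :|: B) u r (e + (f - j)), W :|: B \subset r |: D,
      forall t, t \in W :|: B -> t \in X -> t = u, epath B v r (f - j) & j < f] /\
      B \subset L /\ q \notin B.
  move=> Lp sL vL sLYZ rv XL.
  have [A [B [j [j2 [Ap Bp dis LE jf]]]]] := epath_split Lp vL.
  have j20 : 0 < j2.
    by case: j2 Bp {jf} => // /epath_nil[E _]; rewrite E eqxx in rv.
  have BL s : s \in B -> s \in L by rewrite LE inE => ->; rewrite orbT.
  have qB : q \notin B.
    by apply: contraNN qv => qB; apply/eqP/dis => //; apply: epath_start Ap.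
  have E : f - j = j2 by rewrite -jf addKn.
  exists B, j; rewrite E; split; last by split=> //; apply/subsetP.
  split=> //; last by rewrite -jf -addn1 leq_add2l.
  - by apply: epath_cat Wp Bp _ => s sW' /BL/(subsetP sLYZ); apply: hYZ.
  - rewrite subUset (subset_trans sWD) ?subsetUr //=.
    by apply/subsetP=> s /BL/(subsetP sL).
  - move=> s; rewrite in_setU => /orP[|sB sX]; first exact: hX.
    by case/negP: qB; rewrite -(XL s sX (BL s sB)).
case/setUP: (vYZ) => [vY|vZ].
- have [B [j [[Pp sP PX Bp jf] [sB qB]]]] :=
    along y Y _ (tp_Y tp) (tp_YD tp) vY (subsetUl _ _) yv (tp_XY tp).
  have PZ s : s \in W :|: B -> s \notin Z.
    rewrite in_setU => /orP[sW'|sB']; apply/negP=> sZ.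
      have E : s = v by apply: hYZ; rewrite // inE sZ orbT.
      by case/eqP: qv; rewrite -E; apply/esym/(tp_YZ tp) => //; rewrite E.
    by case/negP: qB; rewrite -(tp_YZ tp (subsetP sB s sB') sZ).
  have [i [A1 [B1 [[i0 ia e1 e2] [A1p B1p dis1 XE]]]]] :=
    ray_ext (tp_X tp) (tp_Z tp) (tp_XD tp) (tp_ZD tp) (tp_XZ tp) qu xu uX Pp sP PX PZ.
  have WB1 : epath (W :|: B1) v x (e + (l.+1 - i)).
    apply: epath_cat (epath_sym Wp) B1p _ => s sW' sB1.
    by apply: hX; rewrite // XE inE sB1 orbT.
  have qB1 : q \notin B1.
    by apply: contraNN qu => qB1; apply/eqP/dis1 => //; apply: epath_start A1p.
  have B1X s : s \in B1 -> s \in X by rewrite XE inE => ->; rewrite orbT.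
  have sWB1 : W :|: B1 \subset x |: D.
    rewrite subUset (subset_trans sWD) ?subsetUr //=.
    by apply/subsetP=> s /B1X/(subsetP (tp_XD tp)).
  have hWB1 s : s \in W :|: B1 -> s \in Y -> s = v.
    rewrite in_setU => /orP[sW' sY|sB1 sY]; first by apply: hYZ; rewrite // inE sY.
    by case/negP: qB1; rewrite -(tp_XY tp (B1X s sB1) sY).
  have nWB1 s : s \in W :|: B1 -> s \notin Z.
    rewrite in_setU => /orP[sW'|sB1]; apply/negP=> sZ.
      by have := PZ s; rewrite in_setU sW' sZ => /(_ isT).
    by case/negP: qB1; rewrite -(tp_XZ tp (B1X s sB1) sZ).
  have [j' [A2 [B2 [[j0 ja e3 e4] [A2p B2p _ _]]]]] :=
    ray_ext (tp_Y tp) (tp_Z tp) (tp_YD tp) (tp_ZD tp) (tp_YZ tp) qv yv vY WB1 sWB1 hWB1 nWB1.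
  have zx : z != x by rewrite eq_sym (tp_xz tp).
  have zy : z != y by rewrite eq_sym (tp_yz tp).
  have yx : y != x by rewrite eq_sym (tp_xy tp).
  have := extR (tp_x tp) (tp_y tp) (tp_xy tp) _ e1.
  have := extR (tp_z tp) (tp_y tp) zy _ e2.
  have := extR (tp_y tp) (tp_x tp) yx _ e3.
  have := extR (tp_z tp) (tp_x tp) zx _ e4.
  move=> b4 b3 b2 b1.
  (* [b1] and [b2] combine to [2 * i <= 2], [b3] and [b4] to [2 * j' <= 2]; so the ear is an edge
     between two neighbours of [q]. *)
  have [i1 j1 e1'] : [/\ i = 1, j' = 1 & e = 1].
    by move: b1 b2 b3 b4 e0 i0 j0 ia ja jf; clear; split; lia.
  subst i j' e.
  have edge1 V s t' : epath V s t' 1 -> adj s t'.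
    by case/epath_step=> s' [V' [ss' /epath_nil[<- _] _ _]].
  apply: (prism_false tp uX vY vD (edge1 _ _ _ A2p) _ _ _ qB1).
  + by rewrite adj_sym; apply: edge1 Wp.
  + by rewrite subn1 in B1p.
  + exact/subsetP.
(* An ear to the short leg gives paths to [z] from [x] and from [y] whose lengths differ by [2 * i],
   too much for the window. *)
- have [B [j [[Pp sP PX Bp jf] [sB qB]]]] :=
    along z Z _ (tp_Z tp) (tp_ZD tp) vZ (subsetUr _ _) zv (tp_XZ tp).
  have PY s : s \in W :|: B -> s \notin Y.
    rewrite in_setU => /orP[sW'|sB']; apply/negP=> sY.
      have E : s = v by apply: hYZ; rewrite // inE sY.
      by case/eqP: qv; rewrite -E; apply/esym/(tp_YZ tp) => //; rewrite E.
    by case/negP: qB; rewrite -(tp_YZ tp sY (subsetP sB s sB')).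
  have [i [A1 [B1 [[i0 ia e1 e2] _]]]] :=
    ray_ext (tp_X tp) (tp_Y tp) (tp_XD tp) (tp_YD tp) (tp_XY tp) qu xu uX Pp sP PX PY.
  have := extR (tp_x tp) (tp_z tp) (tp_xz tp) _ e1.
  have := extR (tp_y tp) (tp_z tp) (tp_yz tp) _ e2.
  by move: e0 i0 ia jf; clear; lia.
Qed.

(* A ray from the long leg [X] to [y] starts next to [q], at [u] say, and yields a tripod
   centred at [u] whose branch of the ray is a proper subset of [M]. *)
Lemma long_branch_false q x y z X Y Z w : tripod q x y z X Y Z l.+1 l.+1 l ->
  w \in X -> w != q -> w != x -> False.
Proof.
have [n] := ubnP #|component (D :\ q) w|.
elim: n q x y z X Y Z w => // n IH q x y z X Y Z w szM tp wX wq wx.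
pose M := component (D :\ q) w.
have sM : M \subset D :\ q := branch_sub tp wX wq wx.
have nYZ : forall t, t \in M -> t \notin Y :|: Z := long_branch_no_meet tp wX wq wx.
have [NM|nNM] := classic (forall u v, u \in M -> adj u v -> v \notin M -> v = q \/ v = x).
  have [W1 [W2 [k1 [k2 [t1 t2 par]]]]] := branch_two_lengths cr tp wX wq wx NM nYZ.
  (* The leg to [y] allows [k] to be [l] or [l.+1], the leg to [z] allows [l.+1] or [l.+2]. *)
  suff one W k : tripod q x y z W Y Z k l.+1 l -> k = l.+1.
    by move: par; rewrite (one _ _ t1) (one _ _ t2) eqxx.
  move=> t; have e1 := tripod_ext t; have e2 := tripod_ext (tripod_swap t).
  have /= := extR (tp_x tp) (tp_y tp) (tp_xy tp) _ e1.
  have /= := extR (tp_x tp) (tp_z tp) (tp_xz tp) _ e2.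
  by move: l2; clear; lia.
have [r [u0 [rR rx u0M u0r]]] : exists r u0, [/\ r \in R, r != x, u0 \in M & adj u0 r].
  have [//|no] := classic (exists r u0, [/\ r \in R, r != x, u0 \in M & adj u0 r]).
  case: nNM => u v uM uv vM; case: (branch_step tp wX wq wx uM uv vM) => [|vR]; first by left.
  right; apply/eqP/negP=> vx; case: no; exists v, u; split=> //; exact/negP.
have [u [W [e [uX uM Wp sW hX]]]] := branch_ear_root tp wX wq wx nYZ u0M u0r rR rx.
have /setD1P[uq uD] := subsetP sM _ uM.
have qu : q != u by rewrite eq_sym.
have xu : x != u by apply: contraTneq uD => <-; apply: contraL (tp_x tp); apply: DR.
have sWD : W \subset r |: D.
  by apply: subset_trans sW _; apply: setUS; apply: subset_trans sM (subsetDl _ _).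
have e0 : 0 < e.
  case: e Wp => // /epath_nil[E _]; have := DR uD; by rewrite E rR.
have noroot (V : {set G}) s t : V \subset s |: D -> t \in R -> t != s -> t \notin V.
  move=> sV tR ts; apply/negP=> /(subsetP sV); rewrite in_setU1 (negPf ts) /=.
  by move/DR; rewrite tR.
have noW s (V : {set G}) t : V \subset t |: D -> (forall t, t \in M -> t \notin V) -> r != t ->
    s \in W -> s \notin V.
  move=> sV MV rt sW1; have := subsetP sW s sW1; rewrite in_setU1 => /orP[/eqP->|/MV//].
  exact: noroot sV rR rt.
have MY t : t \in M -> t \notin Y by move/nYZ; rewrite in_setU negb_or => /andP[].
have MZ t : t \in M -> t \notin Z by move/nYZ; rewrite in_setU negb_or => /andP[].
have ry : r = y.
  have yx : y != x by rewrite eq_sym (tp_xy tp).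
  have yz := tp_yz tp; have := R3 (tp_x tp) (tp_y tp) (tp_z tp) rR (tp_xy tp) (tp_xz tp) yz.
  rewrite (negPf rx) /= => /orP[/eqP//|/eqP E]; subst r; exfalso.
  have zy : z != y by rewrite eq_sym.
  have [i [_ [_ [[i0 ia e1 e2] _]]]] := ray_ext (tp_X tp) (tp_Y tp) (tp_XD tp) (tp_YD tp)
    (tp_XY tp) qu xu uX Wp sWD hX (fun s => @noW s Y y (tp_YD tp) MY zy).
  have := extR (tp_x tp) (tp_z tp) (tp_xz tp) _ e1.
  have := extR (tp_y tp) (tp_z tp) yz _ e2.
  by move: e0 i0 ia; clear; lia.
subst r; have yz := tp_yz tp; have zy : z != y by rewrite eq_sym.
have WZ s : s \in W -> s \notin Z := @noW s Z z (tp_ZD tp) MZ yz.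
have [i [A [B [[i0 ia e1 e2] [Ap Bp disAB XE]]]]] := ray_ext (tp_X tp) (tp_Z tp) (tp_XD tp)
  (tp_ZD tp) (tp_XZ tp) qu xu uX Wp sWD hX WZ.
have b1 := extR (tp_x tp) (tp_y tp) (tp_xy tp) _ e1.
have b2 := extR (tp_z tp) (tp_y tp) zy _ e2.
(* The lengths [l.+1 - i + e] and [l + i + e] both fit the window only for [i = 1], and then
   [e = l.+1]. *)
have [i1 el] : i = 1 /\ e = l.+1 by move: b1 b2 e0 i0 ia; clear; split; lia.
subst i e; rewrite subn1 /= in Bp.
have AX s : s \in A -> s \in X by rewrite XE inE => ->.
have BX s : s \in B -> s \in X by rewrite XE inE => ->; rewrite orbT.
have xA : x \notin A.
  by apply/negP=> xA; case/eqP: xu; apply: disAB => //; apply: epath_end Bp.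
have sBD : B \subset x |: D by apply/subsetP=> s /BX/(subsetP (tp_XD tp)).
have qB : q \notin B.
  by apply: contraNN qu => qB; apply/eqP/disAB => //; apply: epath_start Ap.
have AZp : epath (A :|: Z) u z l.+1.
  have := epath_cat (epath_sym Ap) (tp_Z tp); rewrite add1n; apply=> s /AX sX sZ.
  exact: (tp_XZ tp).
have yx : y != x by rewrite eq_sym (tp_xy tp).
have zx : z != x by rewrite eq_sym (tp_xz tp).
(* The centre moves one step, from [q] to [u]: the leg to [z] grows to [l.+1], the rest of [X]
   becomes the short leg, and the ray is the long leg to be examined next. *)
have tp' : tripod u y z x W (A :|: Z) B l.+1 l.+1 l.
  split=> //; try exact: tp_y tp; try exact: tp_z tp; try exact: tp_x tp.
  - rewrite subUset (tp_ZD tp) andbT; apply/subsetP=> s sA.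
    have := subsetP (tp_XD tp) s (AX s sA); rewrite !in_setU1 => /orP[/eqP E|->].
      by rewrite E (negPf xA) in sA.
    by rewrite orbT.
  - move=> s sW1; rewrite in_setU => /orP[/AX|sZ]; first exact: hX.
    by have := WZ s sW1; rewrite sZ.
  - by move=> s sW1 /BX; apply: hX.
  - move=> s; rewrite in_setU => /orP[sA sB|sZ sB]; first exact: disAB.
    by case/negP: qB; rewrite -(tp_XZ tp (BX s sB) sZ).
have [w' [w'W w'u w'y]] := epath_interior Wp (ltnW l2).
pose M' := component (D :\ u) w'.
have nM' : forall t, t \in M' -> t \notin (A :|: Z) :|: B := long_branch_no_meet tp' w'W w'u w'y.
have w'D := branch_base tp' w'W w'u w'y; have sM' := branch_sub tp' w'W w'u w'y.
have w'M : w' \in M by have := subsetP sW _ w'W; rewrite in_setU1 (negPf w'y).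
have wD := branch_base tp wX wq wx.
(* [M'] avoids [A], hence [q], so it stays connected in [D :\ q]; and it does not contain [u]. *)
have sM'M : M' \subset M :\ u.
  apply/subsetP=> t tM'; have /setD1P[tu _] := subsetP sM' t tM'; rewrite in_setD1 tu /=.
  have w'M' : w' \in M' := component_refl _ _.
  have [P [k [Pp sP]]] := connect_epath (component_connected w'D w'M' tM') w'M'.
  have sPq : P \subset D :\ q.
    apply/subsetP=> s /(subsetP sP) sM1; have /setD1P[_ sD] := subsetP sM' s sM1.
    rewrite in_setD1 sD andbT; apply/eqP=> E; have := nM' s sM1.
    by rewrite E !in_setU (epath_start Ap).
  have := epath_connect Pp sPq; rewrite inE in w'M; rewrite inE; exact: connect_trans w'M.
apply: (IH u y z x W (A :|: Z) B w') => //.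
apply: leq_ltn_trans (subset_leq_card sM'M) _.
by move: szM; rewrite (cardsD1 u (component (D :\ q) w)) -/M uM add1n ltnS.
Qed.

(** A ray gives lengths that differ by [2 * i], so the branch is closed and the leg can be replaced
    by legs of both parities. One of these has length [l], which is the case already excluded. *)
Lemma three_long_false q x y z X Y Z : tripod q x y z X Y Z l.+1 l.+1 l.+1 -> False.
Proof.
move=> tp; have [w [wX wq wx]] := epath_interior (tp_X tp) (ltnW l2).
have R_sym (r r' : G) : r != r' -> r' != r by rewrite eq_sym.
have [[NM nYZ]|[y' [i [e [[y'R y'x i0 il] [e0 ray]]]]]] := branch_closed_or_ray tp wX wq wx; last first.
  case: ray => [[y'z [e1 e2]]|[y'z [e1 e2]]].
  - have /= := extR (tp_x tp) y'R (R_sym _ _ y'x) _ e1.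
    have /= := extR (tp_z tp) y'R (R_sym _ _ y'z) _ e2.
    by move: i0 il e0; clear; lia.
  - have yy' : y != y' by rewrite y'z (tp_yz tp).
    have /= := extR (tp_x tp) y'R (R_sym _ _ y'x) _ e1.
    have /= := extR (tp_y tp) y'R yy' _ e2.
    by move: i0 il e0; clear; lia.
have [W1 [W2 [k1 [k2 [t1 t2 par]]]]] := branch_two_lengths cr tp wX wq wx NM nYZ.
have short W k : tripod q x y z W Y Z k l.+1 l.+1 -> k = l \/ k = l.+1.
  move=> t; have e1 := tripod_ext t; have := extR (tp_x tp) (tp_y tp) (tp_xy tp) _ e1.
  by move: l2; clear; lia.
have [W t] : exists W, tripod q x y z W Y Z l l.+1 l.+1.
  case: (short _ _ t1) => E1; first by exists W1; rewrite -{1}E1.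
  case: (short _ _ t2) => E2; first by exists W2; rewrite -{1}E2.
  by rewrite E1 E2 eqxx in par.
have [w' [w'Y w'q w'y]] := epath_interior (tp_Y tp) (ltnW l2).
exact: long_branch_false (tripod_rot t) w'Y w'q w'y.
Qed.

Lemma three_roots_false x y z x' y' z' : x \in R -> y \in R -> z \in R ->
  x != y -> x != z -> y != z -> x' \in D -> y' \in D -> z' \in D ->
  adj x x' -> adj y y' -> adj z z' -> False.
Proof.
move=> xR yR zR xy xz yz x'D y'D z'D xx' yy' zz'.
have [q [X [Y [Z [a [b [c tp]]]]]]] := tripod_exists xR yR zR xy xz yz x'D y'D z'D xx' yy' zz'.
have pos W r k : epath W q r k -> r \in R -> 0 < k.
  case: k => // /epath_nil[E _] rR; have := DR (tp_q tp); by rewrite E rR.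
have a0 := pos _ _ _ (tp_X tp) xR; have b0 := pos _ _ _ (tp_Y tp) yR.
have c0 := pos _ _ _ (tp_Z tp) zR.
have := extR xR yR xy _ (tripod_ext tp); have := extR xR zR xz _ (tripod_ext (tripod_swap tp)).
have := extR yR zR yz _ (tripod_ext (tripod_rot tp)) => h1 h2 h3.
(* Pairwise sums equal to [2 * l + 1] or [2 * l + 2] leave all legs at [l.+1], except for at most
   one of length [l]. *)
have : (a = l.+1 /\ b = l.+1 /\ c = l.+1) \/ (a = l /\ b = l.+1 /\ c = l.+1) \/
    (a = l.+1 /\ b = l /\ c = l.+1) \/ (a = l.+1 /\ b = l.+1 /\ c = l).
  by move: h1 h2 h3 a0 b0 c0; clear; lia.
have long q' x1 y1 z1 X' Y' Z' : tripod q' x1 y1 z1 X' Y' Z' l.+1 l.+1 l -> False.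
  move=> t; have [w [wX wq wx]] := epath_interior (tp_X t) (ltnW l2).
  exact: long_branch_false t wX wq wx.
case=> [|[|[|]]] [? [? ?]]; subst a b c.
- exact: three_long_false tp.
- exact: long (tripod_rot tp).
- exact: long (tripod_rot (tripod_rot tp)).
- exact: long tp.
Qed.

End ThreeRoots.

End Tripods.

(** * A triangle sharing no edge with another one *)

Section Triangles.
Variables (G : sgraph) (l : nat).
Implicit Types (x y z t u v w a b c d : G) (W X Y Z K M D R : {set G}).
Hypotheses (l2 : 2 <= l) (odl : odd_lengths G l) (cr : vertex_critical G 3).

Lemma odd_cycle_length W1 W2 x y k1 k2 :
  epath W1 x y k1 -> epath W2 x y k2 -> x != y ->
  (forall t, t \in W1 -> t \in W2 -> t = x \/ t = y) -> 2 < k1 + k2 -> odd (k1 + k2) ->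
  k1 + k2 = 3 \/ k1 + k2 = 2 * l + 3.
Proof. by move=> W1p W2p xy dis k3; apply: odl; apply: epath_cycle W1p W2p xy dis k3. Qed.

Lemma epath2_mid W x y : epath W x y 2 -> exists s, [/\ adj x s, adj s y & s \in W].
Proof.
case/epath_step=> s [W' [xs W'p _ WE]]; case/epath_step: (W'p) => t [W2 [st /epath_nil[E _] _ _]].
by exists s; rewrite -E; split=> //; rewrite WE in_setU1 (epath_start W'p) orbT.
Qed.

(* Close a path between [x] and [y] by the edge [xy] and by the path through [z]. *)
Lemma triangle_path_length x y z W k : adj x y -> adj x z -> adj z y ->
  epath W x y k -> 1 < k -> z \notin W ->
  [\/ k = 2, k = 2 * l + 1 | k = 2 * l + 2].
Proof.
move=> xy xz zy Wp k1 zW; have nxy := adj_neq xy.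
have [ok|ek] := boolP (odd k).
  have [||||] := odd_cycle_length Wp (epath2 xz zy nxy) nxy.
  - move=> t tW; rewrite !inE => /or3P[]/eqP E; [by left| |by right].
    by rewrite -E tW in zW.
  - by move: k1; clear; lia.
  - by rewrite addn2 /= negbK.
  - by move: k1; clear; lia.
  - by move=> h; apply: Or32; move: h; clear; lia.
have [||||] := odd_cycle_length Wp (epath1 xy) nxy.
- by move=> t _; rewrite !inE => /orP[]/eqP; [left | right].
- by move: k1; clear; lia.
- by rewrite addn1.
- by move=> h; apply: Or31; move: h; clear; lia.
- by move=> h; apply: Or33; move: h; clear; lia.
Qed.

Lemma neighbour_outside_clique K a d : (forall u v, u \in K -> v \in K -> u != v -> adj u v) ->
  a \notin K -> d \notin K -> a != d -> exists2 v, adj a v & v \notin K.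
Proof.
move=> cK aK dK ad; have := clique_not_cutset cr cK aK dK.
case/connect_epath=> [|W [k [Wp sW]]]; first by rewrite inE.
case: k Wp => [/epath_nil[E _]|k /epath_step[v [W' [av W'p _ WE]]]].
  by rewrite E eqxx in ad.
exists v => //; have := subsetP sW v; rewrite WE in_setU1 (epath_start W'p) orbT inE.
exact.
Qed.

Lemma critical_has_outside K : #|K| <= 3 -> exists d, d \notin K.
Proof.
move=> K3; have [//|no] := classic (exists d, d \notin K); case: (cr) => + _; case.
have inK v : v \in K by apply: contraT => vK; case: no; exists v.
have idx v : index v (enum K) < 3.
  by apply: leq_trans K3; rewrite cardE index_mem mem_enum.
exists (fun v => Ordinal (idx v)) => u v _ _ uv; apply/eqP=> /(congr1 val) /= E.
have := adj_neq uv; rewrite -(nth_index u (s := enum K) (x := u)) ?mem_enum //.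
by rewrite E nth_index ?mem_enum // eqxx.
Qed.

Lemma pair_clique x y : adj x y ->
  forall u v, u \in [set x; y] -> v \in [set x; y] -> u != v -> adj u v.
Proof.
move=> xy u v; rewrite !inE => /orP[]/eqP-> /orP[]/eqP->; rewrite ?eqxx //.
by rewrite adj_sym.
Qed.

Lemma triple_clique x y z : adj x y -> adj x z -> adj y z ->
  forall u v, u \in [set x; y; z] -> v \in [set x; y; z] -> u != v -> adj u v.
Proof.
move=> xy xz yz u v; rewrite !inE -!orbA.
by case/or3P=> /eqP-> /or3P[]/eqP->; rewrite ?eqxx // adj_sym.
Qed.

Lemma isolated_triangle_false a b c : adj a b -> adj a c -> adj b c ->
  (forall d, d \notin [set a; b; c] ->
    [/\ ~~ (adj d a && adj d b), ~~ (adj d a && adj d c) & ~~ (adj d b && adj d c)]) ->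
  False.
Proof.
move=> ab ac bc far; pose R := [set a; b; c].
have cR := triple_clique ab ac bc.
have card3 x y z : #|[set x; y; z]| <= 3.
  by rewrite (leq_trans (leq_card_setU _ _)) // cards2 cards1; case: (x != y).
have [d dR] := critical_has_outside (card3 a b c).
(* The other two vertices of the triangle form a clique, which is not a cutset; hence each vertex
   has a neighbour outside. *)
have nbr x y z : x \in R -> x \notin [set y; z] -> adj y z ->
    (forall v, v \in R -> v != x -> v \in [set y; z]) -> d \notin [set y; z] ->
    exists2 v, adj x v & v \in ~: R.
  move=> xR xyz yz other dyz.
  have xd : x != d by apply: contraNneq dR => <-.
  have [v xv vK] := neighbour_outside_clique (pair_clique yz) xyz dyz xd.
  exists v; rewrite // inE; apply: contra vK => vR; apply: other => //.
  by rewrite eq_sym adj_neq.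
have nab := adj_neq ab; have nac := adj_neq ac; have nbc := adj_neq bc.
have dN x y : x \in R -> y \in R -> d \notin [set x; y].
  by move=> xR yR; apply: contra dR => /set2P[] ->.
have [aR bR cRR] : [/\ a \in R, b \in R & c \in R] by rewrite !inE !eqxx !orbT.
have notin x y z : x != y -> x != z -> x \notin [set y; z].
  by move=> xy xz; rewrite !inE negb_or xy.
have rest x y z : (forall v, v \in R -> [|| v == x, v == y | v == z]) ->
    forall v, v \in R -> v != x -> v \in [set y; z].
  by move=> h v /h; rewrite !inE => /orP[->|].
have R1 v : v \in R -> [|| v == a, v == b | v == c] by rewrite !inE -orbA.
have R2 v : v \in R -> [|| v == b, v == a | v == c] by rewrite !inE orbA [(v == b) || _]orbC.
have R3 v : v \in R -> [|| v == c, v == a | v == b] by rewrite !inE orbC.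
have [nba nca ncb] : [/\ b != a, c != a & c != b] by split; rewrite eq_sym.
have [a' aa' a'D] := nbr a b c aR (notin _ _ _ nab nac) bc (rest _ _ _ R1) (dN _ _ bR cRR).
have [b' bb' b'D] := nbr b a c bR (notin _ _ _ nba nbc) ac (rest _ _ _ R2) (dN _ _ aR cRR).
have [c' cc' c'D] := nbr c a b cRR (notin _ _ _ nca ncb) ab (rest _ _ _ R3) (dN _ _ aR bR).
apply: (@three_roots_false G R (~: R) _ _ _ l l2 cr _ _ a b c a' b' c') => //.
- by move=> t; rewrite inE.
- by move=> u v _ _; rewrite inE negbK.
- by move=> u v; rewrite !in_setC => uR vR; apply: clique_not_cutset cr cR uR vR.
- move=> x y z r; rewrite !inE -!orbA.
  by case/or3P=> /eqP-> /or3P[]/eqP-> /or3P[]/eqP-> /or3P[]/eqP->; rewrite ?eqxx ?orbT.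
move=> x y k xR yR xy k1 [W Wp sW].
have [z [zR zx zy]] : exists z, [/\ z \in R, z != x & z != y].
  move: xR yR xy; rewrite !inE -!orbA.
  case/or3P=> /eqP-> /or3P[]/eqP->; rewrite ?eqxx // => _;
    by first [exists a; rewrite aR ![a == _]eq_sym; split; rewrite // eq_sym
      | exists b; rewrite bR; split; rewrite // eq_sym
      | exists c; rewrite cRR; split; rewrite // eq_sym].
have zW : z \notin W.
  by apply/negP=> /(subsetP sW); rewrite !in_setU !in_set1 (negPf zx) (negPf zy) in_setC zR.
have xz : x != z by rewrite eq_sym.
have := triangle_path_length (cR _ _ xR yR xy) (cR _ _ xR zR xz) (cR _ _ zR yR zy) Wp k1 zW.
case=> [k2|->|->]; last 2 first.
- by clear; lia.
- by clear; lia.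
(* The middle vertex of a path of length 2 would be adjacent to two vertices of the triangle. *)
subst k; have [s [xs sy sW1]] := epath2_mid Wp; exfalso.
have sR : s \notin R.
  have := subsetP sW s sW1; rewrite in_setU in_setC => /orP[/set2P[] E|//].
    by rewrite E adj_irrefl in xs.
  by rewrite E adj_irrefl in sy.
rewrite adj_sym in xs; have [f1 f2 f3] := far s sR.
move: xR yR xy xs sy; rewrite !inE -!orbA.
by case/or3P=> /eqP-> /or3P[]/eqP->; rewrite ?eqxx // => _ h1 h2;
  first [by rewrite h1 h2 in f1 | by rewrite h1 h2 in f2 | by rewrite h1 h2 in f3].
Qed.

End Triangles.

(** * Diamonds *)

Section Diamond.
Variables (G : sgraph) (l : nat).
Implicit Types (x y z t u v w a b c d : G) (W X Y Z K M D R : {set G}).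
Hypotheses (l2 : 2 <= l) (odl : odd_lengths G l) (cr : vertex_critical G 3).
Hypothesis noK4 : forall a b c d, adj a b -> adj a c -> adj b c ->
  adj a d -> adj b d -> adj c d -> False.

Definition common a b := [set c | adj a c && adj b c].
Definition book a b := [set a; b] :|: common a b.

Lemma bookC a b : book a b = book b a.
Proof.
by apply/setP=> t; rewrite !inE [(t == a) || _]orbC [adj a t && _]andbC.
Qed.

(** * Lengths of paths between the vertices of a book *)

Section Bounds.
Variables (a b : G) (D : {set G}).
Hypothesis ab : adj a b.
Let N := common a b.
Let R := book a b.
Hypothesis DR : forall t, t \in D -> t \notin R.

Lemma ext_notin x y W r : r \in R -> r != x -> r != y -> W \subset [set x; y] :|: D ->
  r \notin W.
Proof.
move=> rR rx ry sW; apply/negP=> /(subsetP sW); rewrite in_setU !inE (negPf rx) (negPf ry) /=.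
by move=> /DR; rewrite rR.
Qed.

Lemma diamond_roots c : c \in N ->
  [/\ a \in R, b \in R, c \in R, adj a c & adj b c] /\ [/\ a != b, c != a & c != b].
Proof.
rewrite !inE => /andP[ac bc]; rewrite !eqxx !orbT ac bc !orbT; split=> //.
by split; [exact: adj_neq | rewrite eq_sym adj_neq | rewrite eq_sym adj_neq].
Qed.

(** An odd path closes by two edges through [b]. An even one would close both by the edge [ac] and
    by the three edges through [d] and [b], with lengths that differ by 2. *)
Lemma ext_side c d k : c \in N -> d \in N -> c != d -> 1 < k -> ext D a c k -> k = 2 * l + 1.
Proof.
move=> cN dN cd k1 [W Wp sW].
have [[aR bR cR ac bc] [nab ca cb]] := diamond_roots cN.
have [[_ _ dR ad bd] [_ da db]] := diamond_roots dN.
have aC : a != c by rewrite eq_sym.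
have bW : b \notin W by apply: (ext_notin bR _ _ sW); rewrite eq_sym.
have dW : d \notin W by apply: (ext_notin dR _ _ sW); rewrite // eq_sym.
have ends U : (forall t, t \in U -> [\/ t = a, t = c | t \notin W]) ->
    forall t, t \in W -> t \in U -> t = a \/ t = c.
  by move=> h t tV /h[->|->|]; [left | right | rewrite tV].
have [ok|ek] := boolP (odd k).
  have k2 : 2 < k + 2 by move: k1; clear; lia.
  have h := odd_cycle_length odl Wp (epath2 ab bc aC) aC _ k2.
  have : k + 2 = 3 \/ k + 2 = 2 * l + 3.
    apply: h; last by rewrite addn2 /= negbK.
    by apply: ends => u; rewrite !inE => /or3P[]/eqP->; [apply: Or31|apply: Or33|apply: Or32].
  by move: k1; clear; lia.
have db' : adj d b by rewrite adj_sym.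
have k3 : 2 < k + 1 /\ 2 < k + 3 by move: k1; clear; lia.
have h1 := odd_cycle_length odl Wp (epath1 ac) aC _ (proj1 k3).
have h3 := odd_cycle_length odl Wp (epath3 ad db' bc aC nab _) aC _ (proj2 k3).
have {}h1 : k + 1 = 3 \/ k + 1 = 2 * l + 3.
  apply: h1; last by rewrite addn1.
  by apply: ends => u; rewrite !inE => /orP[]/eqP->; [apply: Or31|apply: Or32].
have {}h3 : k + 3 = 3 \/ k + 3 = 2 * l + 3.
  apply: h3; rewrite 1?eq_sym //; last by rewrite addn3 /= negbK.
  by apply: ends => u; rewrite !inE => /or4P[]/eqP->;
    [apply: Or31|apply: Or33|apply: Or33|apply: Or32].
by move: l2 h1 h3; clear; lia.
Qed.

(** The closing path is [c a d] for odd [k] and [c a b d] for even [k]. *)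
Lemma ext_common c d k : c \in N -> d \in N -> c != d -> 1 < k -> ext D c d k ->
  k = 2 * l \/ k = 2 * l + 1.
Proof.
move=> cN dN cd k1 [W Wp sW].
have [[aR bR cR ac bc] [nab ca cb]] := diamond_roots cN.
have [[_ _ dR ad bd] [_ da db]] := diamond_roots dN.
have aW : a \notin W by apply: (ext_notin aR _ _ sW); rewrite eq_sym.
have bW : b \notin W by apply: (ext_notin bR _ _ sW); rewrite eq_sym.
have ends U : (forall t, t \in U -> [\/ t = c, t = d | t \notin W]) ->
    forall t, t \in W -> t \in U -> t = c \/ t = d.
  by move=> h t tV /h[->|->|]; [left | right | rewrite tV].
have ca' : adj c a by rewrite adj_sym.
have k3 : 2 < k + 2 /\ 2 < k + 3 by move: k1; clear; lia.
have [ok|ek] := boolP (odd k).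
  have h := odd_cycle_length odl Wp (epath2 ca' ad cd) cd _ (proj1 k3).
  have : k + 2 = 3 \/ k + 2 = 2 * l + 3.
    apply: h; last by rewrite addn2 /= negbK.
    by apply: ends => u; rewrite !inE => /or3P[]/eqP->; [apply: Or31|apply: Or33|apply: Or32].
  by move: k1; clear; lia.
have ad' : a != d by rewrite eq_sym.
have h := odd_cycle_length odl Wp (epath3 ca' ab bd cd cb ad') cd _ (proj2 k3).
have : k + 3 = 3 \/ k + 3 = 2 * l + 3.
  apply: h; last by rewrite addn3 /= negbK.
  by apply: ends => u; rewrite !inE => /or4P[]/eqP->;
    [apply: Or31|apply: Or33|apply: Or33|apply: Or32].
by move: k1; clear; lia.
Qed.

(** The path [c a f b d] would close a path of length [2 * l + 1] to a cycle of length
    [2 * l + 5]. *)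
Lemma ext_common3 c d f k : c \in N -> d \in N -> f \in N -> c != d -> f != c -> f != d ->
  1 < k -> ext D c d k -> k = 2 * l.
Proof.
move=> cN dN fN cd fc fd k1 ex; have [//|k2] := ext_common cN dN cd k1 ex.
case: ex => W Wp sW.
have [[aR bR cR ac bc] [nab ca cb]] := diamond_roots cN.
have [[_ _ dR ad bd] [_ da db]] := diamond_roots dN.
have [[_ _ fR af bf] [_ fa fb]] := diamond_roots fN.
have aW : a \notin W by apply: (ext_notin aR _ _ sW); rewrite eq_sym.
have bW : b \notin W by apply: (ext_notin bR _ _ sW); rewrite eq_sym.
have fW : f \notin W by apply: (ext_notin fR fc fd sW).
have ca' : adj c a by rewrite adj_sym.
have fb' : adj f b by rewrite adj_sym.
have P4 : epath (c |: (a |: (f |: [set b; d]))) c d 4.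
  apply: epath_consl (epath3 af fb' bd _ _ _) _; rewrite // 1?eq_sym //.
  by rewrite !inE !negb_or cd ca cb eq_sym fc.
have k5 : 2 < k + 4 by clear; lia.
have h := odd_cycle_length odl Wp P4 cd _ k5.
have : k + 4 = 3 \/ k + 4 = 2 * l + 3.
  apply: h; last by rewrite k2; clear; lia.
  move=> t tW; rewrite !inE => /orP[/eqP|/or4P[]/eqP] E; try by [left | right];
    by move: aW bW fW; rewrite -E tW.
by rewrite k2; clear; lia.
Qed.

(** Length 2 is excluded because the middle vertex would belong to the book, which [D] avoids. *)
Lemma ext_edge c k : c \in N -> 1 < k -> ext D a b k -> k = 2 * l + 1 \/ k = 2 * l + 2.
Proof.
move=> cN k1 [W Wp sW]; have [[aR bR cR ac bc] [nab ca cb]] := diamond_roots cN.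
have cW : c \notin W by apply: (ext_notin cR ca cb sW).
have cb' : adj c b by rewrite adj_sym.
case: (triangle_path_length odl ab ac cb' Wp k1 cW); [|by left|by right].
move=> k2; subst k; have [s [as_ sb sW1]] := epath2_mid Wp.
have sN : s \in N by rewrite inE as_ adj_sym.
have [[_ _ sR _ _] [_ sa sb']] := diamond_roots sN.
by have := ext_notin sR sa sb' sW; rewrite sW1.
Qed.

End Bounds.

(** * Components outside a book and their attachments *)

Section Attachments.
Variables (a b c0 d0 w : G).
Hypotheses (ab : adj a b) (cN : c0 \in common a b) (dN : d0 \in common a b) (cd : c0 != d0).
Let N := common a b.
Let R := book a b.
Hypothesis wR : w \notin R.
Let D := component (~: R) w.

Lemma att_base : w \in ~: R. Proof. by rewrite inE. Qed.

Lemma att_DR t : t \in D -> t \notin R.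
Proof. by move=> /(subsetP (component_sub att_base)); rewrite inE. Qed.

Lemma att_NDR u v : u \in D -> adj u v -> v \notin D -> v \in R.
Proof.
move=> uD uv; apply: contraR => vR; apply: component_closed att_base uD uv _.
by rewrite inE.
Qed.

Lemma att_conD u v : u \in D -> v \in D -> connect (radj D) u v.
Proof. exact: component_connected att_base. Qed.

Lemma other_common c : exists2 d, d \in N & d != c.
Proof.
by have [<-|] := eqVneq c0 c; [exists d0; rewrite // eq_sym | exists c0].
Qed.

(* The triangle [abc] is not a cutset. *)
Lemma attached_other c : c \in N -> exists d u, [/\ d \in N, d != c, u \in D & adj d u].
Proof.
move=> cN1; have [d dN1 dc] := other_common c.
have [[aR bR cR ac bc] [nab ca cb]] := diamond_roots ab cN1.
have [[_ _ dR _ _] [_ da db]] := diamond_roots ab dN1.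
pose K := [set a; b; c].
have wK : w \notin K.
  by apply: contra wR => /setUP[/set2P[]|/set1P] ->.
have dK : d \notin K by rewrite !inE !negb_or da db.
have con := clique_not_cutset cr (triple_clique ab ac bc) wK dK.
have wK' : w \in ~: K by rewrite inE.
have [P [k [Pp sP]]] := connect_epath con wK'.
have [P' [r [k' [P'p sP' rR hit _]]]] := epath_hit Pp dR.
case: k' P'p => [/epath_nil[E _]|k' /epath_sym/epath_step[v [W [rv Wp rW WE]]]].
  by have := wR; rewrite E rR.
have vR : v \notin R.
  apply/negP=> vR; have vr : v = r.
    by apply: hit; rewrite // WE in_setU1 (epath_start Wp) orbT.
  by rewrite vr adj_irrefl in rv.
have sW : W \subset ~: R.
  apply/subsetP=> t tW; rewrite inE; apply/negP=> tR.
  by have tr : t = r; [apply: hit; rewrite // WE in_setU1 tW orbT | rewrite -tr tW in rW].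
exists r, v; split=> //.
- have := subsetP sP _ (subsetP sP' _ _); move/(_ r); rewrite WE setU11 => /(_ isT).
  move: rR; rewrite /R /book in_setU in_setC /K => /orP[/set2P[]->|//];
    by rewrite !inE eqxx ?orbT.
- apply: contraTneq (subsetP sP _ (subsetP sP' r _)); last by rewrite WE setU11.
  by move=> ->; rewrite !inE eqxx !orbT.
- by rewrite inE connect_radj_sym; apply: epath_connect Wp sW.
Qed.

Lemma two_attached : exists c d u v,
  [/\ c \in N, d \in N & c != d] /\ [/\ u \in D, v \in D, adj c u & adj d v].
Proof.
have [c [u [cN1 _ uD cu]]] := attached_other cN.
have [d [v [dN1 dc vD dv]]] := attached_other cN1.
by exists c, d, u, v; split=> //; split; rewrite // eq_sym.
Qed.

(** An attachment at [a] gives a tripod on roots [c], [d], [a]. The sums with the leg to [a] are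
    both [2 * l + 1], so the legs to [c] and [d] are equal and their even sum is [2 * l]; the legs
    are [l], [l], [l.+1]. *)
Lemma not_attached_left u : u \in D -> adj a u -> False.
Proof.
move=> uD au; have [c [d [u1 [u2 [[cN1 dN1 cd1] [u1D u2D cu1 du2]]]]]] := two_attached.
have [[aR bR cR ac bc] [nab ca cb]] := diamond_roots ab cN1.
have [[_ _ dR ad bd] [_ da db]] := diamond_roots ab dN1.
have [q [X [Y [Z [i [j [k tp]]]]]]] := tripod_exists att_DR att_conD cR dR aR cd1 ca da
  u1D u2D uD cu1 du2 au.
have swap x y n : ext D x y n -> ext D y x n by apply: ext_sym.
have dc1 : d != c by rewrite eq_sym.
have pos W r n : epath W q r n -> r \in R -> 0 < n.
  case: n => // /epath_nil[E _] rR; have := att_DR (tp_q tp); by rewrite E rR.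
have i0 := pos _ _ _ (tp_X tp) cR; have j0 := pos _ _ _ (tp_Y tp) dR.
have k0 := pos _ _ _ (tp_Z tp) aR.
have side x n : x \in N -> 1 < n -> ext D x a n -> n = 2 * l + 1.
  move=> xN n1 /swap; have [x' x'N x'x] := other_common x.
  by apply: (ext_side ab att_DR xN x'N) => //; rewrite eq_sym.
have sideb x n : x \in N -> 1 < n -> ext D x b n -> n = 2 * l + 1.
  have ba : adj b a by rewrite adj_sym.
  have DRb t : t \in D -> t \notin book b a by rewrite bookC; apply: att_DR.
  have NN y : y \in N -> y \in common b a by rewrite !inE andbC.
  move=> xN n1 /swap; have [x' x'N x'x] := other_common x.
  by apply: (ext_side ba DRb (NN _ xN) (NN _ x'N)) => //; rewrite eq_sym.
have comm x y n : x \in N -> y \in N -> x != y -> 1 < n -> ext D x y n ->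
    n = 2 * l \/ n = 2 * l + 1.
  by move=> xN yN xy n1; apply: (ext_common ab att_DR xN yN).
have spine n : 1 < n -> ext D a b n -> n = 2 * l + 1 \/ n = 2 * l + 2.
  exact: (ext_edge ab att_DR cN1).
have s2 m n : 0 < m -> 0 < n -> 1 < m + n by clear; lia.
have lens : [/\ i = l, j = l & k = l.+1].
  have h1 := comm _ _ _ cN1 dN1 cd1 (s2 _ _ i0 j0) (tripod_ext tp).
  have h2 := side _ _ cN1 (s2 _ _ i0 k0) (tripod_ext (tripod_swap tp)).
  have h3 := side _ _ dN1 (s2 _ _ j0 k0) (tripod_ext (tripod_rot tp)).
  by move: h1 h2 h3; clear; split; lia.
case: lens => E1 E2 E3; subst i j k.
have [x [xX xq xc]] := epath_interior (tp_X tp) l2.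
have [[NM nYZ]|[y' [i [e [[y'R y'c i1 il] [e0 ray]]]]]] :=
  branch_closed_or_ray att_DR att_NDR tp xX xq xc.
  have [W1 [W2 [k1 [k2 [t1 t2 par]]]]] :=
    branch_two_lengths att_DR cr tp xX xq xc NM nYZ.
  suff one W n : tripod R D q c d a W Y Z n l l.+1 -> n = l.
    by move: par; rewrite (one _ _ t1) (one _ _ t2) eqxx.
  move=> t; have h := side _ _ cN1 _ (tripod_ext (tripod_swap t)).
  by move: l2 h; clear; lia.
have cy' : c != y' by rewrite eq_sym.
have ge1 : 1 < l - i + e by move: il e0; clear; lia.
have ge2 : 1 < l.+1 + i + e by move: i1 e0; clear; lia.
have ge3 : 1 < l + i + e by move: i1 e0; clear; lia.
(* For every possible end [y'] the two lengths of the ray differ by at least [2 * i], more than the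
   bounds for that end permit. *)
case: ray => [[y'a [e1 e2]]|[y'a [e1 e2]]]; last first.
  subst y'; have := side _ _ cN1 ge1 e1; have := side _ _ dN1 ge3 e2.
  by move: i1 il; clear; lia.
move: y'R; rewrite /R /book in_setU !inE (negPf y'a) /= -/(common a b).
have [E _|y'b /= y'N] := eqVneq y' b.
  subst y'; have := sideb _ _ cN1 ge1 e1; have := spine _ ge2 e2.
  by move: i1 il; clear; lia.
have y'N1 : y' \in N by rewrite inE.
have := comm _ _ _ cN1 y'N1 cy' ge1 e1; have := side _ _ y'N1 ge2 (swap _ _ _ e2).
by move: i1 il; clear; lia.
Qed.

End Attachments.

Lemma not_attached_right a b c d w u : adj a b -> c \in common a b -> d \in common a b ->
  c != d -> w \notin book a b -> u \in component (~: book a b) w -> adj b u -> False.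
Proof.
move=> ab cN dN cd wR uD bu.
have ba : adj b a by rewrite adj_sym.
have NN y : y \in common a b -> y \in common b a by rewrite !inE andbC.
rewrite bookC in wR uD.
exact: (not_attached_left ba (NN _ cN) (NN _ dN) cd wR uD bu).
Qed.

(** By [ext_common3] all paths through [D] between common neighbours have length [2 * l]. If only
    [c] and [d] are attached to [D], this contradicts the two parities at that cut; otherwise a
    tripod on three common neighbours has all legs [l], and neither a closed branch nor a ray is
    possible. *)
Lemma three_common_false a b c0 d0 f0 w : adj a b ->
  c0 \in common a b -> d0 \in common a b -> f0 \in common a b ->
  c0 != d0 -> f0 != c0 -> f0 != d0 -> w \notin book a b -> False.
Proof.
move=> ab cN dN fN cd fc fd wR; pose R := book a b; pose D := component (~: R) w.
have DR : forall t, t \in D -> t \notin R := @att_DR a b w wR.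
have NDR : forall u v, u \in D -> adj u v -> v \notin D -> v \in R := @att_NDR a b w wR.
have conD : forall u v, u \in D -> v \in D -> connect (radj D) u v := @att_conD a b w wR.
have swap x y n : ext D x y n -> ext D y x n by apply: ext_sym.
have third x y : exists t, [/\ t \in common a b, t != x & t != y].
  have dc : d0 != c0 by rewrite eq_sym.
  have cf : c0 != f0 by rewrite eq_sym.
  have df : d0 != f0 by rewrite eq_sym.
  have [E1|] := eqVneq c0 x; have [E2|] := eqVneq c0 y.
  - by exists d0; rewrite -E1 -E2.
  - by have [<-|] := eqVneq d0 y; [exists f0; rewrite -E1 | exists d0; rewrite -E1].
  - by have [<-|] := eqVneq d0 x; [exists f0; rewrite -E2 | exists d0; rewrite -E2].
  - by exists c0.
have comm x y n : x \in common a b -> y \in common a b -> x != y -> 1 < n -> ext D x y n ->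
    n = 2 * l.
  move=> xN yN xy n1; have [t [tN tx ty]] := third x y.
  exact: (ext_common3 ab DR xN yN tN xy tx ty n1).
have side x n : x \in common a b -> 1 < n -> ext D x a n -> n = 2 * l + 1.
  move=> xN n1 /swap; have [x' [x'N x'x _]] := third x x.
  by apply: (ext_side ab DR xN x'N) => //; rewrite eq_sym.
have sideb x n : x \in common a b -> 1 < n -> ext D x b n -> n = 2 * l + 1.
  have ba : adj b a by rewrite adj_sym.
  have DRb t : t \in D -> t \notin book b a by rewrite bookC; apply: DR.
  have NN y : y \in common a b -> y \in common b a by rewrite !inE andbC.
  move=> xN n1 /swap; have [x' [x'N x'x _]] := third x x.
  by apply: (ext_side ba DRb (NN _ xN) (NN _ x'N)) => //; rewrite eq_sym.
have [c [d [u1 [u2 [[cN1 dN1 cd1] [u1D u2D cu1 du2]]]]]] := two_attached ab cN dN cd wR.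
have [[aR bR cR ac bc] [nab ca cb]] := diamond_roots ab cN1.
have [[_ _ dR ad bd] [_ da db]] := diamond_roots ab dN1.
have s2 m n : 0 < m -> 0 < n -> 1 < m + n by clear; lia.
have [[f [u3 [fN1 fc1 fd1 u3D fu3]]]|no] :=
  classic (exists f u, [/\ f \in common a b, f != c, f != d, u \in D & adj f u]); last first.
  have cD : c \notin D by apply: contraL cR; apply: DR.
  have dD : d \notin D by apply: contraL dR; apply: DR.
  have aD : a \notin D by apply: contraL aR; apply: DR.
  have [||||W1 [W2 [k1 [k2 [W1p W2p sW1 sW2 par]]]]] := @two_cut_parities G D c d a cr _ cD dD cd1 aD.
  - by apply/set0Pn; exists w; apply: component_refl.
  - by rewrite eq_sym.
  - by rewrite eq_sym.
  - move=> u v uD uv vD; have := NDR u v uD uv vD; rewrite adj_sym in uv.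
    case/setUP=> [/set2P[E|E]|vN].
    + by case: (not_attached_left ab cN dN cd wR uD); rewrite -E.
    + by case: (not_attached_right ab cN dN cd wR uD); rewrite -E.
    + have [->|vc] := eqVneq v c; first by left.
      have [->|vd] := eqVneq v d; first by right.
      by case: no; exists v, u.
  suff one W n : epath W c d n -> W \subset [set c; d] :|: D -> n = 2 * l.
    by move: par; rewrite (one _ _ W1p sW1) (one _ _ W2p sW2) eqxx.
  move=> Wp sW; have n1 : 1 < n.
    case: n Wp => [/epath_nil[E _]|[|//] Wp]; first by rewrite E eqxx in cd1.
    case/epath_step: Wp => t [V [ct /epath_nil[E _] _ _]]; rewrite E in ct.
    by case: (noK4 ab ac bc ad bd ct).
  by apply: (comm c d) => //; exists W.
have [[_ _ fR _ _] _] := diamond_roots ab fN1.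
have cf1 : c != f by rewrite eq_sym.
have df1 : d != f by rewrite eq_sym.
have [q [X [Y [Z [i [j [k tp]]]]]]] := tripod_exists DR conD cR dR fR cd1 cf1 df1
  u1D u2D u3D cu1 du2 fu3.
have pos W r n : epath W q r n -> r \in R -> 0 < n.
  case: n => // /epath_nil[E _] rR; have := DR _ (tp_q tp); by rewrite E rR.
have i0 := pos _ _ _ (tp_X tp) cR; have j0 := pos _ _ _ (tp_Y tp) dR.
have k0 := pos _ _ _ (tp_Z tp) fR.
have lens : [/\ i = l, j = l & k = l].
  have h1 := comm _ _ _ cN1 dN1 cd1 (s2 _ _ i0 j0) (tripod_ext tp).
  have h2 := comm _ _ _ cN1 fN1 cf1 (s2 _ _ i0 k0) (tripod_ext (tripod_swap tp)).
  have h3 := comm _ _ _ dN1 fN1 df1 (s2 _ _ j0 k0) (tripod_ext (tripod_rot tp)).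
  by move: h1 h2 h3; clear; split; lia.
case: lens => E1 E2 E3; subst i j k.
have [x [xX xq xc]] := epath_interior (tp_X tp) l2.
have [[NM nYZ]|[y' [i [e [[y'R y'c i1 il] [e0 ray]]]]]] :=
  branch_closed_or_ray DR NDR tp xX xq xc.
  have [W1 [W2 [k1 [k2 [t1 t2 par]]]]] := branch_two_lengths DR cr tp xX xq xc NM nYZ.
  suff one W n : tripod R D q c d f W Y Z n l l -> n = l.
    by move: par; rewrite (one _ _ t1) (one _ _ t2) eqxx.
  move=> t; have n0 := pos _ _ _ (tp_X t) cR.
  have h := comm _ _ _ cN1 fN1 cf1 (s2 _ _ n0 k0) (tripod_ext (tripod_swap t)).
  by move: h; clear; lia.
have cy' : c != y' by rewrite eq_sym.
have ge1 : 1 < l - i + e by move: il e0; clear; lia.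
have ge2 : 1 < l + i + e by move: i1 e0; clear; lia.
have [g [gN gy' e1 e2]] : exists g, [/\ g \in common a b, g != y', ext D c y' (l - i + e) &
    ext D g y' (l + i + e)].
  case: ray => [[y'f [e1 e2]]|[y'f [e1 e2]]]; first by exists f; rewrite eq_sym.
  by exists d; rewrite y'f in e1 e2 *.
case/setUP: y'R => [/set2P[E|E]|y'N].
- subst y'; have := side _ _ cN1 ge1 e1; have := side _ _ gN ge2 e2.
  by move: i1 il; clear; lia.
- subst y'; have := sideb _ _ cN1 ge1 e1; have := sideb _ _ gN ge2 e2.
  by move: i1 il; clear; lia.
- have := comm _ _ _ cN1 y'N cy' ge1 e1; have := comm _ _ _ gN y'N gy' ge2 e2.
  by move: i1 il; clear; lia.
Qed.

Lemma diamond_degree a b c d v : adj a b -> adj a c -> adj b c -> adj a d -> adj b d ->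
  c != d -> adj a v -> [\/ v = b, v = c | v = d].
Proof.
move=> ab ac bc ad bd cd av.
have cN : c \in common a b by rewrite inE ac bc.
have dN : d \in common a b by rewrite inE ad bd.
have [vR|vR] := boolP (v \in book a b); last first.
  by case: (not_attached_left ab cN dN cd vR (component_refl _ _) av).
(* If the book were the whole graph, [a], [b] and the common neighbours, pairwise non-adjacent for
   lack of a K4, would be three colour classes. *)
have [w wR] : exists w, w \notin book a b.
  have [//|no] := classic (exists w, w \notin book a b); case: (cr) => + _; case.
  have inR u : u \in book a b by apply: contraT => uR; case: no; exists u.
  pose f u : 'I_3 := if u == a then inord 0 else if u == b then inord 1 else inord 2.
  exists f => x y _ _ xy; rewrite /f -(inj_eq val_inj).
  have [xa|xa] := eqVneq x a; have [ya|ya] := eqVneq y a.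
  - by rewrite xa ya adj_irrefl in xy.
  - by case: ifP => _; rewrite /= !inordK.
  - by case: ifP => _; rewrite /= !inordK.
  - have [xb|xb] := eqVneq x b; have [yb|yb] := eqVneq y b; rewrite /= ?inordK //.
      by rewrite xb yb adj_irrefl in xy.
    have := inR x; have := inR y; rewrite /book !in_setU !in_set1 (negPf xa) (negPf xb).
    rewrite (negPf ya) (negPf yb) /= !inE => /andP[ay by_] /andP[ax bx].
    by case: (noK4 ab ax bx ay by_ xy).
case/setUP: vR => [/set2P[E|->]|vN]; first by rewrite E adj_irrefl in av.
  by apply: Or31.
have [->|vc] := eqVneq v c; first by apply: Or32.
have [->|vd] := eqVneq v d; first by apply: Or33.
by case: (three_common_false ab cN dN vN cd vc vd wR).
Qed.

End Diamond.

(** * Distance layers *)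

Section Distance.
Variable G : sgraph.
Implicit Types (x y z t u v w r : G) (W P : {set G}) (dl : G -> nat).

(** The distance from [r] in the subgraph on [W], described by the properties used later; the last
    one gives every other vertex a parent. Values outside [W] are arbitrary. *)
Definition distance_on W r dl :=
  [/\ r \in W, dl r = 0, forall u v, u \in W -> v \in W -> adj u v -> dl v <= (dl u).+1 &
      forall v, v \in W -> v != r -> exists u, [/\ u \in W, adj u v & dl v = (dl u).+1]].

Lemma distance_exists W r : r \in W -> (forall v, v \in W -> connect (radj W) r v) ->
  exists dl, distance_on W r dl.
Proof.
move=> rW con; pose walk v n := [exists p : n.-tuple G, path (radj W) r p && (last r p == v)].
have walkP v p : path (radj W) r p -> last r p = v -> walk v (size p).
  by move=> rp lp; apply/existsP; exists (in_tuple p); rewrite /= rp lp eqxx.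
have [v|dl dlP] := @fin_all_exists G (fun=> nat)
    (fun v n => v \in W -> walk v n /\ forall k, walk v k -> n <= k).
  case: (boolP (v \in W)) => [vW|]; last by exists 0.
  have ex : exists n, walk v n.
    by have /connectP[p rp lp] := con v vW; exists (size p); apply: walkP.
  by case: (ex_minnP ex) => n wn minn_; exists n.
exists dl; split=> //.
- by apply/eqP; rewrite -leqn0; have [_] := dlP r rW; apply; apply: (@walkP r [::]).
- move=> u v uW vW uv; have [/existsP[p /andP[rp /eqP lp]] _] := dlP u uW.
  have [_] := dlP v vW; apply; have := @walkP v (rcons p v).
  by rewrite size_rcons size_tuple rcons_path last_rcons rp lp /= uv uW vW; apply.
- move=> v vW vr; have [/existsP[p /andP[rp /eqP lp]] min_v] := dlP v vW.
  case/lastP E: (val p) => [|p' x]; first by rewrite E in lp; rewrite -lp eqxx in vr.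
  move: rp lp; rewrite E rcons_path last_rcons => /andP[rp' /and3P[ux uW xW]] xv; subst x.
  exists (last r p'); split=> //; apply/eqP.
  have sz : dl v = (size p').+1 by rewrite -(size_tuple p) E size_rcons.
  rewrite sz eqSS eqn_leq; apply/andP; split; last first.
    by have [_] := dlP _ uW; apply; apply: walkP.
  have [/existsP[p1 /andP[rp1 /eqP lp1]] _] := dlP _ uW.
  rewrite -ltnS -sz; apply: min_v; have := @walkP v (rcons p1 v).
  by rewrite size_rcons size_tuple rcons_path last_rcons rp1 lp1 /= ux uW xW; apply.
Qed.

Section Fixed.
Variables (W : {set G}) (r : G) (dl : G -> nat).
Hypothesis dP : distance_on W r dl.

Lemma distance_step u v : u \in W -> v \in W -> adj u v -> dl v <= (dl u).+1.
Proof. by case: dP => _ _ h _; apply: h. Qed.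

Lemma distance_parent v : v \in W -> v != r -> exists u, [/\ u \in W, adj u v & dl v = (dl u).+1].
Proof. by case: dP => _ _ _ h; apply: h. Qed.

Lemma distance_eq0 v : v \in W -> dl v = 0 -> v = r.
Proof.
by move=> vW d0; apply/eqP; apply: contraT => /(distance_parent vW)[u [_ _]]; rewrite d0.
Qed.

Lemma distance_epath P u v k : epath P u v k -> P \subset W -> dl v <= dl u + k.
Proof.
elim: k u P => [|k IH] u P; first by case/epath_nil=> -> _; rewrite addn0.
case/epath_step=> u' [P' [uu' P'p _ ->]]; rewrite subUset sub1set => /andP[uW sP'].
have := distance_step uW (subsetP sP' _ (epath_start P'p)) uu'.
have := IH _ _ P'p sP'; clear; lia.
Qed.

Lemma geodesic v : v \in W -> exists P, [/\ epath P r v (dl v), P \subset W &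
  forall t, t \in P -> t = v \/ dl t < dl v].
Proof.
have [n] := ubnP (dl v); elim: n v => // n IH v dn vW.
have [->|vr] := eqVneq v r.
  case: dP => rW -> _ _; exists [set r]; split; [exact: epath0 | by rewrite sub1set |].
  by move=> t /set1P; left.
have [u [uW uv du]] := distance_parent vW vr.
have [|P [Pp sP hP]] := IH u _ uW; first by rewrite -ltnS -du.
exists (v |: P); split.
- rewrite du; apply/epath_sym/(epath_consl _ (epath_sym Pp)); first by rewrite adj_sym.
  by apply/negP=> /hP[E|]; [rewrite E adj_irrefl in uv | rewrite du; clear; lia].
- by rewrite subUset sub1set vW.
- move=> t /setU1P[->|/hP[->|h]]; first by left.
    by right; rewrite du.
  by right; rewrite du; apply: ltnW.
Qed.

(* Two geodesics from the same level, followed until they meet. *)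
Lemma twin_path u v k : u \in W -> v \in W -> u != v -> dl u = k -> dl v = k ->
  exists P j, [/\ epath P u v (2 * j), 0 < j, j <= k & P \subset W /\
    forall t, t \in P -> [\/ t = u, t = v | dl t < k]].
Proof.
elim: k u v => [|k IH] u v uW vW uv du dv.
  by rewrite (distance_eq0 uW du) (distance_eq0 vW dv) eqxx in uv.
have nr t : dl t = k.+1 -> t != r.
  by move=> dt; apply/eqP=> E; case: dP => _; rewrite -E dt.
have [p [pW pu dp]] := distance_parent uW (nr _ du).
have [q [qW qv dq]] := distance_parent vW (nr _ dv).
have {}dp : dl p = k by move: dp; rewrite du => -[].
have {}dq : dl q = k by move: dq; rewrite dv => -[].
rewrite adj_sym in pu; have [E|pq] := eqVneq p q.
  exists (u |: [set p; v]), 1; split=> //; first by apply: epath2; rewrite // E.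
  split; first by rewrite !subUset !sub1set uW pW vW.
  move=> t; rewrite !inE => /or3P[]/eqP->; [exact: Or31 | | exact: Or32].
  by apply: Or33; rewrite dp.
have [P [j [Pp j0 jk [sP hP]]]] := IH _ _ pW qW pq dp dq.
have low t : t \in P -> dl t <= k.
  by move=> /hP[->|->|]; rewrite ?dp ?dq // => /ltnW.
have uP : u \notin P by apply/negP=> /low; rewrite du ltnn.
have vP : v \notin u |: P.
  by rewrite in_setU1 negb_or eq_sym uv; apply/negP=> /low; rewrite dv ltnn.
exists (v |: (u |: P)), j.+1; split=> //.
- have vq : adj v q by rewrite adj_sym.
  have := epath_sym (epath_consl vq (epath_sym (epath_consl pu Pp uP)) vP).
  by rewrite mulnS add2n.
- split; first by rewrite !subUset !sub1set uW vW.
  move=> t /setU1P[->|/setU1P[->|/low tk]]; [exact: Or32 | exact: Or31 |].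
  by apply: Or33.
Qed.

End Fixed.
End Distance.

(** * Edges inside a distance layer *)

Section Layers.
Variables (G : sgraph) (l : nat).
Implicit Types (x y z t u v w a b c d e f g h p q s : G) (P : {set G}).
Hypotheses (l2 : 2 <= l) (odl : odd_lengths G l).
Hypothesis noK4 : forall a b c d : G, adj a b -> adj a c -> adj b c ->
  adj a d -> adj b d -> adj c d -> False.
Hypothesis books : forall x y z : G, adj x y -> adj x z -> adj y z ->
  exists e, [/\ e != x, e != y & e != z] /\
    [\/ adj e x && adj e y, adj e x && adj e z | adj e y && adj e z].
Hypothesis spine_degree : forall a b c d v : G, adj a b -> adj a c -> adj b c ->
  adj a d -> adj b d -> c != d -> adj a v -> [\/ v = b, v = c | v = d].

Variables (a b r r' : G).
Hypotheses (nab : a != b) (ra : adj r a) (rb : adj r b).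
Let W := ~: [set a; b].
Hypothesis ends : forall v, v \in W -> adj v a || adj v b -> v = r \/ v = r'.
Variables (dl dl' : G -> nat).
Hypotheses (dP : distance_on W r dl) (dP' : distance_on W r' dl').
Hypothesis lower : forall v, v \in W -> 2 * l <= dl v + dl' v.
Hypothesis upper : forall P k, epath P r r' k -> P \subset W -> k <= 2 * l + 1.

(** A vertex other than [v] common to the geodesics from [r] to [u] and from [r'] to [v] would have
    distance sum below [2 * l]. So the geodesics and [P] form one path from [r] to [r'], to which
    [upper] applies. *)
Lemma cross_path P u v k : epath P u v k -> P \subset W -> dl u + dl' v <= 2 * l ->
  (forall t, t \in P -> t = u \/ dl u <= dl t) ->
  (forall t, t \in P -> t = v \/ dl' v <= dl' t) -> dl u + k + dl' v <= 2 * l + 1.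
Proof.
move=> Pp sP le hu hv.
have uW := subsetP sP _ (epath_start Pp); have vW := subsetP sP _ (epath_end Pp).
have [A [Ap sA hA]] := geodesic dP uW; have [B [Bp sB hB]] := geodesic dP' vW.
have AP : epath (A :|: P) r v (dl u + k).
  by apply: epath_cat Ap Pp _ => t /hA[//|lt] /hu[//|]; rewrite leqNgt lt.
apply: upper (epath_cat AP (epath_sym Bp) _) _; last by rewrite !subUset sA sP.
move=> t; rewrite in_setU => /orP[tA tB|tP /hB[//|lt]]; last first.
  by case: (hv t tP) => //; rewrite leqNgt lt.
have := lower (subsetP sA t tA); case: (hB t tB) => [//|lv].
by case: (hA t tA) => [tu|lu]; rewrite ?tu; move: le lv; rewrite ?tu; last move: lu; clear; lia.
Qed.

(** Distinct parents would be joined by a path of length [2 * j] that stays at their level or below;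
    with [s] and [t] it closes a cycle of length [2 * j + 3], where [0 < j < l]. *)
Lemma unique_parent s t p q : s \in W -> t \in W -> p \in W -> q \in W -> adj s t ->
  adj p s -> adj q t -> dl s = dl t -> dl s <= l ->
  dl s = (dl p).+1 -> dl t = (dl q).+1 -> p = q.
Proof.
move=> sW tW pW qW st ps qt E sl dp dq; apply/eqP; apply: contraT => pq.
have Epq : dl q = dl p by move: E; rewrite dp dq => -[].
have [P [j [Pp j0 jk [sP hP]]]] := twin_path dP pW qW pq erefl Epq.
have low u : u \in P -> dl u <= dl p by move=> /hP[->|->|/ltnW]; rewrite ?Epq.
have sNP : s \notin P by apply/negP=> /low; rewrite dp ltnn.
have tNP : t \notin s |: P.
  rewrite in_setU1 negb_or eq_sym (adj_neq st); apply/negP=> /low.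
  by rewrite -E dp ltnn.
have sp : adj s p by rewrite adj_sym.
have tq : adj t q by rewrite adj_sym.
have Q := epath_consl tq (epath_sym (epath_consl sp Pp sNP)) tNP.
have nst : t != s by rewrite eq_sym adj_neq.
have ts : adj t s by rewrite adj_sym.
have Q3 : 2 < (2 * j).+2 + 1 by clear -j0; lia.
have h := odd_cycle_length odl Q (epath1 ts) nst _ Q3.
have : (2 * j).+2 + 1 = 3 \/ (2 * j).+2 + 1 = 2 * l + 3.
  apply: h; last by rewrite addn1 /= mul2n odd_double.
  by move=> u _; rewrite !inE => /orP[]/eqP; [left | right].
by move: jk j0 sl; rewrite dp; clear; lia.
Qed.

(** The vertex [e] would make [ps] the middle edge of a diamond, so that [p] has no neighbours but
    [s], [t], [e]. This leaves no room for a parent of [p], or for both [a] and [b] if [p = r]. *)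
Lemma parent_not_spine p s t e : p \in W -> s \in W -> t \in W -> adj p s -> adj p t ->
  adj s t -> dl s = (dl p).+1 -> dl t = (dl p).+1 -> e != t -> adj e p -> adj e s -> False.
Proof.
move=> pW sW tW ps pt st ds dt et ep es.
have pe : adj p e by rewrite adj_sym.
have se : adj s e by rewrite adj_sym.
have te : t != e by rewrite eq_sym.
have deg v := spine_degree (v := v) ps pt st pe se te.
have nW v : v \in W -> a != v /\ b != v.
  by rewrite !inE negb_or ![v == _]eq_sym => /andP[].
have [pr|pr] := eqVneq p r.
  have [as_ bs] := nW s sW; have [at_ bt] := nW t tW.
  move: (deg a) (deg b); rewrite pr ra rb => /(_ isT) ha /(_ isT) hb.
  case: ha => E; rewrite E ?eqxx // in as_ at_ *.
  by case: hb => E'; move: nab bs bt; rewrite E E' eqxx.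
have [p0 [p0W p0p dp]] := distance_parent dP pW pr.
have pp0 : adj p p0 by rewrite adj_sym.
case: (deg p0 pp0) => E; subst p0.
- by move: ds dp; clear; lia.
- by move: dt dp; clear; lia.
- by have := distance_step dP p0W sW es; move: ds dp; clear; lia.
Qed.

(** All three would have the same parent [p], and the triangles on [pg] with [h] and with [f] would
    make [pg] a middle edge. *)
Lemma no_three_in_layer h g f : h \in W -> g \in W -> f \in W -> adj h g -> adj g f ->
  h != f -> dl h = dl g -> dl f = dl g -> 0 < dl g -> dl g <= l -> False.
Proof.
move=> hW gW fW hg gf hf dh df d0 dlg.
have nr v : dl v = dl g -> v != r.
  by move=> E; apply: contraTneq d0 => E'; case: dP => _ E2 _ _; rewrite -E E' E2.
have [p [pW pg dp]] := distance_parent dP gW (nr g erefl).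
have [p1 [p1W p1h dp1]] := distance_parent dP hW (nr h dh).
have [p2 [p2W p2f dp2]] := distance_parent dP fW (nr f df).
have gh : adj g h by rewrite adj_sym.
have E1 := unique_parent gW hW pW p1W gh pg p1h (esym dh) dlg dp dp1.
have E2 := unique_parent gW fW pW p2W gf pg p2f (esym df) dlg dp dp2.
subst p1 p2; apply: (parent_not_spine (e := f) pW gW hW) => //.
- by rewrite eq_sym.
- by rewrite adj_sym.
- by rewrite adj_sym.
Qed.

(** The triangle on [s], [t] and their common parent lies in a diamond. The middle edge cannot
    contain the parent, so it is [st], and [t] has degree 3. *)
Lemma twin_book s t : s \in W -> t \in W -> adj s t -> dl s = dl t -> 0 < dl t -> dl t <= l ->
  exists p e, [/\ p \in W, e \in W, adj p s & adj p t] /\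
    [/\ dl t = (dl p).+1, adj e s, adj e t & forall v, adj t v -> [\/ v = s, v = p | v = e]].
Proof.
move=> sW tW st dst d0 dtl.
have nr v : dl v = dl t -> v != r.
  by move=> E; apply: contraTneq d0 => E'; case: dP => _ E2 _ _; rewrite -E E' E2.
have [p [pW ps dp]] := distance_parent dP sW (nr s dst).
have [q [qW qt dq]] := distance_parent dP tW (nr t erefl).
have dsl : dl s <= l by rewrite dst.
have E := unique_parent sW tW pW qW st ps qt dst dsl dp dq; subst q.
have ts : adj t s by rewrite adj_sym.
have dp' : dl t = (dl p).+1 by rewrite -dst.
have [e [[ep es et] H]] := books ps qt st.
case: H => /andP[e1 e2].
- by case: (parent_not_spine pW sW tW ps qt st dp dq et e1 e2).
- by case: (parent_not_spine pW tW sW qt ps ts dq dp es e1 e2).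
have eW : e \in W.
  rewrite !inE negb_or; apply/andP; split; apply/eqP=> E; subst e.
  - have := ends sW; have := ends tW; rewrite ![adj _ a]adj_sym e1 e2 /= => /(_ isT) h1 /(_ isT) h2.
    case: h1 h2 => [E|E]; first by have := nr t erefl; rewrite E eqxx.
    case=> [E'|E']; first by have := nr s dst; rewrite E' eqxx.
    by move: st; rewrite E E' adj_irrefl.
  - have := ends sW; have := ends tW; rewrite ![adj _ b]adj_sym e1 e2 /= !orbT => /(_ isT) h1 /(_ isT) h2.
    case: h1 h2 => [E|E]; first by have := nr t erefl; rewrite E eqxx.
    case=> [E'|E']; first by have := nr s dst; rewrite E' eqxx.
    by move: st; rewrite E E' adj_irrefl.
exists p, e; split; split=> // v tv.
have tp : adj t p by rewrite adj_sym.
have sp : adj s p by rewrite adj_sym.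
have te : adj t e by rewrite adj_sym.
have se : adj s e by rewrite adj_sym.
have pe : p != e by rewrite eq_sym.
exact: spine_degree ts tp sp te se pe tv.
Qed.

Let lev v := minn (dl v) (dl' v).

(** Keeps the third colour off both ends of an edge between consecutive levels: [s] and [q] are the
    neighbours on account of which [t] and [v] would take it. By [twin_book], [v] is the far tip [e]
    of the diamond on [st], with both [s] and [t] one level below it. *)
Lemma no_red_pair s t v q : s \in W -> t \in W -> v \in W -> q \in W -> adj s t ->
  adj t v -> adj q v -> dl s = dl t -> lev s = dl s -> lev t = dl t -> 0 < dl t ->
  lev v = (dl t).+1 -> lev q = lev v -> lev v <= l -> False.
Proof.
move=> sW tW vW qW st tv qv dst ls lt d0 lv lq lvl.
have dtl : dl t <= l by move: lvl; rewrite lv => /ltnW.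
have [p [e [[pW eW ps pt] [dp es et deg]]]] := twin_book sW tW st dst d0 dtl.
have E : v = e.
  case: (deg v tv) => // E; subst v; exfalso.
    by move: lv; rewrite ls dst; clear; lia.
  by move: lv; rewrite /lev dp; clear; lia.
subst v.
have te : adj t e by rewrite adj_sym.
have se : adj s e by rewrite adj_sym.
have de : dl e = (dl t).+1.
  apply/eqP; rewrite eqn_leq (distance_step dP tW eW te) /=.
  by rewrite -lv /lev geq_minl.
have eq : adj e q by rewrite adj_sym.
(* On the same side, a parent of [q] would coincide with both parents [s] and [t] of [e]. *)
have [dq|dq] := eqVneq (dl q) (dl e).
  have qr : q != r.
    by apply/eqP=> E; case: dP => _ E2 _ _; move: dq; rewrite E E2 de.
  have [p1 [p1W p1q dp1]] := distance_parent dP qW qr.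
  have del : dl e <= l by rewrite de -lv.
  have des : dl e = (dl s).+1 by rewrite de dst.
  have E1 := unique_parent eW qW tW p1W eq te p1q (esym dq) del de dp1.
  have E2 := unique_parent eW qW sW p1W eq se p1q (esym dq) del des dp1.
  by move: st; rewrite E1 E2 adj_irrefl.
have dq' : dl' q = (dl t).+1.
  by move: dq lq lv; rewrite /lev de; clear; lia.
have qe : q != e by apply: contraNneq dq => ->.
have ge q' : q' \in W -> 2 * l <= dl q' + dl' q' := @lower q'.
have step1 := distance_step dP eW qW eq.
(* Now [q] is close to [r'] but within one step of [e]; the lower bound on distance sums leaves only
   level [l] for [e] and [q]. *)
have il : (dl t).+1 = l.
  by have := ge q qW; move: lvl step1; rewrite lv dq' de; clear; lia.
have tNe : t \notin [set e; q].
  rewrite !inE negb_or (adj_neq te); apply/eqP=> E; subst q.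
  by move: lq; rewrite lt lv; clear; lia.
have sN : s \notin t |: [set e; q].
  rewrite !inE !negb_or (adj_neq st) (adj_neq se) /=; apply/eqP=> E; subst q.
  by move: lq; rewrite ls lv dst; clear; lia.
have dpq : dl q >= l by have := lq; rewrite lv il /lev; clear; lia.
have pN : p \notin s |: (t |: [set e; q]).
  rewrite !inE !negb_or (adj_neq ps) (adj_neq pt) /=; apply/andP; split; apply/eqP=> E; subst p.
    by move: de dp; clear; lia.
  by move: dpq dp il; clear; lia.
(* The path [p s t e q] has 4 edges, starts at distance [l - 2] from [r] and ends at distance [l]
   from [r']: in total [2 * l + 2], one too many. *)
have Q := epath_consl ps (epath_consl st (epath_consl te (epath1 eq) tNe) sN) pN.
have sQ : p |: (s |: (t |: [set e; q])) \subset W.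
  by rewrite !subUset !sub1set pW sW tW eW qW.
have := cross_path Q sQ.
have ds' := ge s sW; have dt' := ge t tW.
rewrite dq' => /(_ _ _ _); have le1 : dl p + (dl t).+1 <= 2 * l by move: dp il; clear; lia.
move=> /(_ le1) H; have : dl p + 4 + (dl t).+1 <= 2 * l + 1; last by move: dp il; clear; lia.
apply: H => u; rewrite !inE => /orP[/eqP->|/orP[/eqP->|/or3P[]/eqP->]];
  try by [left]; right; try (move: dp dst de il dpq; clear; lia).
- have := ge p pW; move: dp il; clear; lia.
- by move: ds' dst il; clear; lia.
- by move: dt' il; clear; lia.
- by have := lv; rewrite /lev; clear; lia.
Qed.

End Layers.

(** * The colouring by layers *)

Section LayeredColouring.
Variables (G : sgraph) (l : nat).
Implicit Types (x y z t u v w e f g h p q s : G) (P : {set G}).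
Hypotheses (l2 : 2 <= l) (odl : odd_lengths G l) (cr : vertex_critical G 3).
Hypothesis noK4 : forall a b c d : G, adj a b -> adj a c -> adj b c ->
  adj a d -> adj b d -> adj c d -> False.
Hypothesis books : forall x y z : G, adj x y -> adj x z -> adj y z ->
  exists e, [/\ e != x, e != y & e != z] /\
    [\/ adj e x && adj e y, adj e x && adj e z | adj e y && adj e z].

Variables (a b c d : G).
Hypotheses (ab : adj a b) (ac : adj a c) (bc : adj b c) (ad : adj a d) (bd : adj b d).
Hypothesis cd : c != d.
Let W := ~: [set a; b].

Let spine_degree := @diamond_degree G l l2 odl cr noK4.

Lemma spine_ends v : v \in W -> adj v a || adj v b -> v = c \/ v = d.
Proof.
rewrite !inE negb_or => /andP[va vb].
have ba : adj b a by rewrite adj_sym.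
case/orP; rewrite adj_sym => h.
- by case: (spine_degree ab ac bc ad bd cd h) => E; [rewrite E eqxx in vb | left | right].
- by case: (spine_degree ba bc ac bd ad cd h) => E; [rewrite E eqxx in va | left | right].
Qed.

Lemma cd_nonadj : adj c d = false.
Proof. by apply/negP=> h; apply: noK4 ab ac bc ad bd h. Qed.

Lemma c_off_spine : c \in W.
Proof. by rewrite !inE negb_or ![c == _]eq_sym (adj_neq ac) (adj_neq bc). Qed.

Lemma d_off_spine : d \in W.
Proof. by rewrite !inE negb_or ![d == _]eq_sym (adj_neq ad) (adj_neq bd). Qed.

(** By [spine_ends] a path in [W] meets no common neighbour of [a] and [b] besides [c] and [d], so
    [ext_common] applies with the complement of the book as [D]. *)
Lemma cd_path_length P k : epath P c d k -> P \subset W -> k = 2 * l \/ k = 2 * l + 1.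
Proof.
move=> Pp sP.
have cN : c \in common a b by rewrite inE ac bc.
have dN : d \in common a b by rewrite inE ad bd.
have k1 : 1 < k.
  case: k Pp => [/epath_nil[E _]|[|//]]; first by have := cd; rewrite E eqxx.
  case/epath_step=> t [V [ct /epath_nil[E _] _ _]].
  by have := cd_nonadj; rewrite -E ct.
have DR t : t \in ~: book a b -> t \notin book a b by rewrite inE.
apply: (ext_common odl ab DR cN dN cd k1).
exists P => //; apply/subsetP=> t tP; rewrite in_setU in_setC; have tW := subsetP sP t tP.
have [/setUP[tab|]|_] := boolP (t \in book a b); last by rewrite orbT.
  by rewrite /W in_setC tab in tW.
rewrite inE => /andP[at_ _]; have := spine_ends tW; rewrite adj_sym at_ => /(_ isT).
by case=> ->; rewrite !inE eqxx ?orbT.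
Qed.

Variables dc dd : G -> nat.
Hypotheses (cP : distance_on W c dc) (dP : distance_on W d dd).

(** The triangle inequality along a geodesic to [d], since [c] and [d] are at distance at least
    [2 * l]. *)
Lemma dist_lower v : v \in W -> 2 * l <= dc v + dd v.
Proof.
have d0 : dd d = 0 by case: dP.
have dcd : 2 * l <= dc d.
  have [P [Pp sP _]] := geodesic cP d_off_spine.
  by case: (cd_path_length Pp sP) => ->; clear; lia.
have [n] := ubnP (dd v); elim: n v => // n IH v vn vW.
have [->|vd] := eqVneq v d; first by rewrite d0 addn0.
have [u [uW uv du]] := distance_parent dP vW vd.
have := IH u _ uW; rewrite du in vn * => /(_ vn).
have vu : adj v u by rewrite adj_sym.
by have := distance_step cP vW uW vu; clear; lia.
Qed.

Lemma dist_upper P k : epath P c d k -> P \subset W -> k <= 2 * l + 1.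
Proof. by move=> Pp sP; case: (cd_path_length Pp sP) => ->; clear; lia. Qed.

Let lev v := minn (dc v) (dd v).

(** A fan from [v] to [c] and [d] is a path from [c] to [d] through [v], of length at most
    [2 * l + 1]; its shorter part has at most [l] edges. *)
Lemma lev_le v : v \in W -> lev v <= l.
Proof.
move=> vW.
have [->|vc] := eqVneq v c; first by rewrite /lev; case: cP => _ -> _ _; rewrite min0n.
have [->|vd] := eqVneq v d; first by rewrite /lev; case: dP => _ -> _ _; rewrite minn0.
have cX : c \in [set c; d] by rewrite !inE eqxx.
have dX : d \in [set c; d] by rewrite !inE eqxx orbT.
have vX : v \notin [set c; d] by rewrite !inE negb_or vc vd.
have [W1 [W2 [z1 [z2 [k1 [k2 [[W1p W2p z1X z2X] [dis h1 h2]]]]]]]] :=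
  fan2P (critical_two_connected cr) cX dX cd vX.
pose M := W :\: [set c; d].
have NM u t : u \in M -> adj u t -> t \notin M -> t \in [set c; d].
  move=> /setDP[uW ucd] ut; rewrite in_setD negb_and negbK => /orP[//|tW].
  have : adj u a || adj u b.
    by move: tW ut; rewrite /W in_setC negbK => /set2P[]-> ->; rewrite ?orbT.
  by move/(spine_ends uW)=> E; move: ucd; rewrite !inE; case: E => ->; rewrite eqxx ?orbT.
have vJ : v \in [set c; d] :|: M by rewrite in_setU in_setD vX vW orbT.
have sJ : [set c; d] :|: M \subset W.
  by rewrite !subUset !sub1set c_off_spine d_off_spine subsetDl.
have s1 := subset_trans (epath_trapped NM W1p vJ h1) sJ.
have s2 := subset_trans (epath_trapped NM W2p vJ h2) sJ.
have z12 : z1 != z2.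
  apply/eqP=> E; have zv : z1 = v.
    by apply: dis; [apply: epath_end W1p | rewrite E; apply: epath_end W2p].
  by rewrite -zv z1X in vX.
have sum (x y : G) V1 V2 i j : epath V1 v x i -> epath V2 v y j -> V1 \subset W -> V2 \subset W ->
    (forall t, t \in V1 -> t \in V2 -> t = v) -> x = c -> y = d -> lev v <= l.
  move=> V1p V2p sV1 sV2 disV E1 E2; subst x y.
  have Q := epath_cat (epath_sym V1p) V2p disV.
  have len : i + j <= 2 * l + 1 by apply: dist_upper Q _; rewrite subUset sV1 sV2.
  have := distance_epath cP (epath_sym V1p) sV1; have := distance_epath dP (epath_sym V2p) sV2.
  case: cP => _ -> _ _; case: dP => _ -> _ _; rewrite /lev.
  by move: len; clear; lia.
move: z1X z2X z12; rewrite !inE => /orP[]/eqP E1 /orP[]/eqP E2; rewrite E1 E2 ?eqxx // => _.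
- exact: (sum _ _ _ _ _ _ W1p W2p).
- apply: (sum _ _ _ _ _ _ W2p W1p) => // t t1 t2; exact: dis.
Qed.

(* Levels are coloured by their parity; of two adjacent vertices on one level, the one
   that is larger for [key] gets the third colour. *)
Let cls v := if dc v < dd v then 0 else if dc v == dd v then 1 else 2.
Let key v := cls v * #|G| + enum_rank v.

Lemma key_inj : injective key.
Proof.
move=> u v E; apply/enum_rank_inj/val_inj => /=.
by have := congr1 (modn^~ #|G|) E; rewrite /= /key !modnMDl !modn_small ?ltn_ord.
Qed.

Lemma key_cls u v : key u < key v -> cls u <= cls v.
Proof.
move=> k; rewrite leqNgt; apply/negP=> lt.
have : (cls v).+1 * #|G| <= cls u * #|G| by rewrite leq_mul2r lt orbT.
have := ltn_ord (enum_rank v); move: k; rewrite /key mulSn.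
move: (cls u * _) (cls v * _) (nat_of_ord _) (nat_of_ord _) => m n i j.
by move: #|G| => N; clear; lia.
Qed.

Lemma lev0 v : v \in W -> lev v = 0 -> v = c \/ v = d.
Proof.
move=> vW; rewrite /lev; have [le|lt] := leqP (dc v) (dd v) => E.
  by left; apply: (distance_eq0 cP).
by right; apply: (distance_eq0 dP).
Qed.

Lemma lev_pos u v : u \in W -> v \in W -> adj u v -> lev u = lev v -> 0 < lev v.
Proof.
move=> uW vW uv E; rewrite lt0n; apply/eqP=> v0; rewrite v0 in E.
move: uv; case: (lev0 uW E) => ->; case: (lev0 vW v0) => ->;
  by rewrite ?adj_irrefl 1?[adj d c]adj_sym ?cd_nonadj.
Qed.

Let dist_lower' v (vW : v \in W) : 2 * l <= dd v + dc v.
Proof. by rewrite addnC; apply: dist_lower. Qed.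

Let dist_upper' P k : epath P d c k -> P \subset W -> k <= 2 * l + 1.
Proof. by move=> /epath_sym; apply: dist_upper. Qed.

Let spine_ends' v : v \in W -> adj v a || adj v b -> v = d \/ v = c.
Proof. by move=> vW h; case: (spine_ends vW h); [right | left]. Qed.

(** Below level [l], if [u] were near [c] only and [v] near [d] only, the distance sum of [u] would
    be at most [2 * lev v + 1 < 2 * l]. *)
Lemma same_side_level u v : u \in W -> v \in W -> adj u v -> lev u = lev v -> lev v < l ->
  (dc u = lev v /\ dc v = lev v) \/ (dd u = lev v /\ dd v = lev v).
Proof.
move=> uW vW uv E vl; have vu : adj v u by rewrite adj_sym.
have := dist_lower uW; have := dist_lower vW; move: E vl; rewrite /lev.
have := distance_step cP uW vW uv; have := distance_step cP vW uW vu.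
have := distance_step dP uW vW uv; have := distance_step dP vW uW vu.
by clear; lia.
Qed.

(** Two adjacent third-coloured vertices on one level would give such a chain. If it stays on one
    side, [no_three_in_layer] applies. Sides can change at level [l] only, and there [cls], which
    puts the side of [c] first, makes the chain run from [dc h = l] to [dd f = l]; then [cross_path]
    is violated by [l + 2 + l]. *)
Lemma no_layer_chain h g f : h \in W -> g \in W -> f \in W -> adj h g -> adj g f ->
  lev h = lev g -> lev f = lev g -> key h < key g -> key g < key f -> False.
Proof.
move=> hW gW fW hg gf lh lf khg kgf.
have hf : h != f.
  by apply: contraTneq (ltn_trans khg kgf) => ->; rewrite ltnn.
have g0 := lev_pos hW gW hg lh; have gl := lev_le gW.
have nab := adj_neq ab.
have ca : adj c a by rewrite adj_sym.
have cb : adj c b by rewrite adj_sym.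
have da : adj d a by rewrite adj_sym.
have db : adj d b by rewrite adj_sym.
have three_c : dc h = lev g -> dc g = lev g -> dc f = lev g -> False.
  move=> E1 E2 E3; apply: (no_three_in_layer odl spine_degree nab ca cb cP hW gW fW hg gf hf);
    by rewrite ?E1 ?E2 ?E3.
have three_d : dd h = lev g -> dd g = lev g -> dd f = lev g -> False.
  move=> E1 E2 E3; apply: (no_three_in_layer odl spine_degree nab da db dP hW gW fW hg gf hf);
    by rewrite ?E1 ?E2 ?E3.
have [ll|lg] := ltnP (lev g) l.
  have fg : adj f g by rewrite adj_sym.
  case: (same_side_level hW gW hg lh ll) => -[h1 h2]; case: (same_side_level fW gW fg lf ll) => -[h3 h4].
  - exact: three_c.
  - by have := dist_lower gW; rewrite h2 h4; move: ll; clear; lia.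
  - by have := dist_lower gW; rewrite h2 h4; move: ll; clear; lia.
  - exact: three_d.
have El : lev g = l by apply/eqP; rewrite eqn_leq gl lg.
have c1 := key_cls khg; have c2 := key_cls kgf.
have [/andP[/eqP dh /eqP df]|nb] := boolP ((dc h == l) && (dd f == l)).
  have s2 : h |: [set g; f] \subset W by rewrite !subUset !sub1set hW gW fW.
  have lev_ge t : t \in h |: [set g; f] -> l <= lev t.
    by rewrite !inE => /or3P[]/eqP->; rewrite ?lh ?lf El.
  have le2 : dc h + dd f <= 2 * l by rewrite dh df; clear; lia.
  have := cross_path cP dP dist_lower dist_upper (epath2 hg gf hf) s2 le2.
  rewrite dh df => H; have : l + 2 + l <= 2 * l + 1; last by clear; lia.
  by apply: H => t /lev_ge; rewrite /lev leq_min => /andP[h1 h2]; right.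
move: nb lh lf El c1 c2 three_c three_d; rewrite /cls /lev; clear.
case: (ltngtP (dc h) (dd h)); case: (ltngtP (dc g) (dd g)); case: (ltngtP (dc f) (dd f)) => // _ _ _.
all: move=> nb lh lf El _ _ hc hd; first [by apply: hc; move: nb lh lf El; lia | by apply: hd; move: nb lh lf El; lia].
Qed.

Let red v := [exists g in W, [&& adj g v, lev g == lev v & key g < key v]].

(** As [t] lies below level [l], the vertex that makes it red is on its side; [no_red_pair] is
    applied from [c] or from [d] accordingly. *)
Lemma no_red_edge t v : t \in W -> v \in W -> adj t v -> lev v = (lev t).+1 ->
  red t -> red v -> False.
Proof.
move=> tW vW tv lv /exists_inP[s sW /and3P[st /eqP ls _]] /exists_inP[q qW /and3P[qv /eqP lq _]].
have t0 := lev_pos sW tW st ls; have vl := lev_le vW.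
have tl : lev t < l by rewrite -lv.
have nab := adj_neq ab.
have ca : adj c a by rewrite adj_sym.
have cb : adj c b by rewrite adj_sym.
have da : adj d a by rewrite adj_sym.
have db : adj d b by rewrite adj_sym.
case: (same_side_level sW tW st ls tl) => -[h1 h2].
- have lE u : minn (dc u) (dd u) = lev u by [].
  apply: (no_red_pair odl books spine_degree nab ca cb spine_ends cP dP dist_lower dist_upper
    sW tW vW qW st tv qv); rewrite ?lE ?h1 ?h2 //.
- have lE u : minn (dd u) (dc u) = lev u by rewrite minnC.
  apply: (no_red_pair odl books spine_degree nab da db spine_ends' dP cP dist_lower' dist_upper'
    sW tW vW qW st tv qv); rewrite ?lE ?h1 ?h2 //.
Qed.

Lemma layered_colorable : colorable_on 3 [set: G].
Proof.
pose col v : 'I_3 := if red v then inord 2 else inord (odd (lev v)).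
have col_neq u v : ~~ (red u && red v) -> (~~ red u -> ~~ red v -> odd (lev u) != odd (lev v)) ->
    col u != col v.
  rewrite /col -(inj_eq val_inj); case: (red u); case: (red v) => //= _ h;
    case: (odd (lev u)) h; case: (odd (lev v)) => h; rewrite ?inordK //; by have := h isT isT.
have Wcol u v : u \in W -> v \in W -> adj u v -> col u != col v.
  wlog uv_lev : u v / lev u < lev v \/ (lev u = lev v /\ key u < key v).
    move=> wl uW vW uv; have vu : adj v u by rewrite adj_sym.
    have [lt|lt|E] := ltngtP (lev u) (lev v).
    - by apply: wl => //; left.
    - by rewrite eq_sym; apply: wl => //; left.
    - have [lt|lt|K] := ltngtP (key u) (key v).
      + by apply: wl => //; right.
      + by rewrite eq_sym; apply: wl => //; right.
      + by have := adj_neq uv; rewrite (key_inj K) eqxx.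
  move=> uW vW uv; case: uv_lev => [lt|[E lt]].
    have lv : lev v = (lev u).+1.
      have := distance_step cP uW vW uv; have := distance_step dP uW vW uv.
      by move: lt; rewrite /lev; clear; lia.
    apply: col_neq; last by move=> _ _; rewrite lv /=; case: odd.
    by apply/negP=> /andP[]; apply: no_red_edge.
  have rv : red v by apply/exists_inP; exists u; rewrite // uv E eqxx lt.
  apply: col_neq; last by rewrite rv.
  apply/negP=> /andP[/exists_inP[h hW /and3P[hu /eqP lh kh]] _].
  exact: (no_layer_chain hW uW vW hu uv lh (esym E)).
(* Level 0 consists of [c] and [d], which are not adjacent, so neither takes the third colour; this
   leaves 1 and 2 for [a] and [b]. *)
have end0 v : v = c \/ v = d -> col v = inord 0.
  move=> vE; have vW : v \in W by case: vE => ->; [exact: c_off_spine | exact: d_off_spine].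
  have l0 : lev v = 0.
    rewrite /lev; case: vE => ->; first by case: cP => _ -> _ _; rewrite min0n.
    by case: dP => _ -> _ _; rewrite minn0.
  rewrite /col l0 /=; case: ifP => // /exists_inP[h hW /and3P[hv /eqP lh _]].
  by have := lev_pos hW vW hv lh; rewrite l0.
have ninord i j : i < 3 -> j < 3 -> i != j -> inord i != inord j :> 'I_3.
  by move=> i3 j3 ij; rewrite -(inj_eq val_inj) /= !inordK.
exists (fun v => if v == a then inord 1 else if v == b then inord 2 else col v).
have inW v : v != a -> v != b -> v \in W by move=> va vb; rewrite !inE negb_or va.
have nba : b != a by rewrite eq_sym adj_neq.
move=> u v _ _; wlog vW : u v / v \in W.
  move=> wl uv; have [vW|vW] := boolP (v \in W); first exact: wl.
  have [uW|uW] := boolP (u \in W); first by rewrite eq_sym; apply: wl; rewrite // adj_sym.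
  move: uW vW; rewrite !inE !negbK => /orP[]/eqP uE /orP[]/eqP vE; subst u v.
  - by rewrite adj_irrefl in uv.
  - by rewrite eqxx (negPf nba) eqxx; apply: ninord.
  - by rewrite (negPf nba) !eqxx; apply: ninord.
  - by rewrite adj_irrefl in uv.
have [va vb] : v != a /\ v != b by move: vW; rewrite !inE negb_or => /andP[].
rewrite (negPf va) (negPf vb).
have [->|ua] := eqVneq u a => uv.
  by rewrite end0; [exact: ninord | apply: spine_ends; rewrite // adj_sym uv].
have [E|ub] := eqVneq u b; last exact: Wcol (inW _ ua ub) vW uv.
rewrite E in uv.
by rewrite end0; [exact: ninord | apply: spine_ends; rewrite // [adj v b]adj_sym uv orbT].
Qed.

End LayeredColouring.

Lemma books_false (G : sgraph) l (x y z : G) : 2 <= l -> odd_lengths G l -> vertex_critical G 3 ->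
  (forall a b c d : G, adj a b -> adj a c -> adj b c -> adj a d -> adj b d -> adj c d -> False) ->
  (forall x y z : G, adj x y -> adj x z -> adj y z ->
    exists e, [/\ e != x, e != y & e != z] /\
      [\/ adj e x && adj e y, adj e x && adj e z | adj e y && adj e z]) ->
  adj x y -> adj x z -> adj y z -> False.
Proof.
move=> l2 odl cr noK4 books xy xz yz.
have [a [b [c [d [[ab ac bc] [ad bd cd]]]]]] : exists a b c d : G,
    [/\ adj a b, adj a c & adj b c] /\ [/\ adj a d, adj b d & c != d].
  have [e [[ex ey ez] H]] := books x y z xy xz yz.
  case: H => /andP[]; rewrite ![adj e _]adj_sym => h1 h2.
  - by exists x, y, z, e; rewrite eq_sym.
  - by exists x, z, y, e; rewrite eq_sym [adj z y]adj_sym.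
  - by exists y, z, x, e; rewrite eq_sym [adj y x]adj_sym [adj z x]adj_sym.
case: (cr) => + _; case.
have con u v : u \in ~: [set a; b] -> v \in ~: [set a; b] -> connect (radj (~: [set a; b])) u v.
  by rewrite !in_setC; apply: clique_not_cutset cr (pair_clique ab).
have c_off_spine := c_off_spine ac bc; have d_off_spine := d_off_spine ad bd.
have [dc cP] := distance_exists c_off_spine (fun v => con c v c_off_spine).
have [dd dP] := distance_exists d_off_spine (fun v => con d v d_off_spine).
exact: (layered_colorable l2 odl cr noK4 books ab ac bc ad bd cd cP dP).
Qed.

(** * Reduction to critical graphs *)

Lemma three_critical_false (G : sgraph) l : 2 <= l -> odd_lengths G l -> vertex_critical G 3 ->
  (forall K : {set G}, ~~ K4 K) -> False.
Proof.
move=> l2 odl cr nK4.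
have noK4 (a b c d : G) : adj a b -> adj a c -> adj b c -> adj a d -> adj b d -> adj c d -> False.
  move=> ab ac bc ad bd cd; have := nK4 (d |: [set a; b; c]); rewrite /K4 negb_and.
  have dN : d \notin [set a; b; c].
    by rewrite !inE !negb_or ![d == _]eq_sym (adj_neq ad) (adj_neq bd) (adj_neq cd).
  have cN : c \notin [set a; b] by rewrite !inE negb_or ![c == _]eq_sym (adj_neq ac) (adj_neq bc).
  case/orP; last first.
    by rewrite cardsU1 dN [[set a; b; c]]setUC cardsU1 cN cards2 (adj_neq ab).
  have c3 := triple_clique ab ac bc; case/negP; apply/cliqueP=> x y.
  have dadj t : t \in [set a; b; c] -> adj t d.
    by rewrite !inE -orbA => /or3P[]/eqP->.
  case/setU1P=> [->|x3] /setU1P[->|y3]; rewrite ?eqxx // => xy.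
  - by rewrite adj_sym dadj.
  - exact: dadj.
  - exact: c3.
have [[x [y [z [xy xz yz]]]]|nt] :=
  classic (exists x y z : G, [/\ adj x y, adj x z & adj y z]); last first.
  apply: (triangle_free_critical_false l2 odl cr) => x y z xy yz.
  by apply/negP=> xz; case: nt; exists x, y, z.
apply: (books_false l2 odl cr noK4 _ xy xz yz) => {}x {}y {}z {}xy {}xz {}yz.
have [//|no] := classic (exists e, [/\ e != x, e != y & e != z] /\
  [\/ adj e x && adj e y, adj e x && adj e z | adj e y && adj e z]).
exfalso; apply: (isolated_triangle_false l2 odl cr xy xz yz) => e.
rewrite !inE !negb_or -andbA => /and3P[ex ey ez].
by split; apply/negP=> h; case: no; exists e; split=> //;
  [apply: Or31 | apply: Or32 | apply: Or33].
Qed.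

(** * Induced subgraphs *)

Section Induced.
Variables (G : sgraph) (S : {set G}).

Definition induced_adj : rel {x : G | x \in S} := relpre val (@adj G).
Lemma induced_sym : symmetric induced_adj.
Proof. by move=> x y; rewrite /induced_adj /= adj_sym. Qed.
Lemma induced_irrefl : irreflexive induced_adj.
Proof. by move=> x; rewrite /induced_adj /= adj_irrefl. Qed.
Definition induced := SGraph induced_sym induced_irrefl.

Lemma induced_cycle n : cycle_of_length induced n -> cycle_of_length G n.
Proof.
case=> s [/andP[cs us] sz n3]; exists (map val s); rewrite size_map; split=> //.
by rewrite /ucycle map_inj_uniq ?us ?andbT ?cycle_map //; apply: val_inj.
Qed.

Lemma induced_colorable k (X : {set G}) :
  colorable_on k X -> colorable_on k ([set u | val u \in X] : {set induced}).
Proof.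
case=> f fP; exists (fun u => f (val u)) => u v; rewrite !inE => uX vX uv.
exact: fP.
Qed.

(** The number of colours is written [k.+1] because vertices outside [S] receive the default colour
    [ord0]. *)
Lemma colorable_induced k : colorable_on k.+1 [set: induced] -> colorable_on k.+1 S.
Proof.
case=> f fP; exists (fun x => if insub x is Some u then f u else ord0) => x y xS yS xy.
by rewrite !insubT; apply: fP.
Qed.

Lemma induced_K4 (K : {set induced}) : K4 K -> K4 (val @: K) /\ val @: K \subset S.
Proof.
case/andP=> /cliqueP cK cardK; split; last first.
  by apply/subsetP=> _ /imsetP[u _ ->]; apply: (valP u).
rewrite /K4 card_imset ?cardK ?andbT; last exact: val_inj.
apply/cliqueP=> _ _ /imsetP[u uK ->] /imsetP[v vK ->] uv.
by apply: (cK u v) => //; apply: contraNneq uv => ->.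
Qed.

End Induced.

(** Vertices are removed as long as the set stays uncolourable; a minimal such set is critical. *)
Lemma critical_subset (G : sgraph) k (S : {set G}) : ~ colorable_on k.+1 S ->
  exists T : {set G}, T \subset S /\ vertex_critical (induced T) k.+1.
Proof.
have [n] := ubnP #|S|; elim: n S => // n IH S cardS nS.
have [[v [vS nv]]|all_col] := classic (exists v, v \in S /\ ~ colorable_on k.+1 (S :\ v)).
  have [|T [sT cT]] := IH (S :\ v) _ nv.
    by move: cardS; rewrite (cardsD1 v S) vS.
  by exists T; split=> //; apply: subset_trans sT (subsetDl _ _).
exists S; split=> //; split; first by move/colorable_induced.
move=> v; have col : colorable_on k.+1 (S :\ val v).
  have [//|nc] := classic (colorable_on k.+1 (S :\ val v)).
  by case: all_col; exists (val v); split=> //; apply: (valP v).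
have := @induced_colorable G S _ _ col; apply: colorable_on_sub; apply/subsetP=> u.
by rewrite !inE => uv; rewrite (valP u) andbT.
Qed.

Lemma odd_lengths_induced (G : sgraph) l (S : {set G}) :
  odd_lengths G l -> odd_lengths (induced S) l.
Proof. by move=> odl n /induced_cycle; apply: odl. Qed.

Lemma K4_free_three_colorable (G : sgraph) l (S : {set G}) : 2 <= l -> odd_lengths G l ->
  (forall K : {set G}, K \subset S -> ~~ K4 K) -> colorable_on 3 S.
Proof.
move=> l2 odl nK4; have [//|/critical_subset[T [sT cT]]] := classic (colorable_on 3 S).
exfalso; apply: (three_critical_false l2 (odd_lengths_induced odl) cT) => K.
apply/negP=> /induced_K4[kK sK]; have := nK4 _ (subset_trans sK sT); by rewrite kK.
Qed.

Lemma four_colorable (G : sgraph) l : 2 <= l -> odd_lengths G l -> colorable_on 4 [set: G].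
Proof.
move=> l2 odl; have [//|/critical_subset[T [_ cT]]] := classic (colorable_on 4 [set: G]).
exfalso; apply: (four_critical_false l2 (odd_lengths_induced odl) cT) => S.
exact: K4_free_three_colorable l2 (odd_lengths_induced odl).
Qed.

Lemma colorable_onP (G : sgraph) k : reflect (colorable_on k [set: G]) (colorable G k).
Proof.
apply: (iffP existsP) => [[f /forallP fP]|[f fP]].
  by exists f => x y _ _ xy; have /forallP/(_ y)/implyP := fP x; apply.
exists [ffun x => f x]; apply/forallP=> x; apply/forallP=> y; apply/implyP=> xy.
by rewrite !ffunE; apply: fP.
Qed.

Lemma clique_le_colors (G : sgraph) k (K : {set G}) : colorable G k -> clique K -> #|K| <= k.
Proof.
move=> /colorable_onP[f fP] /cliqueP cK; rewrite -[k]card_ord.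
apply: (@leq_card_in _ _ f) => x y xK yK E; apply/eqP; apply: contraT => xy.
by have := fP x y; rewrite !inE E eqxx => /(_ isT isT (cK _ _ xK yK xy)).
Qed.

Theorem theorem1 (l : nat) (hl : 2 <= l) (G : sgraph)
    (hL : odd_cycle_lengths G =i [:: 3; 3 + 2 * l]) :
  chromatic_number G = maxn 3 (clique_number G).
Proof.
have odl : odd_lengths G l.
  move=> n [s [cs sz n3]] on; have := hL n; rewrite !inE /= on /has_cycle n3 /=.
  have -> : [exists s : n.-tuple G, ucycleb (@adj G) s].
    by apply/existsP; rewrite -sz; exists (in_tuple s).
  by rewrite [3 + _]addnC => /esym/orP[]/eqP; [left | right].
(* Since 3 is in [L(G)] there is a triangle, so the clique number is itself the maximum on the
   right-hand side. *)
have [K cK K3] : exists2 K : {set G}, clique K & #|K| = 3.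
  have := hL 3; rewrite !inE /= => /existsP[[[|x [|y [|z [|u p]]]] //= _] /andP[]].
  rewrite /= andbT => /and3P[xy yz zx] /and3P[]; rewrite !inE negb_or => /andP[nxy nxz] nyz _.
  exists [set x; y; z].
    by apply/cliqueP; apply: triple_clique; rewrite // adj_sym.
  by rewrite setUC cardsU1 !inE negb_or ![z == _]eq_sym nxz nyz cards2 nxy.
have w3 : 3 <= clique_number G by rewrite -K3; apply: leq_bigmax_cond.
rewrite (maxn_idPr w3) /chromatic_number; case: ex_minnP => k colk mink.
apply/eqP; rewrite eqn_leq; apply/andP; split; last first.
  by apply/bigmax_leqP=> K' cK'; apply: clique_le_colors.
(* With a K4, four colours suffice and the clique number is at least 4; without one, three colours
   suffice. *)
have [[K' kK']|nK4] := classic (exists K' : {set G}, K4 K').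
  apply: leq_trans (mink 4 _) _; first exact/colorable_onP/(four_colorable hl odl).
  by case/andP: kK' => cK' /eqP <-; apply: leq_bigmax_cond.
apply: leq_trans (mink 3 _) w3; apply/colorable_onP.
apply: (K4_free_three_colorable hl odl) => K' _; apply/negP=> kK'.
by apply: nK4; exists K'.
Qed.
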